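(* Let $\mathfrak{g}$ be a finite-dimensional complex Lie algebra and $V$ a complex vector space with basis $\{A_n\mid n\in\mathbb{Z}\}$. Then for given $e_1,e_2\in\mathbb{C}$ the vector space $\mathfrak{g}\otimes V$ carries the structure of a Lie algebra given by the bilinear extension of $$[x\otimes A_n,y\otimes A_m]=\begin{cases}[x,y]\otimes A_{n+m},&\text{if } n \text{ or } m \text{ is even},\\ [x,y]\otimes A_{n+m}+3e_1[x,y]\otimes A_{n+m-2}\\ \quad+(e_1-e_2)(2e_1+e_2)[x,y]\otimes A_{n+m-4},&\text{if } n \text{ and } m \text{ are both odd},\end{cases}$$ for $x,y\in\mathfrak{g}$, $n,m\in\mathbb{Z}$. In particular, these algebras define a two-parameter family of deformations (over the base $\mathbb{C}[e_1,e_2]$) of the classical current algebra $\overline{\mathfrak{g}}=\mathfrak{g}\otimes\mathbb{C}[z^{-1},z]$, such that $\overline{\mathfrak{g}}$ corresponds to the point $(0,0)$ (with $A_n=z^n$), and the algebra over a point $(e_1,e_2)$ with $e_1,e_2,e_3:=-(e_1+e_2)$ pairwise distinct is the elliptic current algebra $\overline{\mathcal{G}}_{(e_1,e_2)}=\mathfrak{g}\otimes\mathcal{A}_{(e_1,e_2)}$.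
   Context: The classical current algebra $\overline{\mathfrak{g}}=\mathfrak{g}\otimes\mathbb{C}[z^{-1},z]$ has bracket $[x\otimes z^n,y\otimes z^m]=[x,y]\otimes z^{n+m}$. For $e_1,e_2,e_3=-(e_1+e_2)$ pairwise distinct, $E_{(e_1,e_2)}\subset\mathbb{P}^2(\mathbb{C})$ is the elliptic curve $Y^2Z=4(X-e_1Z)(X-e_2Z)(X-e_3Z)$, $\mathcal{A}_{(e_1,e_2)}$ is the algebra of meromorphic functions on it that are holomorphic outside the two points $\infty=(0:1:0)$ and $(e_1,0)$ (affine coordinates), and $\mathfrak{g}\otimes\mathcal{A}_{(e_1,e_2)}$ has bracket $[x\otimes f,y\otimes g]=[x,y]\otimes fg$. Deformation: let $A$ be a commutative unital $\mathbb{C}$-algebra with a $\mathbb{C}$-algebra homomorphism $\epsilon:A\to\mathbb{C}$ (augmentation), $m=\operatorname{Ker}\epsilon$. A (global) deformation of a Lie algebra $\mathcal{L}$ with base $(A,m)$ is a Lie $A$-algebra structure on $A\otimes_{\mathbb{C}}\mathcal{L}$ such that $\epsilon\otimes\mathrm{id}:A\otimes\mathcal{L}\to\mathbb{C}\otimes\mathcal{L}=\mathcal{L}$ is a Lie algebra homomorphism. Here $A=\mathbb{C}[e_1,e_2]$ and $\epsilon$ is evaluation at $(0,0)$; the algebra over a point is obtained by evaluating $e_1,e_2$ at that point. *)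

(* Defs.v *)
From HB Require Import structures.
From mathcomp Require Import all_boot all_order all_algebra complex ring.
(* mpoly must be loaded before MathComp-Analysis: in the other order their
   notations clash. *)
From mathcomp.multinomials Require Import mpoly freeg.
From mathcomp Require Import all_classical all_reals all_analysis.
Import numFieldNormedType.Exports.
Import Order.TTheory GRing.Theory Num.Theory.

Set Implicit Arguments.
Unset Strict Implicit.
Unset Printing Implicit Defensive.

Local Open Scope classical_set_scope.
Local Open Scope ring_scope.
Local Open Scope quotient_scope.

Definition bilinear_map (K : comNzRingType) (U V W : lmodType K)
    (b : U -> V -> W) : Prop :=
  (forall v, linear (b^~ v)) /\ (forall u, linear (b u)).

Definition is_basis (K : comNzRingType) (V : lmodType K) (I : eqType)
    (A : I -> V) : Prop :=
  (forall (s : seq I) (c : I -> K), uniq s ->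
     \sum_(i <- s) c i *: A i = 0 -> {in s, forall i, c i = 0}) /\
  (forall v, exists (s : seq I) (c : I -> K), v = \sum_(i <- s) c i *: A i).

(** Tensor products: the free module on [U * V] modulo the submodule generated
    by the bilinearity relations. *)

Section Tensor.
Variables (K : comNzRingType) (U V : lmodType K).

Definition tensor_free : lmodType K := {freeg (U * V)%type / K}.

Definition tensor_gen (u : U) (v : V) : tensor_free := << (u, v) >>.

Inductive tensor_rel : tensor_free -> Prop :=
| TensorRelL a u u' v : tensor_rel
    (tensor_gen (a *: u + u') v - (a *: tensor_gen u v + tensor_gen u' v))
| TensorRelR a u v v' : tensor_rel
    (tensor_gen u (a *: v + v') - (a *: tensor_gen u v + tensor_gen u v')).

Definition tensor_null : {pred tensor_free} := fun t =>
  `[< forall S : {pred tensor_free}, submod_closed S ->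
        (forall r, tensor_rel r -> r \in S) -> t \in S >].

Lemma tensor_null_submod : submod_closed tensor_null.
Proof.
split=> [|a x y /asboolP xN /asboolP yN]; apply/asboolP => S SP relS.
  by case: SP.
by have [_ SL] := SP; apply: SL; [exact: xN | exact: yN].
Qed.

HB.instance Definition _ :=
  GRing.isSubmodClosed.Build K tensor_free tensor_null tensor_null_submod.

Lemma tensor_null_rel r : tensor_rel r -> r \in tensor_null.
Proof. by move=> rr; apply/asboolP => S _; apply. Qed.

Definition tensor : Type := Quotient.quot tensor_null.

HB.instance Definition _ := GRing.Zmodule.on tensor.

Definition tensor_pi (t : tensor_free) : tensor :=
  \pi_(Quotient.quot tensor_null) t.

Lemma tensor_piP x y : reflect (tensor_pi x = tensor_pi y)
  (x - y \in tensor_null).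
Proof. by rewrite Quotient.idealrBE; exact: eqP. Qed.

Lemma tensor_pi_repr (t : tensor) : tensor_pi (repr t) = t.
Proof. exact: reprK. Qed.

Lemma tensor_piB : zmod_morphism tensor_pi.
Proof. by move=> x y; rewrite /tensor_pi; exact: raddfB. Qed.

HB.instance Definition _ :=
  GRing.isZmodMorphism.Build tensor_free tensor tensor_pi tensor_piB.

Definition tensor_scale (a : K) (t : tensor) : tensor :=
  tensor_pi (a *: repr t).

Lemma tensor_scale_pi a x : tensor_scale a (tensor_pi x) = tensor_pi (a *: x).
Proof.
apply/tensor_piP; rewrite -scalerBr; apply: rpredZ.
by apply/tensor_piP; rewrite tensor_pi_repr.
Qed.

Lemma tensor_scaleA a b t :
  tensor_scale a (tensor_scale b t) = tensor_scale (a * b) t.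
Proof. by rewrite -(tensor_pi_repr t) !tensor_scale_pi scalerA. Qed.

Lemma tensor_scale1 : left_id 1 tensor_scale.
Proof. by move=> t; rewrite -(tensor_pi_repr t) tensor_scale_pi scale1r. Qed.

Lemma tensor_scaleDr : right_distributive tensor_scale +%R.
Proof.
move=> a s t; rewrite -(tensor_pi_repr t) -(tensor_pi_repr s) -raddfD.
by rewrite !tensor_scale_pi scalerDr raddfD.
Qed.

Lemma tensor_scaleDl t : {morph tensor_scale^~ t : a b / a + b}.
Proof.
move=> a b; rewrite -(tensor_pi_repr t) !tensor_scale_pi scalerDl.
by rewrite raddfD.
Qed.

HB.instance Definition _ := GRing.Zmodule_isLmodule.Build K tensor
  tensor_scaleA tensor_scale1 tensor_scaleDr tensor_scaleDl.

Lemma tensor_piZ : scalable tensor_pi.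
Proof. by move=> a x; rewrite -tensor_scale_pi. Qed.

HB.instance Definition _ :=
  GRing.isScalable.Build K tensor_free tensor *:%R tensor_pi tensor_piZ.

Definition tens (u : U) (v : V) : tensor := tensor_pi (tensor_gen u v).

Lemma tens_bilinear : bilinear_map tens.
Proof.
by split=> [v a u u'|u a v v']; rewrite /tens -linearZ -raddfD;
  apply/tensor_piP/tensor_null_rel; constructor.
Qed.

Lemma tensor_ind (P : tensor -> Prop) : P 0 ->
  (forall a u v t, P t -> P (a *: tens u v + t)) -> forall t, P t.
Proof.
move=> P0 PS t; rewrite -(tensor_pi_repr t) -(freeg_sumE (repr t)).
rewrite raddf_sum /=; elim: (dom _) => [|[u v] s IH]; first by rewrite big_nil.
rewrite big_cons; set c := coeff _ _.
suff -> : << c *g (u, v) >> = c *: tensor_gen u v by rewrite linearZ; exact: PS.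
by apply/eqP/freeg_eqP => x; rewrite coeffZ !coeffU mul1r.
Qed.

(* The linear map out of the tensor product induced by [b]; meaningful when
   [b] is bilinear, see [tlift_tens]. *)
Definition tlift (W : lmodType K) (b : U -> V -> W) (t : tensor) : W :=
  fglift (fun p => b p.1 p.2) (repr t).

Section Lift.
Variables (W : lmodType K) (b : U -> V -> W).
Hypothesis b_bilin : bilinear_map b.

Let F : tensor_free -> W := fglift (fun p => b p.1 p.2).

Let F_zmod : zmod_morphism F. Proof. exact: lift_is_additive. Qed.

HB.instance Definition _ := GRing.isZmodMorphism.Build tensor_free W F F_zmod.

Let F_gen u v : F (tensor_gen u v) = b u v.
Proof. by rewrite /F liftU scale1r. Qed.

Let F_scale : scalable F.
Proof.
have FU c (z : U * V) : F << c *g z >> = c *: b z.1 z.2 by rewrite /F liftU.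
move=> a x; have Fx : F x = \sum_(z <- dom x) coeff z x *: b z.1 z.2.
  by rewrite -[in LHS](freeg_sumE x) raddf_sum; apply: eq_bigr => z _.
rewrite Fx scaler_sumr [a *: x]/GRing.scale /= /fgscale raddf_sum.
apply: eq_bigr => z _; rewrite scalerA; exact: FU.
Qed.

HB.instance Definition _ := GRing.isScalable.Build K tensor_free W *:%R F F_scale.

Let F_lin a x y : F (a *: x + y) = a *: F x + F y.
Proof. exact: linearP. Qed.

Let F0 : F 0 = 0. Proof. exact: raddf0. Qed.

Let FB x y : F (x - y) = F x - F y. Proof. exact: F_zmod. Qed.

Let F_null t : t \in tensor_null -> F t = 0.
Proof.
move=> /asboolP/(_ [pred t | F t == 0]) Ft; apply/eqP/Ft.
  split=> [|a x y]; rewrite !inE ?F0 // => /eqP Fx /eqP Fy.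
  by rewrite F_lin Fx Fy scaler0 addr0.
have [bl br] := b_bilin.
by move=> _ [] a *; rewrite inE FB F_lin !F_gen ?bl ?br subrr.
Qed.

Let tlift_pi x : tlift b (tensor_pi x) = F x.
Proof.
apply/eqP; rewrite -subr_eq0 -[tlift b _]/(F (repr _)) -FB; apply/eqP/F_null.
by apply/tensor_piP; rewrite tensor_pi_repr.
Qed.

Lemma tlift_linear : linear (tlift b).
Proof.
move=> a s t; rewrite -(tensor_pi_repr s) -(tensor_pi_repr t) -linearP.
by rewrite !tlift_pi F_lin.
Qed.

Lemma tlift0 : tlift b 0 = 0.
Proof. by rewrite -(raddf0 tensor_pi) tlift_pi F0. Qed.

Lemma tlift_tens u v : tlift b (tens u v) = b u v.
Proof. by rewrite tlift_pi F_gen. Qed.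

End Lift.
End Tensor.

Arguments tens {K U V}.

Section Lie.
Variable K : comNzRingType.

Definition lie_bracket (L : lmodType K) (br : L -> L -> L) : Prop :=
  [/\ bilinear_map br, (forall x, br x x = 0) &
      forall x y z, br x (br y z) + br y (br z x) + br z (br x y) = 0].

Definition lie_hom (L L' : lmodType K) (br : L -> L -> L)
    (br' : L' -> L' -> L') (f : L -> L') : Prop :=
  linear f /\ forall x y, f (br x y) = br' (f x) (f y).

Definition lie_iso (L L' : lmodType K) (br : L -> L -> L)
    (br' : L' -> L' -> L') (f : L -> L') : Prop :=
  lie_hom br br' f /\ bijective f.

(* [id \otimes f] *)
Definition tens_map (U V V' : lmodType K) (f : V -> V') :
    tensor U V -> tensor U V' :=
  tlift (fun u v => tens u (f v)).

(* The bracket [x \otimes f, y \otimes h] = [x, y] \otimes f h on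
   g \otimes B, see [current_bracketE]. *)
Definition current_bracket (g : lmodType K) (br : g -> g -> g)
    (B : comAlgType K) (s t : tensor g B) : tensor g B :=
  tlift (fun x f => tlift (fun y h => tens (br x y) (f * h)) t) s.

Section CurrentBracket.
Variables (g : lmodType K) (br : g -> g -> g) (B : comAlgType K).
Hypothesis br_bilin : bilinear_map br.

Let inner x (f : B) : bilinear_map (fun y h => tens (br x y) (f * h)).
Proof.
have [tl tr] := tens_bilinear g B; have [bl br'] := br_bilin.
split=> [h a y y'|y a h h']; first by rewrite br' tl.
by rewrite mulrDr -scalerAr tr.
Qed.

Let outer t : bilinear_map
  (fun x (f : B) => tlift (fun y h => tens (br x y) (f * h)) t).
Proof.
have [tl tr] := tens_bilinear g B; have [bl br'] := br_bilin.
have LP x (f : B) a s u := tlift_linear (inner x f) a s u.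
have L0 x (f : B) := tlift0 (inner x f).
split=> [f a x x'|x a f f'].
  elim/tensor_ind: t => [|c y h t IH]; first by rewrite !L0 scaler0 addr0.
  rewrite !LP IH !(tlift_tens (inner _ _)) bl tl.
  rewrite !scalerDr !scalerA (mulrC c a) !addrA; congr (_ + _).
  by rewrite -!addrA; congr (_ + _); rewrite addrC.
elim/tensor_ind: t => [|c y h t IH]; first by rewrite !L0 scaler0 addr0.
rewrite !LP IH !(tlift_tens (inner _ _)) mulrDl -scalerAl tr.
rewrite !scalerDr !scalerA (mulrC c a) !addrA; congr (_ + _).
by rewrite -!addrA; congr (_ + _); rewrite addrC.
Qed.

Lemma current_bracketE x y (f h : B) :
  current_bracket br (tens x f) (tens y h) = tens (br x y) (f * h).
Proof. by rewrite /current_bracket (tlift_tens (outer _)) tlift_tens. Qed.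

Lemma current_bracket_bilinear : bilinear_map (@current_bracket g br B).
Proof.
split=> [t|s a t t']; first exact: (tlift_linear (outer t)).
elim/tensor_ind: s => [|c x f s IH].
  have z u : current_bracket br (0 : tensor g B) u = 0 := tlift0 (outer u).
  by rewrite !z scaler0 addr0.
have L (u v w : tensor g B) : current_bracket br (c *: u + v) w =
    c *: current_bracket br u w + current_bracket br v w.
  exact: (tlift_linear (outer w) c u v).
have E (u : tensor g B) : current_bracket br (tens x f) u =
    tlift (fun y h => tens (br x y) (f * h)) u.
  exact: (tlift_tens (outer u)).
rewrite !L IH !E (tlift_linear (inner x f)) !scalerDr !scalerA (mulrC c a).
by rewrite !addrA; congr (_ + _); rewrite -!addrA; congr (_ + _); rewrite addrC.
Qed.

End CurrentBracket.
End Lie.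

Section Deformation.
Variables (K : comNzRingType) (A : comAlgType K) (L : lmodType K).

(* [A \otimes L], with scalars extended to [A]. *)
Definition base_ext : Type := tensor (A : lmodType K) L.

HB.instance Definition _ := GRing.Zmodule.on base_ext.

Definition base_scale (a : A) : base_ext -> base_ext :=
  tlift (fun b l => tens (a * b) l).

Let bilin a : bilinear_map
  (fun (b : A) l => tens (a * b) l : tensor (A : lmodType K) L).
Proof.
have [tl tr] := tens_bilinear (A : lmodType K) L.
by split=> [l c b b'|b c l l']; rewrite ?tr // mulrDr -scalerAr tl.
Qed.

Let LP a (c : K) (s t : tensor (A : lmodType K) L) :
  base_scale a (c *: s + t) = c *: (base_scale a s : tensor (A : lmodType K) L)
                              + base_scale a t.
Proof. exact: (tlift_linear (bilin a)). Qed.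

Let L0 a : base_scale a 0 = 0.
Proof. exact: (tlift0 (bilin a)). Qed.

Lemma base_scale_tens a b l : base_scale a (tens b l) = tens (a * b) l.
Proof. exact: (tlift_tens (bilin a)). Qed.

Let base_scaleA a b t : base_scale a (base_scale b t) = base_scale (a * b) t.
Proof.
elim/tensor_ind: t => [|c d l t IH]; first by rewrite !L0.
by rewrite !LP IH !base_scale_tens mulrA.
Qed.

Let base_scale1 : left_id 1 base_scale.
Proof.
elim/tensor_ind => [|c d l t IH]; first by rewrite !L0.
by rewrite !LP IH !base_scale_tens mul1r.
Qed.

Let base_scaleDr : right_distributive base_scale +%R.
Proof.
move=> a s t; have := LP a 1 s t; rewrite !scale1r; exact.
Qed.

Let base_scaleDl t : {morph base_scale^~ t : a b / a + b}.
Proof.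
move=> a b; elim/tensor_ind: t => [|c d l t IH]; first by rewrite !L0 addr0.
have [tl tr] := tens_bilinear (A : lmodType K) L.
have DE : tens (a * d + b * d) l = tens (a * d) l + tens (b * d) l
    :> tensor (A : lmodType K) L.
  by rewrite -[a * d in LHS]scale1r tl scale1r.
rewrite !LP IH !base_scale_tens mulrDl DE scalerDr.
by rewrite -!addrA; congr (_ + _); rewrite addrCA.
Qed.

HB.instance Definition _ := GRing.Zmodule_isLmodule.Build A base_ext
  base_scaleA base_scale1 base_scaleDr base_scaleDl.

(* [ev \otimes id : A \otimes L -> K \otimes L = L] *)
Definition specialize (ev : {lrmorphism A -> K | *%R}) : base_ext -> L :=
  tlift (fun a l => ev a *: l).

(* [br] is the bracket induced by [D] on the fibre of [base_ext] over the point
   [ev] of the base; as [specialize ev] is onto, it is determined by [D]. *)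
Definition fibre_bracket (ev : {lrmorphism A -> K | *%R})
    (D : base_ext -> base_ext -> base_ext) (br : L -> L -> L) : Prop :=
  forall s t, specialize ev (D s t) = br (specialize ev s) (specialize ev t).

Definition deformation (ev : {lrmorphism A -> K | *%R}) (br : L -> L -> L)
    (D : base_ext -> base_ext -> base_ext) : Prop :=
  lie_bracket D /\ fibre_bracket ev D br.

End Deformation.

(** Laurent polynomials, as a subring of the field of rational functions. *)

Section Laurent.
Variable K : fieldType.

Local Notation "p %:F" := (tofrac p).

Definition laurent_pred : {pred {fraction {poly K}}} := fun f =>
  `[< exists (n : nat) (p : {poly K}), f * ('X^n)%:F = p%:F >].

Lemma laurent_subring : subring_closed laurent_pred.
Proof.
split=> [|f g /asboolP[n [p fp]] /asboolP[m [q gq]]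
         |f g /asboolP[n [p fp]] /asboolP[m [q gq]]].
- by apply/asboolP; exists 0, 1; rewrite expr0 rmorph1 mulr1.
- apply/asboolP; exists (n + m)%N, (p * 'X^m - q * 'X^n).
  rewrite exprD rmorphB !rmorphM /= -fp -gq mulrBl mulrA; congr (_ - _).
  by rewrite -mulrA [X in _ * X]mulrC mulrA.
- apply/asboolP; exists (n + m)%N, (p * q).
  by rewrite exprD !rmorphM /= -fp -gq mulrACA.
Qed.

HB.instance Definition _ :=
  GRing.isSubringClosed.Build {fraction {poly K}} laurent_pred laurent_subring.

Definition laurent : Type := {f : {fraction {poly K}} | f \in laurent_pred}.

HB.instance Definition _ := [isSub of laurent for @sval _ _].
HB.instance Definition _ := [Choice of laurent by <:].
HB.instance Definition _ := [SubChoice_isSubComNzRing of laurent by <:].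

Lemma laurent_polyP p : p%:F \in laurent_pred.
Proof. by apply/asboolP; exists 0, p; rewrite expr0 rmorph1 mulr1. Qed.

Definition laurent_poly (p : {poly K}) : laurent := exist _ p%:F (laurent_polyP p).

Definition laurent_scale (a : K) (f : laurent) : laurent :=
  laurent_poly a%:P * f.

Let scaleA a b f : laurent_scale a (laurent_scale b f) = laurent_scale (a * b) f.
Proof.
rewrite /laurent_scale mulrA; congr (_ * _).
by apply: val_inj; rewrite /= polyCM rmorphM.
Qed.

Let scale1 : left_id 1 laurent_scale.
Proof.
move=> f; rewrite -[RHS]mul1r; congr (_ * _).
by apply: val_inj; rewrite /= polyC1 rmorph1.
Qed.

Let scaleDr : right_distributive laurent_scale +%R.
Proof. by move=> a f g; exact: mulrDr. Qed.

Let scaleDl f : {morph laurent_scale^~ f : a b / a + b}.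
Proof.
move=> a b; rewrite /laurent_scale -mulrDl; congr (_ * _).
by apply: val_inj; rewrite /= polyCD rmorphD.
Qed.

HB.instance Definition _ := GRing.Zmodule_isLmodule.Build K laurent
  scaleA scale1 scaleDr scaleDl.

Let scaleAl (a : K) (f g : laurent) : a *: (f * g) = a *: f * g.
Proof. exact: mulrA. Qed.

HB.instance Definition _ := GRing.Lmodule_isLalgebra.Build K laurent scaleAl.
HB.instance Definition _ := GRing.Lalgebra_isComAlgebra.Build K laurent.

Lemma laurent_zP (n : int) : ('X%:F ^ n : {fraction {poly K}}) \in laurent_pred.
Proof.
have X0 : ('X : {poly K})%:F != 0 by rewrite tofrac_eq0 polyX_eq0.
case: n => n; first by rewrite -exprnP -rmorphXn laurent_polyP.
apply/asboolP; exists n.+1, 1.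
by rewrite NegzE -exprnN rmorphXn rmorph1 mulVf ?expf_neq0.
Qed.

Definition laurent_z (n : int) : laurent := exist _ ('X%:F ^ n) (laurent_zP n).

End Laurent.

Definition family_bracket (K : comNzRingType) (g V : lmodType K)
    (br : g -> g -> g) (A : int -> V) (e1 e2 : K)
    (b : tensor g V -> tensor g V -> tensor g V) : Prop :=
  bilinear_map b /\
  forall (x y : g) (n m : int), b (tens x (A n)) (tens y (A m)) =
    if (2 %| n)%Z || (2 %| m)%Z then tens (br x y) (A (n + m))
    else tens (br x y) (A (n + m))
       + (3 * e1) *: tens (br x y) (A (n + m - 2))
       + ((e1 - e2) * (2 * e1 + e2)) *: tens (br x y) (A (n + m - 4)).

(* Evaluation C[e1, e2] -> C at the point (c1, c2). *)
Definition eval2 (K : comNzRingType) (c1 c2 : K) :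
    {lrmorphism {mpoly K[2]} -> K | *%R} :=
  mpoly.meval (fun i : 'I_2 => [:: c1; c2]`_i).

(** The elliptic curve. A point of the projective plane is a line in C^3; a
    function near such a point is holomorphic when its pull-back to C^3 is. *)

Section Elliptic.
Variable C : numClosedFieldType.

Local Notation C3 := 'rV[C]_3.
Local Notation P2 := {vspace C3}.

Definition hpoint (x y z : C) : P2 := <[\row_(i < 3) [:: x; y; z]`_i]>%VS.

(* [Q] holds in a neighbourhood of the point [p] of the projective plane. *)
Definition near_point (p : P2) (Q : P2 -> Prop) : Prop :=
  forall v : C3, v \in p -> v != 0 -> \forall w \near v, Q <[w]>%VS.

Definition plane_holomorphic (F : P2 -> C) (p : P2) : Prop :=
  forall v : C3, v \in p -> v != 0 ->
    \forall w \near v, differentiable (fun u : C3 => F <[u]>%VS) w.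

Variables e1 e2 : C.

Let e3 : C := - (e1 + e2).

Definition elliptic_curve : set P2 := [set p | \dim p = 1%N /\
  forall v : C3, v \in p -> let X := v 0 0 in let Y := v 0 1 in let Z := v 0 2 in
    Y ^+ 2 * Z = 4 * (X - e1 * Z) * (X - e2 * Z) * (X - e3 * Z)].

Definition pt_infty : P2 := hpoint 0 1 0.
Definition pt_e1 : P2 := hpoint e1 0 1.

Definition punctured_curve : set P2 :=
  elliptic_curve `\` [set pt_infty; pt_e1].

Definition curve_pt : Type := {p : P2 | p \in punctured_curve}.

HB.instance Definition _ := [isSub of curve_pt for @sval _ _].
HB.instance Definition _ := [Choice of curve_pt by <:].

Lemma punctured_curve_neq0 : exists p, p \in punctured_curve.
Proof.
pose x := e1 + 1; pose y : C := 2 * sqrtC ((x - e1) * (x - e2) * (x - e3)).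
have y2 : y ^+ 2 = 4 * (x - e1) * (x - e2) * (x - e3).
  by rewrite exprMn sqrtCK !mulrA -natrX.
exists (hpoint x y 1); rewrite inE; split; first split.
- rewrite dim_vline; suff -> : \row_(i < 3) [:: x; y; 1]`_i != 0 by [].
  by apply/eqP => /rowP/(_ 2); rewrite !mxE /= => /eqP; rewrite oner_eq0.
- move=> v /vlineP[k ->] /=; rewrite !mxE /=.
  rewrite mulr1 exprMn y2; ring.
- have mem : \row_(i < 3) [:: x; y; 1]`_i \in hpoint x y 1 by exact: memv_line.
  case=> E; move: mem; rewrite E => /vlineP[k] /rowP H.
    by have := H 2; rewrite !mxE /= mulr0 => /eqP; rewrite oner_eq0.
  have := H 2; have := H 0; rewrite !mxE /= mulr1 => + k1.
  rewrite -k1 mul1r /x => /(congr1 (fun t => t - e1)) /eqP.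
  by rewrite addrAC subrr add0r oner_eq0.
Qed.

HB.instance Definition _ := isPointed.Build curve_pt
  (exist _ (xchoose punctured_curve_neq0) (xchooseP punctured_curve_neq0)).

(* [f] agrees, on the punctured curve near [p], with a holomorphic function on
   a neighbourhood of [p] in the plane. *)
Definition holomorphic_at (f : curve_pt -> C) (p : P2) : Prop :=
  exists F : P2 -> C, plane_holomorphic F p /\
    near_point p (fun l => forall q : curve_pt, val q = l -> f q = F l).

(* Near [p], [f] is a quotient of holomorphic functions whose denominator does
   not vanish on the curve away from [p]. *)
Definition meromorphic_at (f : curve_pt -> C) (p : P2) : Prop :=
  exists F G : P2 -> C, [/\ plane_holomorphic F p, plane_holomorphic G p &
    near_point p (fun l => forall q : curve_pt, val q = l -> l != p ->
      G l != 0 /\ f q = F l / G l)].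

Definition elliptic_pred : {pred curve_pt -> C} := fun f =>
  `[< [/\ forall q : curve_pt, holomorphic_at f (val q),
          meromorphic_at f pt_infty & meromorphic_at f pt_e1] >].

Lemma near_pointI p (P Q : P2 -> Prop) : near_point p P -> near_point p Q ->
  near_point p (fun l => P l /\ Q l).
Proof.
move=> HP HQ v vp v0.
exact: (@filterI _ (nbhs v) _ _ _ (HP v vp v0) (HQ v vp v0)).
Qed.

Lemma near_pointS p (P Q : P2 -> Prop) : (forall l, P l -> Q l) ->
  near_point p P -> near_point p Q.
Proof.
move=> PQ HP v vp v0; apply: (@filterS _ (nbhs v)) (HP v vp v0) => w.
exact: PQ.
Qed.

Lemma plane_holomorphic_cst c p : plane_holomorphic (fun=> c) p.
Proof. by move=> v _ _; apply: (@filterE _ (nbhs v)) => w; exact: differentiable_cst. Qed.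

Lemma plane_holomorphicD F G p : plane_holomorphic F p ->
  plane_holomorphic G p -> plane_holomorphic (fun l => F l + G l) p.
Proof.
move=> HF HG v vp v0; apply: (@filterS2 _ (nbhs v)) (HF v vp v0) (HG v vp v0) => w.
exact: differentiableD.
Qed.

Lemma plane_holomorphicM F G p : plane_holomorphic F p ->
  plane_holomorphic G p -> plane_holomorphic (fun l => F l * G l) p.
Proof.
move=> HF HG v vp v0; apply: (@filterS2 _ (nbhs v)) (HF v vp v0) (HG v vp v0) => w.
exact: differentiableM.
Qed.

Lemma holomorphic_cst c p : holomorphic_at (fun=> c) p.
Proof.
exists (fun=> c); split; first exact: plane_holomorphic_cst.
by move=> v _ _; exact: (@filterE _ (nbhs v)).
Qed.

Lemma holomorphicD f g p : holomorphic_at f p -> holomorphic_at g p ->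
  holomorphic_at (fun q => f q + g q) p.
Proof.
move=> [F [hF fF]] [G [hG gG]]; exists (fun l => F l + G l).
split; first exact: plane_holomorphicD.
apply: near_pointS (near_pointI fF gG) => l [fl gl] q ql.
by rewrite (fl q ql) (gl q ql).
Qed.

Lemma holomorphicM f g p : holomorphic_at f p -> holomorphic_at g p ->
  holomorphic_at (fun q => f q * g q) p.
Proof.
move=> [F [hF fF]] [G [hG gG]]; exists (fun l => F l * G l).
split; first exact: plane_holomorphicM.
apply: near_pointS (near_pointI fF gG) => l [fl gl] q ql.
by rewrite (fl q ql) (gl q ql).
Qed.

Lemma meromorphic_cst c p : meromorphic_at (fun=> c) p.
Proof.
exists (fun=> c), (fun=> 1); split; [exact: plane_holomorphic_cst..|].
by move=> v _ _; apply: (@filterE _ (nbhs v)) => w q _ _; rewrite divr1 oner_eq0.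
Qed.

Lemma meromorphicD f g p : meromorphic_at f p -> meromorphic_at g p ->
  meromorphic_at (fun q => f q + g q) p.
Proof.
move=> [F [G [hF hG fE]]] [F' [G' [hF' hG' gE]]].
exists (fun l => F l * G' l + F' l * G l), (fun l => G l * G' l).
split; [by apply: plane_holomorphicD; exact: plane_holomorphicM|
        exact: plane_holomorphicM|].
apply: near_pointS (near_pointI fE gE) => l [fl gl] q ql lp.
have [G0 ->] := fl q ql lp; have [G'0 ->] := gl q ql lp.
by rewrite mulf_neq0 // addf_div.
Qed.

Lemma meromorphicM f g p : meromorphic_at f p -> meromorphic_at g p ->
  meromorphic_at (fun q => f q * g q) p.
Proof.
move=> [F [G [hF hG fE]]] [F' [G' [hF' hG' gE]]].
exists (fun l => F l * F' l), (fun l => G l * G' l).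
split; [exact: plane_holomorphicM..|].
apply: near_pointS (near_pointI fE gE) => l [fl gl] q ql lp.
have [G0 ->] := fl q ql lp; have [G'0 ->] := gl q ql lp.
by rewrite mulf_neq0 // mulf_div.
Qed.

Lemma elliptic_pred_cst c : (fun=> c) \in elliptic_pred.
Proof.
apply/asboolP; split=> [q||]; first exact: holomorphic_cst;
  exact: meromorphic_cst.
Qed.

Lemma elliptic_predD f g : f \in elliptic_pred -> g \in elliptic_pred ->
  (fun q => f q + g q) \in elliptic_pred.
Proof.
move=> /asboolP[hf mf mf'] /asboolP[hg mg mg']; apply/asboolP.
by split=> [q||]; [exact: holomorphicD|exact: meromorphicD..].
Qed.

Lemma elliptic_predM f g : f \in elliptic_pred -> g \in elliptic_pred ->
  (fun q => f q * g q) \in elliptic_pred.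
Proof.
move=> /asboolP[hf mf mf'] /asboolP[hg mg mg']; apply/asboolP.
by split=> [q||]; [exact: holomorphicM|exact: meromorphicM..].
Qed.

Lemma elliptic_subring : subring_closed elliptic_pred.
Proof.
split=> [|f g fP gP|f g]; [exact: elliptic_pred_cst| |exact: elliptic_predM].
have -> : f - g = (fun q => f q + (fun r => (-1) * g r) q).
  by apply/funext => q; rewrite mulN1r.
apply: elliptic_predD => //.
by apply: (@elliptic_predM (fun=> -1)) => //; exact: elliptic_pred_cst.
Qed.

HB.instance Definition _ :=
  GRing.isSubringClosed.Build (curve_pt -> C) elliptic_pred elliptic_subring.

(* The meromorphic functions on the curve that are holomorphic outside
   [pt_infty] and [pt_e1]. *)
Definition elliptic_alg : Type := {f : curve_pt -> C | f \in elliptic_pred}.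

HB.instance Definition _ := [isSub of elliptic_alg for @sval _ _].
HB.instance Definition _ := [Choice of elliptic_alg by <:].
HB.instance Definition _ := [SubChoice_isSubComNzRing of elliptic_alg by <:].

Definition elliptic_cst (c : C) : elliptic_alg :=
  exist _ (fun=> c) (elliptic_pred_cst c).

Definition elliptic_scale (c : C) (f : elliptic_alg) : elliptic_alg :=
  elliptic_cst c * f.

Let scaleA a b f :
  elliptic_scale a (elliptic_scale b f) = elliptic_scale (a * b) f.
Proof. by rewrite /elliptic_scale mulrA; congr (_ * _); apply: val_inj. Qed.

Let scale1 : left_id 1 elliptic_scale.
Proof.
by move=> f; rewrite -[RHS]mul1r; congr (_ * _); apply: val_inj.
Qed.

Let scaleDr : right_distributive elliptic_scale +%R.
Proof. by move=> a f g; exact: mulrDr. Qed.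

Let scaleDl f : {morph elliptic_scale^~ f : a b / a + b}.
Proof.
by move=> a b; rewrite /elliptic_scale -mulrDl; congr (_ * _); apply: val_inj.
Qed.

HB.instance Definition _ := GRing.Zmodule_isLmodule.Build C elliptic_alg
  scaleA scale1 scaleDr scaleDl.

Let scaleAl (a : C) (f g : elliptic_alg) : a *: (f * g) = a *: f * g.
Proof. exact: mulrA. Qed.

HB.instance Definition _ := GRing.Lmodule_isLalgebra.Build C elliptic_alg scaleAl.
HB.instance Definition _ := GRing.Lalgebra_isComAlgebra.Build C elliptic_alg.

End Elliptic.

(* Main.v *)
Require Import Defs.
From HB Require Import structures.
From mathcomp Require Import all_boot all_order all_algebra complex ring lra zify.
From mathcomp.multinomials Require Import mpoly freeg.
From mathcomp Require Import all_classical all_reals all_analysis.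
Import numFieldNormedType.Exports.
Import Order.TTheory GRing.Theory Num.Theory.

Set Implicit Arguments.
Unset Strict Implicit.
Unset Printing Implicit Defensive.

Local Open Scope ring_scope.
Local Open Scope complex_scope.
Local Open Scope classical_set_scope.

(** The bracket of the family is [[x \otimes v, y \otimes w] = [x, y] \otimes v w]
    for a commutative and associative product on the space of the [A n], so it
    is a Lie bracket. Antisymmetry and the Jacobi identity only have to be
    checked on elements [x \otimes A n], where the Jacobi identity holds because
    the double product of three basis vectors has its two extra terms exactly
    when at least two of the three indices are odd. The two parameters enter
    through [3 e1] and [(e1 - e2)(2 e1 + e2)] only, and the check works over any
    ring that contains them ([family_lie]): over the complex numbers it gives the
    algebras over a point, over the polynomial ring the deformation. The latter
    is obtained by extending three bilinear maps from the current algebra to the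
    base, and its fibres are computed on the same elements.

    The substance of the theorem is the fibre over a point where [e1], [e2] and
    [e3] are distinct. With [t = x - e1] the curve reads
    [y^2 = 4 t (t^2 + 3 e1 t + (e1 - e2)(2 e1 + e2))], so that the functions
    [t^k] and [y t^(k-1) / 2] multiply as [A (2 k)] and [A (2 k + 1)] do
    ([efunM]). They are linearly independent ([efun_free]). That they span is a
    statement of function theory ([elliptic_structure]): if [f] is regular
    outside the two points and meromorphic there, then [f (x, y) + f (x, -y)],
    and the same sum for [y f], are functions of [x] that are holomorphic outside
    the branch points [e1], [e2], [e3], continuous at [e2] and [e3], and of
    polynomial growth at [e1] and at infinity. Such functions are Laurent
    polynomials in [t], and they determine [f].

    All the function theory comes from one estimate, [cauchy_estimate]: a
    function that is continuous on a disc and complex differentiable outside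
    finitely many points is bounded at the centre by its values on an annulus.
    Over the complex numbers it follows from the theorem of Goursat on squares,
    which is proved by bisection. Exceptional points are allowed because
    the difference quotients of a differentiable function are differentiable
    outside one more point; iterating difference quotients then replaces power
    series. In this way one gets Liouville's theorem for polynomial growth
    ([liouville]) and the finiteness of the order of a zero ([zero_order]). The
    latter bounds a quotient [F / G] of holomorphic functions near a missing
    point of the curve: [G (x, y) G (x, -y)] is a function of one variable
    without zeros in a punctured disc, hence bounded below by a power
    ([meromorphic_growth]). *)

(** * Difference quotients and the Cauchy estimate *)

(** Continuity and complex differentiability are named so that, for functions on
    [R[i]], they refer to the topology of [R[i]] as a number field. *)
Definition cts (K : numFieldType) (u : K -> K) (z : K) : Prop :=
  {for z, continuous u}.

Definition hol (K : numFieldType) (u : K -> K) (z : K) : Prop :=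
  derivable u z 1.

Section EpsDelta.
Variable K : numFieldType.
Implicit Types (u : K -> K) (z : K).

Lemma continuous_epsP u z : cts u z -> forall e, 0 < e ->
  exists2 d, 0 < d & forall w, `|w - z| < d -> `|u w - u z| < e.
Proof.
move=> /cvgrPdist_lt uz e e0; have /nbhs_ballP[d d0 H] := uz e e0.
exists d => // w wz; rewrite distrC; apply: H; by rewrite -ball_normE /= distrC.
Qed.

Lemma eps_continuous u z : (forall e, 0 < e ->
  exists2 d, 0 < d & forall w, `|w - z| < d -> `|u w - u z| < e) ->
  cts u z.
Proof.
move=> H; apply/(@cvgrPdist_lt _ _ _ (nbhs z)) => e e0; have [d d0 Hd] := H e e0.
apply/nbhs_ballP; exists d => // w; rewrite -ball_normE /= => wz.
by rewrite distrC; apply: Hd; rewrite distrC.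
Qed.

Lemma derivable_epsP u z : hol u z -> forall e, 0 < e ->
  exists2 d, 0 < d & forall w, `|w - z| < d ->
    `|u w - u z - 'D_1 u z * (w - z)| <= e * `|w - z|.
Proof.
move=> /cvgrPdist_lt du e e0.
have /nbhs_ballP[d d0 H] := du e e0.
exists d => // w wz; have [->|wNz] := eqVneq w z.
  by rewrite !subrr mulr0 subr0 normr0 mulr0.
have w0 : w - z != 0 by rewrite subr_eq0.
have /= := H (w - z); rewrite -ball_normE /= sub0r normrN => /(_ wz w0).
rewrite [_%:A]mulr1 subrK => /ltW.
rewrite -(ler_pM2r (x := `|w - z|)) ?normr_gt0 // -normrM mulrBl.
by rewrite /GRing.scale /= mulrAC mulVf // mul1r distrC.
Qed.

(** The value at [t] keeps the quotient continuous when [u] is differentiable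
    at [t]. Differentiability at [t] is not clear, so each quotient costs one
    exceptional point. *)
Definition slope u t z : K :=
  if z == t then 'D_1 u t else (u z - u t) / (z - t).

Lemma slopeE u t z : hol u t -> u z = u t + (z - t) * slope u t z.
Proof.
move=> dt; rewrite /slope; case: eqVneq => [->|zt].
  by rewrite subrr mul0r addr0.
by rewrite mulrCA divff ?subr_eq0// mulr1 addrC subrK.
Qed.

Lemma near_slope u t z : z != t ->
  \forall w \near z, (fun w => (u w - u t) / (w - t)) w = slope u t w.
Proof.
move=> zt; apply/nbhs_ballP; exists `|z - t|.
  by rewrite /= normr_gt0 subr_eq0.
move=> w; rewrite -ball_normE /= /slope => wz.
by case: eqVneq => // E; move: wz; rewrite E ltxx.
Qed.

Lemma slope_continuous u t z : z != t -> cts u z ->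
  cts (slope u t) z.
Proof.
move=> zt uz.
have h : (u w - u t) / (w - t) @[w --> z] --> slope u t z.
  rewrite /slope (negbTE zt).
  have c1 : (u w - u t) @[w --> z] --> u z - u t by exact: (cvgB uz (cvg_cst _)).
  have c2 : (w - t) @[w --> z] --> z - t by exact: (cvgB cvg_id (cvg_cst _)).
  apply: (cvgM c1); apply: (cvgV _ c2); by rewrite subr_eq0.
by apply: cvg_trans h; exact: near_eq_cvg (near_slope u zt).
Qed.

Lemma slope_continuous_at u t : hol u t ->
  cts (slope u t) t.
Proof.
move=> dt; apply: eps_continuous => e e0.
have [d d0 H] := derivable_epsP dt (divr_gt0 e0 (ltr0Sn K 1)).
exists d => // w /H Hw; rewrite /slope eqxx; move: Hw; case: eqVneq => [->|wt].
  by move=> _; rewrite subrr normr0.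
have w0 : 0 < `|w - t| by rewrite normr_gt0 subr_eq0.
move=> Hw; apply: (le_lt_trans (y := e / 2)); last by rewrite ltr_pdivrMr// ltr_pMr// ltr1n.
rewrite -(ler_pM2r w0); apply: le_trans Hw; rewrite -normrM mulrBl mulfVK//.
by rewrite subr_eq0.
Qed.

Lemma slope_derivable u t z : z != t -> hol u z ->
  hol (slope u t) z.
Proof.
move=> zt uz.
apply: (near_eq_derivable (near_slope u zt)).
apply: derivableM; first exact: derivableB.
  apply: derivableV; last exact: derivableB.
  by rewrite subr_eq0.
Qed.

(** The norm of a closed field takes values in a partially ordered field, which
    has no minimum of two radii; this takes its place. *)
Lemma lower_bound (x y : K) : 0 < x -> 0 < y ->
  exists z, [/\ 0 < z, z <= x & z <= y].
Proof.
move=> x0 y0; have xy0 := addr_gt0 x0 y0; exists (x * y / (x + y)).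
split; first by rewrite !mulr_gt0// invr_gt0.
  by rewrite ler_pdivrMr// ler_pM2l// lerDr ltW.
by rewrite ler_pdivrMr// mulrC ler_pM2l// lerDl ltW.
Qed.

Lemma avoid_seq (S : seq K) (c d : K) : 0 < d ->
  exists2 z, `|z - c| < d & z \notin S.
Proof.
move=> d0; pose p k : K := c + d / k.+2%:R.
have pinj : injective p.
  move=> i j /addrI/(mulfI (lt0r_neq0 d0))/invr_inj/eqP.
  by rewrite eqr_nat => /eqP[].
have [/allP sub|/allPn[z /mapP[k _ ->] zS]] :=
    boolP (all (mem S) (map p (iota 0 (size S).+1))).
  have := uniq_leq_size _ sub; rewrite map_inj_uniq// iota_uniq size_map size_iota.
  by rewrite ltnn => /(_ isT).
exists (p k) => //; rewrite /p addrC addKr normf_div normr_nat gtr0_norm//.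
by rewrite ltr_pdivrMr ?ltr0n// ltr_pMr// ltr1n.
Qed.

End EpsDelta.

(** The set [S] collects the points at which difference quotients are only known
    to be continuous. The constants leave room
    for a square between the circles of radius [r] and [4 * r], and for a small
    change of the centre. *)
Definition cauchy_estimate (K : numFieldType) : Prop :=
  forall (u : K -> K) (S : seq K) (c r M : K), 0 < r ->
    (forall z, `|z - c| <= 4 * r -> cts u z) ->
    (forall z, `|z - c| <= 4 * r -> z \notin S -> hol u z) ->
    (forall z, r <= `|z - c| <= 4 * r -> `|u z| <= M) -> `|u c| <= 4 * M.

(** * Integrals of complex functions on a segment *)

Section ComplexIntegral.
Variable R : realType.
Local Notation C := R[i].
Local Notation re := (@complex.Re R).
Local Notation im := (@complex.Im R).
Local Notation mu := (@lebesgue_measure R).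
Implicit Types (a b k : R).

Definition rint (f : R -> R) a b : R := \int[mu]_(x in `[a, b]) f x.

Lemma seg_integrable (f : R -> R) a b : {within `[a, b], continuous f} ->
  mu.-integrable `[a, b] (EFin \o f).
Proof.
move=> cf; apply: continuous_compact_integrable cf; exact: segment_compact.
Qed.

Lemma rint_split (f : R -> R) a m b : {within `[a, b], continuous f} ->
  a <= m -> m <= b -> rint f a b = rint f a m + rint f m b.
Proof.
move=> /seg_integrable fi am mb.
have fi2 : mu.-integrable `]m, b] (EFin \o f).
  apply: integrableS fi => //; apply: subset_itvr; by rewrite bnd_simp.
have /= := Rintegral_itvB (x := m) fi; rewrite !bnd_simp => /(_ am mb).
by rewrite (Rintegral_itv_obnd_cbnd fi2) /rint => <-; rewrite addrC subrK.
Qed.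

Lemma rint_cst k a b : a <= b -> rint (fun=> k) a b = k * (b - a).
Proof.
move=> ab; rewrite /rint Rintegral_cst//; congr (_ * _).
rewrite /= lebesgue_measure_itv /= lte_fin; by case: ltgtP ab => //= -> _; rewrite subrr.
Qed.

Lemma seg_cst k a b : {within `[a, b], continuous (fun=> k : R)}.
Proof. by apply: continuous_subspaceT => x; exact: cvg_cst. Qed.

Lemma rint_ge (f : R -> R) k a b : {within `[a, b], continuous f} -> a <= b ->
  (forall x, a <= x <= b -> k <= f x) -> k * (b - a) <= rint f a b.
Proof.
move=> cf ab kf; rewrite -rint_cst //.
have fi := seg_integrable cf; have ki := seg_integrable (@seg_cst k a b).
by apply: le_Rintegral => // x /=; rewrite in_itv /=; exact: kf.
Qed.

Lemma rint_le (f : R -> R) k a b : {within `[a, b], continuous f} -> a <= b ->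
  (forall x, a <= x <= b -> f x <= k) -> rint f a b <= k * (b - a).
Proof.
move=> cf ab kf; rewrite -rint_cst //.
have fi := seg_integrable cf; have ki := seg_integrable (@seg_cst k a b).
by apply: le_Rintegral => // x /=; rewrite in_itv /=; exact: kf.
Qed.

Lemma rintB (f h : R -> R) a b : {within `[a, b], continuous f} ->
  {within `[a, b], continuous h} ->
  rint (fun x => f x - h x) a b = rint f a b - rint h a b.
Proof. by move=> /seg_integrable fi /seg_integrable hi; exact: RintegralB. Qed.

(** A norm with real values, equivalent to the modulus, which is itself complex
    valued: real estimates can then be left to linear arithmetic. *)
Definition n1 (z : C) : R := `|re z| + `|im z|.

Lemma n1D z w : n1 (z + w) <= n1 z + n1 w.
Proof.
case: z w => [a b] [c d]; rewrite /n1 /= addrACA.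
by apply: lerD; exact: ler_normD.
Qed.

Lemma norm_le_n1 z : `|z| <= (n1 z)%:C.
Proof.
case: z => a b; rewrite normc_def /n1 /= lecR.
rewrite -[leRHS]ger0_norm ?addr_ge0// -sqrtr_sqr ler_wsqrtr// sqrrD.
by rewrite !real_normK ?num_real// lerD2r lerDl mulrn_wge0// mulr_ge0.
Qed.

Lemma Re_le_norm z : (`|re z|%:C <= `|z|)%R.
Proof. exact: normc_ge_Re. Qed.

Lemma Im_le_norm z : (`|im z|%:C <= `|z|)%R.
Proof.
by rewrite normc_def lecR -sqrtr_sqr ler_wsqrtr // lerDr sqr_ge0.
Qed.

Lemma n1_le_norm z (e : R) : `|z| <= e%:C -> n1 z <= 2 * e.
Proof.
move=> ze; rewrite /n1 mulr2n mulrDl mul1r; apply: lerD.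
  by rewrite -lecR (le_trans (Re_le_norm z)).
by rewrite -lecR (le_trans (Im_le_norm z)).
Qed.

Lemma n1_mulI z : n1 ('i%C * z) = n1 z.
Proof. by case: z => a b; rewrite /n1 /= mul0r mul1r mul0r mul1r sub0r add0r normrN addrC. Qed.

Definition ccont (f : R -> C) a b : Prop :=
  {within `[a, b], continuous (fun t => re (f t))} /\
  {within `[a, b], continuous (fun t => im (f t))}.

Definition cint (f : R -> C) a b : C :=
  rint (fun t => re (f t)) a b +i* rint (fun t => im (f t)) a b.

Lemma seg_sub (f : R -> R) a b a' b' : {within `[a, b], continuous f} ->
  a <= a' -> b' <= b -> {within `[a', b'], continuous f}.
Proof.
move=> cf aa bb; apply: continuous_subspaceW cf => x /=.
by rewrite !in_itv /= => /andP[ax xb]; rewrite (le_trans aa)// (le_trans xb).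
Qed.

Lemma segB (f h : R -> R) a b : {within `[a, b], continuous f} ->
  {within `[a, b], continuous h} ->
  {within `[a, b], continuous (fun t => f t - h t)}.
Proof. by move=> cf ch x; apply: cvgB; [exact: cf|exact: ch]. Qed.

Lemma reB (z w : C) : re (z - w) = re z - re w.
Proof. by case: z w => [? ?] [? ?]. Qed.

Lemma imB (z w : C) : im (z - w) = im z - im w.
Proof. by case: z w => [? ?] [? ?]. Qed.

Lemma ccontB f h a b : ccont f a b -> ccont h a b ->
  ccont (fun t => f t - h t) a b.
Proof.
move=> [fr fi] [hr hi]; split.
  rewrite (_ : (fun t => _) = fun t => re (f t) - re (h t)); first exact: segB.
  by apply/funext => t; rewrite reB.
rewrite (_ : (fun t => _) = fun t => im (f t) - im (h t)); first exact: segB.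
by apply/funext => t; rewrite imB.
Qed.

Lemma cintB f h a b : ccont f a b -> ccont h a b ->
  cint (fun t => f t - h t) a b = cint f a b - cint h a b.
Proof.
move=> [fr fi] [hr hi].
transitivity (rint (fun t => re (f t) - re (h t)) a b +i*
              rint (fun t => im (f t) - im (h t)) a b); last by rewrite !rintB.
by congr (_ +i* _); congr rint; apply/funext => t; rewrite ?reB ?imB.
Qed.

Lemma cint_split f a m b : ccont f a b -> a <= m -> m <= b ->
  cint f a b = cint f a m + cint f m b.
Proof.
by move=> [fr fi] am mb; rewrite /cint (rint_split fr am mb) (rint_split fi am mb).
Qed.

(** The bound on a single integral is the case [k = 0]; general [k] is what
    makes affine functions cancel on a square. *)
Lemma cint_near f (k : C) a b (E : R) : ccont f a b -> a <= b ->
  (forall t, a <= t <= b -> n1 (f t - k) <= E) ->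
  n1 (cint f a b - k * (b - a)%:C) <= 2 * E * (b - a).
Proof.
move=> [fr fi] ab fk; case: k fk => kr ki fk.
have bnd t : a <= t <= b ->
    `|re (f t) - kr| <= E /\ `|im (f t) - ki| <= E.
  move=> /fk; rewrite /n1; case: (f t) => x y /= H.
  by split; apply: le_trans H; rewrite ?lerDl ?lerDr.
have aux (h : R -> R) k : {within `[a, b], continuous h} ->
    (forall t, a <= t <= b -> `|h t - k| <= E) ->
    `|rint h a b - k * (b - a)| <= E * (b - a).
  move=> ch hk; rewrite ler_distl -mulrBl -mulrDl; apply/andP; split.
    by apply: rint_ge => // t /hk; rewrite ler_distl => /andP[].
  by apply: rint_le => // t /hk; rewrite ler_distl => /andP[].
rewrite /n1 /cint /= !mulr0 subr0 add0r -mulrA mulr2n mulrDl !mul1r.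
by apply: lerD; apply: aux => // t /bnd[].
Qed.

Lemma cint_im_le f k a b : ccont f a b -> a <= b ->
  (forall t, a <= t <= b -> im (f t) <= k) -> im (cint f a b) <= k * (b - a).
Proof. by move=> [fr fi] ab fk; exact: rint_le. Qed.

Lemma cint_im_ge f k a b : ccont f a b -> a <= b ->
  (forall t, a <= t <= b -> k <= im (f t)) -> k * (b - a) <= im (cint f a b).
Proof. by move=> [fr fi] ab fk; exact: rint_ge. Qed.

Lemma cint_re_le f k a b : ccont f a b -> a <= b ->
  (forall t, a <= t <= b -> re (f t) <= k) -> re (cint f a b) <= k * (b - a).
Proof. by move=> [fr fi] ab fk; exact: rint_le. Qed.

Lemma cint_re_ge f k a b : ccont f a b -> a <= b ->
  (forall t, a <= t <= b -> k <= re (f t)) -> k * (b - a) <= re (cint f a b).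
Proof. by move=> [fr fi] ab fk; exact: rint_ge. Qed.

(** Sides of squares are parametrized by [p], which is a horizontal or a vertical
    line. *)
Lemma ccont_line (u : C -> C) (p : R -> C) a b :
  (forall s t, `|p s - p t| <= `|s - t|%:C) ->
  (forall t, a <= t <= b -> cts (K := C) u (p t)) ->
  ccont (fun t => u (p t)) a b.
Proof.
move=> pL uc.
have H t (e : R) : a <= t <= b -> 0 < e ->
    \forall s \near t, `|u (p s) - u (p t)| <= e%:C.
  move=> /uc/continuous_epsP/(_ e%:C) + e0; rewrite ltcR => /(_ e0)[d d0 Hd].
  have dE : d = (re d)%:C by rewrite RRe_real// ger0_real// ltW.
  apply/nbhs_ballP; exists (re d); first by rewrite /= -ltcR -dE.
  move=> s; rewrite -ball_normE /= => ts; apply/ltW/Hd.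
  apply: le_lt_trans (pL s t) _; by rewrite dE ltcR distrC.
split; apply: continuous_in_subspaceT => t; rewrite inE /= in_itv /= => tab;
  apply/(@cvgrPdist_le _ _ _ (nbhs t)) => e e0; apply: filterS (H t e tab e0) => s Hs.
  by rewrite distrC -reB -lecR; apply: le_trans (Re_le_norm _) Hs.
by rewrite distrC -imB -lecR; apply: le_trans (Im_le_norm _) Hs.
Qed.

End ComplexIntegral.

(** * Integrals along the boundary of a square *)

Section Goursat.
Variable R : realType.
Local Notation C := R[i].
Local Notation re := (@complex.Re R).
Local Notation im := (@complex.Im R).
Implicit Types (u : C -> C) (x y l h e : R) (S : seq C).

Definition in_square x y l : set C :=
  [set z | x <= re z <= x + l /\ y <= im z <= y + l].

(** The boundary of the square with lower left corner [x + i y] and side [l],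
    counterclockwise. *)
Definition square_int u x y l : C :=
  cint (fun s => u (s +i* y)) x (x + l)
  - cint (fun s => u (s +i* (y + l))) x (x + l)
  + 'i%C * (cint (fun t => u ((x + l) +i* t)) y (y + l)
          - cint (fun t => u (x +i* t)) y (y + l)).

Lemma ccont_h u x1 x2 y : (forall s, x1 <= s <= x2 -> cts (K := C) u (s +i* y)) ->
  ccont (fun s => u (s +i* y)) x1 x2.
Proof.
apply: (ccont_line (p := fun s => s +i* y)) => s t.
by rewrite normc_def /= subrr expr0n addr0 sqrtr_sqr.
Qed.

Lemma ccont_v u x y1 y2 : (forall t, y1 <= t <= y2 -> cts (K := C) u (x +i* t)) ->
  ccont (fun t => u (x +i* t)) y1 y2.
Proof.
apply: (ccont_line (p := fun t => x +i* t)) => s t.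
by rewrite normc_def /= subrr expr0n add0r sqrtr_sqr.
Qed.

Lemma square_edges u x y l : 0 <= l ->
  (forall z, in_square x y l z -> cts (K := C) u z) ->
  [/\ (forall y', y <= y' <= y + l -> ccont (fun s => u (s +i* y')) x (x + l)) &
      (forall x', x <= x' <= x + l -> ccont (fun t => u (x' +i* t)) y (y + l))].
Proof.
move=> l0 uc; split=> [y' yy|x' xx].
  by apply: ccont_h => s ss; apply: uc; split.
by apply: ccont_v => s ss; apply: uc; split.
Qed.

(** The inner sides are run through twice, in opposite directions. *)
Lemma square_int_split u x y h : 0 <= h ->
  (forall z, in_square x y (h + h) z -> cts (K := C) u z) ->
  square_int u x y (h + h) =
    square_int u x y h + square_int u (x + h) y h
    + (square_int u x (y + h) h + square_int u (x + h) (y + h) h).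
Proof.
move=> h0 uc; have [H V] := square_edges (addr_ge0 h0 h0) uc.
have xh (a : R) : a <= a + h by rewrite lerDl.
have xhh (a : R) : a + h <= a + (h + h) by rewrite lerD2l lerDl.
have hh (a : R) : a <= a + (h + h) by rewrite lerDl addr_ge0.
have inn (a : R) : a <= a + h <= a + (h + h) by rewrite xh xhh.
have in0 (a : R) : a <= a <= a + (h + h) by rewrite lexx hh.
have in1 (a : R) : a <= a + (h + h) <= a + (h + h) by rewrite lexx hh.
rewrite /square_int (cint_split (H _ (in0 y)) (xh x) (xhh x)).
rewrite (cint_split (H _ (in1 y)) (xh x) (xhh x)).
rewrite (cint_split (V _ (in0 x)) (xh y) (xhh y)).
rewrite (cint_split (V _ (in1 x)) (xh y) (xhh y)).
rewrite !(addrA x h h) !(addrA y h h); ring.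
Qed.

(** Along the boundary of a square, affine functions integrate to zero: two
    opposite sides differ by a constant, and the two constants cancel. So only
    the distance to an affine function matters. *)
Lemma square_int_cell u (k m : C) x y l (E : R) : 0 <= l ->
  (forall z, in_square x y l z -> cts (K := C) u z) ->
  (forall z, in_square x y l z -> n1 (u z - (k + m * z)) <= E) ->
  n1 (square_int u x y l) <= 8 * E * l.
Proof.
move=> l0 uc uE; have [H V] := square_edges l0 uc.
have ll (a : R) : a <= a + l by rewrite lerDl.
have n1B (a b : C) (c : C) : n1 a <= E -> n1 b <= E -> c = a - b -> n1 c <= 2 * E.
  move=> aE bE ->; apply: le_trans (n1D _ _) _; rewrite mulr2n mulrDl mul1r.
  by apply: lerD => //; move: bE; case: (b) => p q; rewrite /n1 /= !normrN.
have B1 : n1 (cint (fun s => u (s +i* y) - u (s +i* (y + l))) x (x + l)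
              - (- m * 'i%C * l%:C) * (x + l - x)%:C) <= 2 * (2 * E) * (x + l - x).
  apply: cint_near => //; first by apply: ccontB; apply: H; rewrite ?lexx ll.
  move=> s sx; apply: (n1B (u (s +i* y) - (k + m * (s +i* y)))
                           (u (s +i* (y + l)) - (k + m * (s +i* (y + l))))).
  - by apply: uE; split; rewrite //= lexx ll.
  - by apply: uE; split; rewrite //= lexx ll.
  - have -> : s +i* (y + l) = s +i* y + 'i%C * l%:C :> C.
      by simpc.
    by ring.
have B2 : n1 (cint (fun t => u ((x + l) +i* t) - u (x +i* t)) y (y + l)
              - (m * l%:C) * (y + l - y)%:C) <= 2 * (2 * E) * (y + l - y).
  apply: cint_near => //; first by apply: ccontB; apply: V; rewrite ?lexx ll.
  move=> t ty; apply: (n1B (u ((x + l) +i* t) - (k + m * ((x + l) +i* t)))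
                           (u (x +i* t) - (k + m * (x +i* t)))).
  - by apply: uE; split; rewrite //= lexx ll.
  - by apply: uE; split; rewrite //= lexx ll.
  - have -> : (x + l) +i* t = x +i* t + l%:C :> C by simpc.
    by ring.
have el (a : R) : a + l - a = l by rewrite addrC addKr.
have in0 (a : R) : a <= a <= a + l by rewrite lexx ll.
have in1 (a : R) : a <= a + l <= a + l by rewrite lexx ll.
move: B1 B2; rewrite (cintB (H _ (in0 y)) (H _ (in1 y))).
rewrite (cintB (V _ (in1 x)) (V _ (in0 x))) !el.
set c1 := cint _ _ _ - _; set c2 := cint _ _ _ - _ => B1 B2.
rewrite /square_int -/c1 -/c2.
have -> : c1 + 'i%C * c2 =
    (c1 - - m * 'i%C * l%:C * l%:C) + 'i%C * (c2 - m * l%:C * l%:C) by ring.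
apply: le_trans (n1D _ _) _; rewrite n1_mulI.
by apply: le_trans (lerD B1 B2) _; rewrite -mulrDl -mulrDr; lra.
Qed.

End Goursat.

(** * The theorem of Goursat *)

Section Bisection.
Variable R : realType.
Local Notation C := R[i].
Local Notation re := (@complex.Re R).
Local Notation im := (@complex.Im R).
Implicit Types (u : C -> C) (x y l h e : R) (S : seq C).

(** Counting a point once for each half-open interval that contains it is
    additive when the interval is cut, even at that point. *)
Definition end_count (a b x : R) : nat := ((a < x <= b)%R + (a <= x < b)%R)%N.

Lemma end_count_split a m b x : a <= m -> m <= b ->
  end_count a b x = (end_count a m x + end_count m b x)%N.
Proof.
rewrite /end_count => am mb; rewrite addnACA; congr addn.
  case: (leP x m) => [xm|mx]; last by rewrite (le_lt_trans am mx) andbF.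
  by rewrite (le_trans xm mb) addn0.
case: (ltP x m) => [xm|mx]; last by rewrite (le_trans am mx) andbF.
by rewrite (lt_le_trans xm mb) addn0.
Qed.

Lemma end_count_gt0 a b x : a < b -> a <= x <= b -> (0 < end_count a b x)%N.
Proof.
rewrite /end_count => ab /andP[ax xb].
case: (ltgtP a x) ax => // [ax|<-] _; first by rewrite xb.
by rewrite ab addnC.
Qed.

(** A measure concentrated on [S] that is additive under subdivision and charges
    every closed square that meets [S]: a point counts 4 times inside, twice on a
    side, once at a corner. *)
Definition square_count S x y l : nat :=
  \sum_(s <- S) (end_count x (x + l) (re s) * end_count y (y + l) (im s)).

Lemma square_count_split S x y h : 0 <= h ->
  square_count S x y (h + h) =
    (square_count S x y h + square_count S (x + h) y h
    + (square_count S x (y + h) h + square_count S (x + h) (y + h) h))%N.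
Proof.
move=> h0; rewrite /square_count -!big_split /=; apply: eq_bigr => s _.
have h1 a : a <= a + h by rewrite lerDl.
have h2 a : a + h <= a + h + h by rewrite lerDl.
rewrite !addrA (end_count_split _ (h1 x) (h2 x)) (end_count_split _ (h1 y) (h2 y)).
by rewrite mulnDr !mulnDl.
Qed.

Lemma square_count_gt0 S x y l (s : C) : 0 < l -> s \in S -> in_square x y l s ->
  (0 < square_count S x y l)%N.
Proof.
move=> l0 sS [sx sy]; rewrite /square_count (big_rem s) //= addn_gt0 muln_gt0.
by rewrite !end_count_gt0 // ltrDl.
Qed.

(** Bisection. If [P] failed for the large square it would fail for a quarter of
    it, and so on; the quarters shrink to a point, near which [P] holds. *)
Lemma square_ind (P : R -> R -> R -> Prop) x0 y0 l0 : 0 < l0 ->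
  (forall x y h, 0 < h -> P x y h -> P (x + h) y h -> P x (y + h) h ->
     P (x + h) (y + h) h -> P x y (h + h)) ->
  (forall p : C, in_square x0 y0 l0 p -> exists2 d, 0 < d &
     forall x y l, 0 < l < d -> in_square x y l p -> P x y l) ->
  P x0 y0 l0.
Proof.
move=> l00 Pjoin Ploc; apply: contrapT => nP0.
pose l n := l0 / 2 ^+ n; have l0n n : 0 < l n by rewrite divr_gt0 ?exprn_gt0.
have lS n : l n = l n.+1 + l n.+1.
  by rewrite /l exprS invfM mulrCA [2^-1 * _]mulrC -splitr.
have /choice[f fP] : forall np : nat * (R * R), exists q : R * R,
    ~ P np.2.1 np.2.2 (l np.1) ->
    [/\ ~ P q.1 q.2 (l np.1.+1),
        np.2.1 <= q.1 <= np.2.1 + l np.1.+1 & np.2.2 <= q.2 <= np.2.2 + l np.1.+1].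
  move=> [n [x y]] /=; rewrite lS; set h := l n.+1.
  have h0 : 0 < h by exact: l0n.
  have hh a : a <= a + h by rewrite lerDl ltW.
  have [P1|N1] := pselect (P x y h); last by exists (x, y); rewrite /= !lexx !hh.
  have [P2|N2] := pselect (P (x + h) y h).
    2: by exists (x + h, y); rewrite /= !lexx !hh.
  have [P3|N3] := pselect (P x (y + h) h).
    2: by exists (x, y + h); rewrite /= !lexx !hh.
  have [P4|N4] := pselect (P (x + h) (y + h) h).
    2: by exists (x + h, y + h); rewrite /= !lexx !hh.
  by exists (x, y) => N; case: N; exact: Pjoin.
pose q := nat_rect (fun=> (R * R)%type) (x0, y0) (fun n qn => f (n, qn)).
have qP n : ~ P (q n).1 (q n).2 (l n).
  elim: n => [|n IH]; first by rewrite /l expr0 divr1.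
  by have [] := fP (n, q n) IH.
have qS n := fP (n, q n) (qP n).
have lim (c : nat -> R) : (forall n, c n <= c n.+1 <= c n + l n.+1) ->
    exists p, forall n, c n <= p <= c n + l n.
  move=> cS.
  have cle n k : c n <= c (n + k)%N.
    elim: k => [|k IH]; first by rewrite addn0.
    by rewrite addnS (le_trans IH)//; have /andP[] := cS (n + k)%N.
  have cge n k : c (n + k)%N + l (n + k)%N <= c n + l n.
    elim: k => [|k IH]; first by rewrite addn0.
    rewrite addnS; apply: le_trans IH; rewrite (lS (n + k)%N) addrA lerD2r.
    by have /andP[] := cS (n + k)%N.
  have cub n m : c m <= c n + l n.
    have [/subnKC <-|/ltnW/subnKC <-] := leqP n m.
      by apply: le_trans (cge n (m - n)%N); rewrite lerDl ltW.
    by rewrite (le_trans (cle m (n - m)%N))// lerDl ltW.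
  have ubc n : ubound (range c) (c n + l n) by move=> _ [m _ <-].
  exists (sup (range c)) => n; apply/andP; split.
    by apply: ub_le_sup; [exists (c 0%N + l 0%N)|exists n].
  by apply: ge_sup => //; exists (c 0%N), 0%N.
have [px pxP] : exists p, forall n, (q n).1 <= p <= (q n).1 + l n.
  by apply: lim => n; case: (qS n).
have [py pyP] : exists p, forall n, (q n).2 <= p <= (q n).2 + l n.
  by apply: lim => n; case: (qS n).
have [|d d0 dP] := Ploc (px +i* py).
  by have := conj (pxP 0%N) (pyP 0%N); rewrite /l expr0 divr1.
have [n ln] : exists n, l n < d.
  have := archi_boundP (ltW (divr_gt0 l00 d0)); set n := Num.Def.archi_bound _ => nP.
  exists n; rewrite /l ltr_pdivrMr ?exprn_gt0// mulrC -ltr_pdivrMr//.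
  by apply: lt_le_trans nP _; rewrite -natrX ler_nat ltnW// ltn_expl.
by apply: (qP n); apply: dP; [rewrite l0n ln|split].
Qed.

(** The inequality [|square_int| <= e (area + square_count)] is stable under
    subdivision, since its right hand side is additive. It holds for small
    squares: near a point of differentiability because the function is affine up
    to [e l], near an exceptional point because the integral is small while the
    count is at least 1. Then [e] tends to 0. *)
Lemma goursat u x0 y0 l0 S : 0 < l0 ->
  (forall z, in_square x0 y0 l0 z -> cts (K := C) u z) ->
  (forall z, in_square x0 y0 l0 z -> z \notin S -> hol (K := C) u z) ->
  square_int u x0 y0 l0 = 0.
Proof.
move=> l00 uc ud.
suff H e : 0 < e -> n1 (square_int u x0 y0 l0) <=
    e * (l0 ^+ 2 + (square_count S x0 y0 l0)%:R).
  set A := l0 ^+ 2 + _ in H.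
  have A0 : 0 < A by rewrite ltr_wpDr// exprn_gt0.
  have : n1 (square_int u x0 y0 l0) <= 0.
    apply/ler_addgt0Pr => e e0; rewrite add0r.
    by have := H (e / A); rewrite divr_gt0// mulfVK ?gt_eqF//; exact.
  rewrite /n1 => n0; apply/eqP; rewrite eq_complex /=.
  have := normr_ge0 (re (square_int u x0 y0 l0)).
  have := normr_ge0 (im (square_int u x0 y0 l0)).
  by move=> h1 h2; apply/andP; split; rewrite -normr_eq0 eq_le ?h1 ?h2 andbT; lra.
move=> e0.
pose sub x y l := forall z, in_square x y l z -> in_square x0 y0 l0 z.
suff : sub x0 y0 l0 -> n1 (square_int u x0 y0 l0) <=
    e * (l0 ^+ 2 + (square_count S x0 y0 l0)%:R) by exact.
pose P x y l := sub x y l ->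
  n1 (square_int u x y l) <= e * (l ^+ 2 + (square_count S x y l)%:R).
rewrite -/(P x0 y0 l0); apply: square_ind => // [x y h h0 P1 P2 P3 P4 sxy|p pP].
  have subs a b : x <= a <= x + h -> y <= b <= y + h -> sub a b h.
    move=> ha hb z [za zb]; apply: sxy; split; lra.
  have hh a : a <= a + h by rewrite lerDl ltW.
  rewrite square_int_split ?(ltW h0) //; last by move=> z /sxy; exact: uc.
  rewrite square_count_split ?(ltW h0)//.
  have := P1 (subs _ _ _ _); have := P2 (subs _ _ _ _).
  have := P3 (subs _ _ _ _); have := P4 (subs _ _ _ _).
  rewrite !lexx !hh => /(_ isT isT) Q4 /(_ isT isT) Q3 /(_ isT isT) Q2 /(_ isT isT) Q1.
  apply: (le_trans (n1D _ _)); apply: (le_trans (lerD (n1D _ _) (n1D _ _))).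
  apply: (le_trans (lerD (lerD Q1 Q2) (lerD Q3 Q4))).
  rewrite -!mulrDr ler_pM2l // !natrD -subr_ge0.
  set c1 := (square_count _ x y h)%:R; set c2 := (square_count _ (x + h) y h)%:R.
  set c3 := (square_count _ x _ h)%:R; set c4 := (square_count _ _ _ h)%:R.
  rewrite le_eqVlt; apply/orP; left; apply/eqP; ring.
have [pS|pNS] := boolP (p \in S).
  have [d d0 Hd] := continuous_epsP (uc p pP) (ltr01 : 0 < 1 :> C).
  have dR : d = (re d)%:C by rewrite RRe_real// ger0_real// ltW.
  exists (Num.min (re d / 2) (e / 16)).
    by rewrite lt_min !divr_gt0// -ltcR -dR.
  move=> x y l /andP[lx]; rewrite lt_min => /andP[ld le] px sxy.
  have cnt := square_count_gt0 lx pS px.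
  have : n1 (square_int u x y l) <= 8 * 2 * l.
    apply: (@square_int_cell _ _ (u p) 0) => //; first exact: ltW.
      by move=> z /sxy; exact: uc.
    move=> z [zx zy]; rewrite mul0r addr0 -[leRHS]mulr1; apply/n1_le_norm/ltW/Hd.
    apply: le_lt_trans (norm_le_n1 _) _; rewrite dR ltcR /n1 reB imB.
    apply: (@le_lt_trans _ _ (l + l)); last lra.
    case: px => px py; apply: lerD; rewrite ler_norml; lra.
  move=> H; apply: le_trans H _; apply: (@le_trans _ _ e); first lra.
  rewrite ler_peMr ?(ltW e0)//; apply: ler_wpDl; first by rewrite exprn_ge0// ltW.
  by rewrite ler1n.
have e32 : 0 < e / 32 by rewrite divr_gt0.
have e32C : 0 < (e / 32)%:C by rewrite ltcR.
have [d d0 Hd] := derivable_epsP (ud p pP pNS) e32C.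
have dR : d = (re d)%:C by rewrite RRe_real// ger0_real// ltW.
exists (re d / 2); first by rewrite divr_gt0// -ltcR -dR.
move=> x y l /andP[lx ld] px sxy; set m := derive _ _ _ in Hd.
have : n1 (square_int u x y l) <= 8 * (2 * (e / 32 * (l + l))) * l.
  apply: (@square_int_cell _ _ (u p - m * p) m) => //; first exact: ltW.
    by move=> z /sxy; exact: uc.
  move=> z [zx zy].
  have zpl : n1 (z - p) <= l + l.
    by rewrite /n1 reB imB; case: px => px py; apply: lerD; rewrite ler_norml; lra.
  have zp : `|z - p| <= (l + l)%:C by apply: le_trans (norm_le_n1 _) _; rewrite lecR.
  apply: n1_le_norm.
  have -> : u z - (u p - m * p + m * z) = u z - u p - m * (z - p) by ring.
  apply: le_trans (Hd z _) _.
    by apply: le_lt_trans zp _; rewrite dR ltcR; lra.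
  have -> : (e / 32 * (l + l))%:C = (e / 32)%:C * (l + l)%:C by exact: rmorphM.
  exact: ler_wpM2l (ltW e32C) _ _ zp.
move=> H; apply: le_trans H _.
have -> : 8 * (2 * (e / 32 * (l + l))) * l = e * l ^+ 2 by field.
by rewrite ler_pM2l// lerDl ler0n.
Qed.

End Bisection.

(** * The Cauchy estimate over the complex numbers *)

Section CauchyEstimate.
Variable R : realType.
Local Notation C := R[i].
Local Notation re := (@complex.Re R).
Local Notation im := (@complex.Im R).
Implicit Types (u : C -> C) (x y l h e : R) (S : seq C).

(** On the lower side of the square of half side [h] around 0, the kernel
    [1 / z] has imaginary part at least half its maximal modulus [1 / h]. *)
Lemma kernel_im h s : 0 < h -> -h <= s <= h ->
  (2 * h)^-1 <= im (s -i* h)^-1 /\ `|(s -i* h)^-1| <= h^-1%:C.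
Proof.
move=> h0 sh; have n0 : 0 < s ^+ 2 + h ^+ 2 by rewrite ltr_wpDl ?sqr_ge0 ?exprn_gt0.
have s2 : s ^+ 2 <= h ^+ 2 by rewrite -subr_ge0 subr_sqr mulr_ge0//; lra.
split.
  rewrite /= sqrrN mulNr opprK ler_pdivlMr// mulrC ler_pdivrMr ?mulr_gt0//.
  by rewrite mulrCA -expr2; lra.
rewrite normfV fmorphV /= lef_pV2 ?posrE ?normr_gt0 ?ltcR//; last first.
  by rewrite eq_complex /= oppr_eq0 (gt_eqF h0) andbF.
rewrite normc_def lecR /= sqrrN -[leLHS]ger0_norm ?(ltW h0)// -sqrtr_sqr.
by rewrite ler_wsqrtr// lerDr sqr_ge0.
Qed.

(** The factor [w], a power of [i], turns each side of the square into the lower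
    one. *)
Lemma edge_im (w c z g v : C) h s : 0 < h -> -h <= s <= h -> `|w| = 1 ->
  z - c = w * (s -i* h) -> `|v| <= 4^-1 -> g = (v - 1) / (z - c) ->
  im (w * g) <= - (4 * h)^-1.
Proof.
move=> h0 sh w1 zc v4 ->; have [k1 k2] := kernel_im h0 sh.
have w0 : w != 0 by rewrite -normr_eq0 w1 oner_eq0.
have -> : w * ((v - 1) / (z - c)) = v * (s -i* h)^-1 - (s -i* h)^-1.
  by rewrite zc invfM mulrCA mulVKf// mulrBl mul1r.
set k := (s -i* h)^-1 in k1 k2 *; rewrite imB.
have : `|im (v * k)| <= (4 * h)^-1.
  rewrite -lecR; apply: le_trans (Im_le_norm _) _; rewrite normrM invfM rmorphM /=.
  by apply: ler_pM => //; rewrite fmorphV rmorph_nat.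
rewrite ler_norml => /andP[_ k3]; move: k1 k3; rewrite !invfM => k1 k3.
lra.
Qed.

Lemma eq_re_im (z w : C) : re z = re w -> im z = im w -> z = w.
Proof. by case: z w => [? ?] [? ?] /= -> ->. Qed.

(** The sign conflict that ends the proof of [cauchy_square]. *)
Lemma four_sides (i1 i2 i3 i4 a b : R) : i1 <= - a * b -> a * b <= i2 ->
  i3 <= - a * b -> a * b <= i4 -> i1 - i2 + (i3 - i4) = 0 -> 0 < a * b -> False.
Proof. by rewrite mulNr; move: (a * b) => k; lra. Qed.

(** Otherwise [v = u / u c] is at most 1/4 in modulus on the boundary of a square
    around [c], and the boundary integral of [(v - 1) / (z - c)] vanishes by
    Goursat's theorem; but there the integrand is close to [- 1 / (z - c)], so
    that each side contributes a negative imaginary part. *)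
Lemma cauchy_square u S (c M : C) h : 0 < h -> c \notin S ->
  (forall z, `|z - c| <= (2 * h)%:C -> cts (K := C) u z) ->
  (forall z, `|z - c| <= (2 * h)%:C -> z \notin S -> hol (K := C) u z) ->
  (forall z, h%:C <= `|z - c| <= (2 * h)%:C -> `|u z| <= M) -> `|u c| <= 4 * M.
Proof.
move=> h0 cS uc ud uM.
have hc2 : `|c + h%:C - c| = h%:C by rewrite addrC addKr ger0_norm// lecR ltW.
have M0 : 0 <= M.
  by apply: le_trans (normr_ge0 _) (uM (c + h%:C) _); rewrite hc2 lexx lecR; lra.
rewrite real_leNgt ?ger0_real ?mulr_ge0//; apply/negP => uc4.
have u0 : u c != 0 by rewrite -normr_gt0 (le_lt_trans _ uc4)// mulr_ge0.
pose x := re c - h; pose y := im c - h.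
have sqP z : in_square x y (h + h) z -> `|z - c| <= (2 * h)%:C.
  move=> [zx zy]; apply: le_trans (norm_le_n1 _) _; rewrite lecR /n1 reB imB.
  rewrite mulr2n mulrDl mul1r /x /y in zx zy *.
  by apply: lerD; rewrite ler_norml; lra.
pose g z := (u c)^-1 * slope (K := C) u c z.
have cc : hol (K := C) u c.
  by apply: ud => //; rewrite subrr normr0 lecR; lra.
have gc z : in_square x y (h + h) z -> cts (K := C) g z.
  move=> zq; suff sz : cts (K := C) (slope (K := C) u c) z.
    exact: (cvgM (cvg_cst _) sz).
  have [->|zc] := eqVneq z c; first exact: slope_continuous_at.
  by apply: (@slope_continuous C _ _ _ zc); apply: uc; apply: sqP.
have gd z : in_square x y (h + h) z -> z \notin c :: S -> hol (K := C) g z.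
  move=> zq; rewrite inE negb_or => /andP[zc zS].
  have sd : hol (K := C) (slope (K := C) u c) z.
    by apply: (@slope_derivable C _ _ _ zc); apply: ud zS; apply: sqP.
  exact: (derivableM (derivable_cst _ _ _) sd).
have J0 := goursat (addr_gt0 h0 h0) gc gd.
have hh0 : 0 <= h + h by lra.
have [H V] := square_edges hh0 gc.
have E (w z : C) s : -h <= s <= h -> `|w| = 1 -> in_square x y (h + h) z ->
    z - c = w * (s -i* h) -> im (w * g z) <= - (4 * h)^-1.
  move=> sh w1 zq zc.
  have nzc : h%:C <= `|z - c|.
    rewrite zc normrM w1 mul1r; apply: le_trans (Im_le_norm _).
    by rewrite /= normrN ger0_norm ?(ltW h0).
  have zNc : z != c.
    by rewrite -subr_eq0 -normr_gt0; apply: lt_le_trans nzc; rewrite ltcR.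
  apply: (@edge_im w c z (g z) (u z / u c) h s h0 sh w1 zc).
    rewrite normf_div ler_pdivrMr ?normr_gt0// mulrC ler_pdivlMr ?ltr0n//.
    rewrite mulrC; apply: le_trans (ltW uc4); rewrite ler_pM2l ?ltr0n//.
    by apply: uM; rewrite nzc sqP.
  by rewrite /g /slope (negbTE zNc) mulrA; congr (_ / _); rewrite mulrBr mulVf// mulrC.
have e2 a : a - h + (h + h) - (a - h) = h + h by ring.
have hp a : a - h <= a - h + (h + h) by lra.
have inl a : a - h <= a - h <= a - h + (h + h) by rewrite lexx hp.
have inr a : a - h <= a - h + (h + h) <= a - h + (h + h) by rewrite lexx hp.
have sh a t : a - h <= t <= a - h + (h + h) ->
    (-h <= t - a <= h) /\ (-h <= a - t <= h) by move=> ?; split; lra.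
have I1 : im (cint (fun s => g (s +i* y)) x (x + (h + h))) <= - (4 * h)^-1 * (h + h).
  rewrite -[X in _ <= _ * X](e2 (re c)); apply: cint_im_le; [exact: (H _ (inl _))|exact: hp|].
  move=> s sx; rewrite -[g _]mul1r; apply: (E _ _ (s - re c)).
  - by have [] := sh _ _ sx.
  - exact: normr1.
  - by split => //=; exact: inl.
  - by rewrite mul1r; apply: eq_re_im; rewrite ?reB ?imB /= /y; ring.
have I2 : (4 * h)^-1 * (h + h) <=
    im (cint (fun s => g (s +i* (y + (h + h)))) x (x + (h + h))).
  rewrite -[X in _ * X <= _](e2 (re c)); apply: cint_im_ge; [exact: (H _ (inr _))|exact: hp|].
  move=> s sx; have := E (-1) (s +i* (y + (h + h))) (re c - s).
  have -> : im (-1 * g (s +i* (y + (h + h)))) = - im (g (s +i* (y + (h + h)))).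
    by rewrite mulN1r; case: (g _).
  rewrite lerN2; apply.
  - by have [] := sh _ _ sx.
  - by rewrite normrN normr1.
  - by split => //=; exact: inr.
  - by rewrite mulN1r; apply: eq_re_im; rewrite ?reB ?imB /= /y; ring.
have I3 : re (cint (fun t => g ((x + (h + h)) +i* t)) y (y + (h + h)))
    <= - (4 * h)^-1 * (h + h).
  rewrite -[X in _ <= _ * X](e2 (im c)); apply: cint_re_le; [exact: (V _ (inr _))|exact: hp|].
  move=> t ty; have := E 'i%C ((x + (h + h)) +i* t) (t - im c).
  have -> : im ('i%C * g ((x + (h + h)) +i* t)) = re (g ((x + (h + h)) +i* t)).
    by case: (g _) => a b; rewrite /= mul0r mul1r add0r.
  apply.
  - by have [] := sh _ _ ty.
  - by rewrite normc_def /= expr0n expr1n add0r sqrtr1.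
  - by split => //=; exact: inr.
  - by apply: eq_re_im; rewrite ?reB ?imB /= /x; ring.
have I4 : (4 * h)^-1 * (h + h) <=
    re (cint (fun t => g (x +i* t)) y (y + (h + h))).
  rewrite -[X in _ * X <= _](e2 (im c)); apply: cint_re_ge; [exact: (V _ (inl _))|exact: hp|].
  move=> t ty; have := E (- 'i%C) (x +i* t) (im c - t).
  have -> : im (- 'i%C * g (x +i* t)) = - re (g (x +i* t)).
    by case: (g _) => a b; rewrite /= oppr0 mul0r mulN1r add0r.
  rewrite lerN2; apply.
  - by have [] := sh _ _ ty.
  - by rewrite normrN normc_def /= expr0n expr1n add0r sqrtr1.
  - by split => //=; exact: inl.
  - by apply: eq_re_im; rewrite ?reB ?imB /= /x; ring.
have : im (square_int g x y (h + h)) = 0 by rewrite J0.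
rewrite /square_int.
have imD (z1 z2 : C) : im (z1 + z2) = im z1 + im z2 by case: z1 z2 => [? ?] [? ?].
have imi (z1 : C) : im ('i%C * z1) = re z1.
  by case: z1 => a b; rewrite /= mul0r mul1r add0r.
rewrite imD imB imi reB => J.
have : 0 < (4 * h)^-1 * (h + h) by rewrite mulr_gt0 ?invr_gt0 ?mulr_gt0 ?addr_gt0.
exact: four_sides I1 I2 I3 I4 J.
Qed.

(** By continuity the centre can be moved off the exceptional points, at the cost
    of the width of the annulus. *)
Theorem complex_cauchy_estimate : cauchy_estimate C.
Proof.
move=> u S c r M r0 uc ud uM.
have rR : r = (re r)%:C by rewrite RRe_real// ger0_real// ltW.
have re0 : 0 < re r by rewrite -ltcR -rR.
apply/ler_addgt0Pr => e e0.
have [d d0 Hd] : exists2 d, 0 < d & forall w, `|w - c| < d -> `|u w - u c| < e.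
  by apply: continuous_epsP e0; apply: uc; rewrite subrr normr0 mulr_ge0 ?ltW.
have [m [m0 md mr]] := lower_bound d0 (divr_gt0 r0 (ltr0n _ 2)).
have [c' cc' c'S] := avoid_seq S c m0.
have uc' := Hd _ (lt_le_trans cc' md); have cr := lt_le_trans cc' mr.
have tri z : `|z - c| <= `|z - c'| + r / 2.
  by rewrite -[z - c](subrKA c'); apply: le_trans (ler_normD _ _) _; rewrite lerD2l ltW.
have r2 : r / 2 = (re r / 2)%:C.
  by rewrite {1}rR -(rmorph_nat (real_complex R) 2) -fmorphV -rmorphM.
have r4 : 4 * r = (4 * re r)%:C.
  by rewrite {1}rR -(rmorph_nat (real_complex R) 4) -rmorphM.
pose h := 3 / 2 * re r; have h0 : 0 < h by rewrite mulr_gt0.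
have up z : `|z - c'| <= (2 * h)%:C -> `|z - c| <= 4 * r.
  move=> zc; apply: le_trans (tri z) _.
  apply: le_trans (_ : (2 * h)%:C + r / 2 <= _); first by rewrite lerD2r.
  by rewrite r2 r4 -rmorphD lecR /h; lra.
have low z : h%:C <= `|z - c'| -> r <= `|z - c|.
  move=> zc; rewrite -(lerD2r (r / 2)).
  have tri' : `|z - c'| <= `|z - c| + r / 2.
    rewrite -[z - c'](subrKA c); apply: le_trans (ler_normD _ _) _.
    by rewrite lerD2l distrC ltW.
  apply: le_trans tri'; apply: le_trans zc.
  by rewrite r2 [in leLHS]rR -rmorphD lecR /h; lra.
have uc'M : `|u c'| <= 4 * M.
  apply: (cauchy_square h0 c'S) => z.
  - by move=> /up; exact: uc.
  - by move=> /up; exact: ud.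
  - by move=> /andP[/low h1 /up h2]; apply: uM; rewrite h1 h2.
rewrite -[u c](subrK (u c')) addrC; apply: le_trans (ler_normD _ _) _.
by apply: lerD uc'M _; rewrite distrC ltW.
Qed.

End CauchyEstimate.

(** * Liouville's theorem and the order of a zero *)

Section FunctionTheory.
Variable C : numClosedFieldType.
Hypothesis cauchy : cauchy_estimate C.
Hypothesis arch : forall x : C, exists n : nat, `|x| <= n%:R.
Implicit Types (u g : C -> C) (S : seq C).

Lemma le_dist (z w r s : C) : r + s <= `|z| -> `|w| <= s -> r <= `|z - w|.
Proof.
move=> zr ws; rewrite -(lerD2r s); apply: le_trans zr _.
rewrite -{1}[z](subrK w); apply: le_trans (ler_normD _ _) _; exact: lerD.
Qed.

Lemma slope_cts u t z : hol u t -> cts u z -> cts (slope u t) z.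
Proof.
move=> ut uz; have [->|zt] := eqVneq z t; first exact: slope_continuous_at.
exact: slope_continuous.
Qed.

(** The Cauchy estimate is applied around [z], on an annulus that stays away from
    [t], where the quotient is bounded by the values of [u]. *)
Lemma slope_bound u S (M a t z : C) : 0 < a ->
  (forall z, `|z| <= 16 * a -> cts u z) ->
  (forall z, `|z| <= 16 * a -> z \notin S -> hol u z) ->
  (forall z, `|z| <= 16 * a -> `|u z| <= M) ->
  t \notin S -> `|t| <= a -> `|z| <= a -> `|slope u t z| <= 8 * (M / a).
Proof.
move=> a0 uc ud uM tS ta za.
have ta16 : `|t| <= 16 * a by apply: le_trans ta _; rewrite ler_peMl ?(ltW a0)// ler1n.
have ut : hol u t by exact: ud.
have dom w : `|w - z| <= 4 * (3 * a) -> `|w| <= 16 * a.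
  move=> wz; rewrite -[w](subrK z); apply: le_trans (ler_normD _ _) _.
  apply: le_trans (lerD wz za) _.
  have -> : 16 * a = 4 * (3 * a) + a + 3 * a by ring.
  by rewrite lerDl mulr_ge0 ?(ltW a0).
have -> : 8 * (M / a) = 4 * (2 * (M / a)) by ring.
apply: (cauchy (S := t :: S) (r := 3 * a)); first by rewrite mulr_gt0.
- by move=> w /dom wd; apply: slope_cts => //; exact: uc.
- move=> w /dom wd; rewrite inE negb_or => /andP[wt wS].
  exact: slope_derivable wt (ud _ wd wS).
move=> w /andP[wz /dom wd].
have wt : a <= `|w - t|.
  have -> : w - t = w - z - (t - z) by rewrite opprB addrA subrK.
  apply: (le_dist (s := 2 * a)).
    by apply: le_trans wz; rewrite le_eqVlt; apply/orP; left; apply/eqP; ring.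
  apply: le_trans (ler_normB _ _) _; apply: le_trans (lerD ta za) _.
  by rewrite mulr2n mulrDl mul1r.
have wt0 : 0 < `|w - t| by exact: lt_le_trans wt.
rewrite /slope ifN; last by rewrite -subr_eq0 -normr_gt0.
rewrite normf_div mulrA; apply: ler_pM => //; rewrite ?invr_ge0//; last first.
  by rewrite lef_pV2.
apply: le_trans (ler_normB _ _) _; rewrite mulr2n mulrDl mul1r; apply: lerD.
  exact: uM.
exact: uM.
Qed.

(** Each difference quotient lowers the growth by one, until the function tends
    to 0 at infinity; the Cauchy estimate on large discs then makes it vanish. *)
Lemma liouville n : forall u S (R M : C), 0 <= R -> 0 <= M ->
  (forall z, cts u z) -> (forall z, z \notin S -> hol u z) ->
  (forall z, R <= `|z| -> `|z| * `|u z| <= M * `|z| ^+ n) ->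
  exists p : {poly C}, forall z, u z = p.[z].
Proof.
elim: n => [|n IH] u S R M R0 M0 uc ud uM.
  exists 0 => c; rewrite horner0; apply/eqP; rewrite -normr_le0.
  apply/ler_addgt0Pr => e e0; rewrite add0r.
  pose r := R + 1 + 4 * M / e.
  have Me0 : 0 <= 4 * M / e by rewrite divr_ge0 ?mulr_ge0 ?(ltW e0).
  have R10 : 0 < R + 1 by rewrite ltr_wpDl.
  have r0 : 0 < r by rewrite ltr_wpDr.
  apply: (@le_trans _ _ (4 * (M / r))); last first.
    rewrite mulrA ler_pdivrMr // -ler_pdivrMl// mulrC.
    by rewrite lerDr ltW.
  apply: (cauchy (S := S) (r := r + `|c|)).
  - by rewrite ltr_wpDr.
  - by move=> z _.
  - by move=> z _; exact: ud.
  move=> z /andP[zc _].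
  have zr : r <= `|z|.
    rewrite -[z](subrK c) -[c in _ + c]opprK.
    by apply: (le_dist zc); rewrite normrN.
  have z0 : 0 < `|z| by exact: lt_le_trans zr.
  have := uM z; rewrite expr0 mulr1 mulrC -ler_pdivlMr// => H.
  apply: le_trans (H _) _; first by apply: le_trans zr; rewrite /r -addrA lerDl addr_ge0.
  by rewrite ler_wpM2l// lef_pV2.
have [c _ cS] := avoid_seq S (0 : C) (ltr01 : 0 < 1 :> C).
have uc' := ud c cS.
have [|||||p pE] := IH (slope u c) (c :: S) (R + 2 * `|c| + 1) (2 * (M + `|u c|)).
- by rewrite !addr_ge0// mulr_ge0.
- by rewrite mulr_ge0 ?addr_ge0.
- by move=> z; exact: slope_cts.
- move=> z; rewrite inE negb_or => /andP[zc zS].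
  exact: slope_derivable zc (ud _ zS).
- move=> z zR.
  have c2 : 0 <= 2 * `|c| by rewrite mulr_ge0.
  have z1 : 1 <= `|z| by apply: le_trans zR; rewrite lerDr addr_ge0.
  have zRR : R <= `|z| by apply: le_trans zR; rewrite -addrA lerDl addr_ge0.
  have zc2 : 2 * `|c| <= `|z| by apply: le_trans zR; rewrite addrAC lerDr addr_ge0.
  have z0 : 0 < `|z| by exact: lt_le_trans z1.
  have zc : `|z| / 2 <= `|z - c|.
    apply: (le_dist (s := `|z| / 2)); first by rewrite -splitr.
    by rewrite ler_pdivlMr// mulrC.
  have zc0 : 0 < `|z - c| by apply: lt_le_trans zc; rewrite divr_gt0.
  rewrite /slope ifN; last by rewrite -subr_eq0 -normr_gt0.
  rewrite normf_div mulrA ler_pdivrMr//.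
  apply: (@le_trans _ _ (`|z| * ((M + `|u c|) * `|z| ^+ n))).
    rewrite ler_pM2l// mulrDl; apply: le_trans (ler_normB _ _) _; apply: lerD.
      have := uM z zRR; rewrite exprS mulrCA ler_pM2l//.
    by rewrite ler_peMr// exprn_ege1.
  have -> : 2 * (M + `|u c|) * `|z| ^+ n * `|z - c| =
      (2 * `|z - c|) * ((M + `|u c|) * `|z| ^+ n) by ring.
  rewrite ler_wpM2r ?mulr_ge0 ?addr_ge0 ?exprn_ge0//.
  by rewrite mulrC -ler_pdivrMr.
exists ((u c)%:P + ('X - c%:P) * p) => z.
by rewrite !hornerE -pE; exact: slopeE.
Qed.

Lemma cts_bound u (z : C) : cts u z -> exists2 d, 0 < d &
  forall w, `|w - z| <= d -> `|u w| <= `|u z| + 1.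
Proof.
move=> /continuous_epsP/(_ 1 ltr01)[d d0 Hd]; exists (d / 2).
  by rewrite divr_gt0.
move=> w wd; rewrite -[u w](subrK (u z)) addrC.
apply: le_trans (ler_normD _ _) _; rewrite lerD2l ltW// Hd//.
by apply: le_lt_trans wd _; rewrite ltr_pdivrMr// ltr_pMr// ltr1n.
Qed.

Lemma cts_away u (z : C) : cts u z -> u z != 0 -> exists2 d, 0 < d &
  forall w, `|w - z| <= d -> `|u z| / 2 <= `|u w|.
Proof.
move=> uc uz; have e0 : 0 < `|u z| / 2 by rewrite divr_gt0 ?normr_gt0.
have [d d0 Hd] := continuous_epsP uc e0; exists (d / 2); first by rewrite divr_gt0.
move=> w wd; have wd' : `|w - z| < d.
  by apply: le_lt_trans wd _; rewrite ltr_pdivrMr// ltr_pMr// ltr1n.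
rewrite -[u w](subKr (u z)); apply: (le_dist (s := `|u z| / 2)).
  by rewrite -splitr.
by rewrite distrC ltW// Hd.
Qed.

Section ZeroOrder.
Variable a : C.
Hypothesis a0 : 0 < a.

(** Only continuity is asked at 0, since the quotients by [z] below have no more
    a priori; the estimates do not see a single point. *)
Definition punctured_hol u : Prop :=
  (forall z, `|z| <= a -> cts u z) /\
  (forall z, `|z| <= a -> z != 0 -> hol u z).

(** The difference of [u t / t] and [u s / s] is [t - s] times the second
    difference quotient of [u] at [t], [s] and 0, which [slope_bound], used
    twice, bounds uniformly. This replaces the removable singularity theorem. *)
Lemma quotient_lipschitz u : punctured_hol u -> u 0 = 0 ->
  exists L d, [/\ 0 < L, 0 < d & forall t s, 0 < `|t| <= d -> 0 < `|s| <= d ->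
    `|u t / t - u s / s| <= L * `|t - s|].
Proof.
move=> [uc ud] u0.
have [d1 d10 Hd1] : exists2 d, 0 < d &
    forall w, `|w - 0| <= d -> `|u w| <= `|u 0| + 1.
  by apply: cts_bound; apply: uc; rewrite normr0 ltW.
rewrite u0 normr0 add0r in Hd1.
have [m [m0 md ma]] := lower_bound d10 a0.
pose b := m / 16; have b0 : 0 < b by rewrite divr_gt0.
have b16 : 16 * b = m by rewrite mulrC mulfVK ?pnatr_eq0.
pose c := b / 16; have c0 : 0 < c by rewrite divr_gt0.
have c16 : 16 * c = b by rewrite mulrC mulfVK ?pnatr_eq0.
have cb : c <= b by rewrite ler_pdivrMr// ler_peMr ?(ltW b0)// ler1n.
have ba z : `|z| <= 16 * b -> `|z| <= a.
  by move=> /le_trans; apply; rewrite b16.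
have bd z : `|z| <= 16 * b -> `|u z| <= 1.
  move=> zb; apply: Hd1; rewrite subr0; apply: le_trans zb _.
  by rewrite b16.
have bb z : `|z| <= b -> `|z| <= 16 * b.
  by move=> /le_trans; apply; rewrite ler_peMl ?(ltW b0)// ler1n.
pose L := 8 * (8 * (1 / b) / c).
exists L, c; split => // [|t s /andP[t0 tc] /andP[s0 sc]].
  by rewrite !mulr_gt0 ?invr_gt0.
have [->|ts] := eqVneq t s; first by rewrite !subrr normr0 mulr0.
rewrite !normr_gt0 in t0 s0.
have tb := le_trans tc cb; have sb := le_trans sc cb.
have u1 z : `|z| <= 16 * b -> z \notin [:: 0] -> hol u z.
  by move=> /ba zb; rewrite inE; exact: ud.
have ut : hol u t by apply: u1; rewrite ?inE// bb.
pose d := slope u t.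
have dc z : `|z| <= 16 * c -> cts d z.
  by rewrite c16 => /bb/ba zb; apply: slope_cts => //; exact: uc.
have dd z : `|z| <= 16 * c -> z \notin [:: t; 0] -> hol d z.
  rewrite c16 !inE negb_or => /bb/ba zb /andP[zt z0].
  exact: slope_derivable zt (ud _ zb z0).
have dM z : `|z| <= 16 * c -> `|d z| <= 8 * (1 / b).
  rewrite c16 => zb; apply: (slope_bound (S := [:: 0])) => //.
  - by move=> w /ba; exact: uc.
  - by rewrite inE.
have H : `|slope d s 0| <= L.
  apply: (slope_bound (S := [:: t; 0])) => //.
    by rewrite !inE negb_or eq_sym ts.
  by rewrite normr0 ltW.
have E : u t / t - u s / s = (t - s) * slope d s 0.
  have d0E : d 0 = u t / t.
    by rewrite /d /slope ifN 1?eq_sym// u0 !sub0r invrN mulrNN.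
  have dsE : d s = (u s - u t) / (s - t) by rewrite /d /slope ifN 1?eq_sym.
  rewrite /slope ifN 1?eq_sym// d0E dsE; field.
  by rewrite s0 t0 !subr_eq0 eq_sym ts.
by rewrite E normrM mulrC ler_wpM2r.
Qed.

(** When [u 0 = 0] the quotient [u z / z] is Lipschitz near 0. Either it tends to
    0, and setting it to 0 there makes it continuous; or it stays away from 0. *)
Lemma divide_zero u : punctured_hol u ->
  (exists k m d, [/\ 0 < m, 0 < d &
     forall z, 0 < `|z| <= d -> m * `|z| ^+ k <= `|u z|]) \/
  (exists2 q, punctured_hol q & forall z, u z = z * q z).
Proof.
move=> uP; have [uc ud] := uP.
have uc0 : cts u 0 by apply: uc; rewrite normr0 ltW.
have [u0|u0] := eqVneq (u 0) 0; last first.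
  left; have [d d0 Hd] := cts_away uc0 u0.
  exists 0%N, (`|u 0| / 2), d; split=> // [|z /andP[_ zd]].
    by rewrite divr_gt0 ?normr_gt0.
  by rewrite expr0 mulr1; apply: Hd; rewrite subr0.
pose q z := u z / z.
have qE z : u z = z * q z.
  have [->|z0] := eqVneq z 0; first by rewrite u0 mul0r.
  by rewrite /q mulrCA divff// mulr1.
have [qc|nqc] := pselect (forall e, 0 < e -> exists2 d, 0 < d &
    forall w, `|w - 0| < d -> `|q w - q 0| < e).
  right; exists q; last exact: qE.
  split=> z za; last first.
    move=> z0; apply: derivableM; first exact: ud.
    exact: derivableV.
  have [->|z0] := eqVneq z 0; first exact: eps_continuous.
  have uz : cts u z by exact: uc.
  apply: (cvgM uz); apply: cvgV => //.
left; have [L [d [L0 d0 Lip]]] := quotient_lipschitz uP u0.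
have [e [e0 He]] : exists e, 0 < e /\ forall d, 0 < d ->
    exists2 w, 0 < `|w| <= d & e <= `|q w|.
  apply: contrapT => N; apply: nqc => e e0.
  apply: contrapT => N2; apply: N; exists e; split=> // c c0.
  apply: contrapT => N3; apply: N2; exists c => // w wc.
  rewrite subr0 in wc; rewrite {2}/q u0 mul0r subr0.
  have [->|w0] := eqVneq w 0; first by rewrite /q u0 mul0r normr0.
  rewrite real_ltNge ?ger0_real ?(ltW e0)//; apply/negP => ew; apply: N3.
  by exists w => //; rewrite normr_gt0 w0 ltW.
have [c [c0 cd ce]] := lower_bound d0 (divr_gt0 e0 (mulr_gt0 (ltr0Sn C 3) L0)).
have [w /andP[w0 wc] ew] := He c c0.
exists 1%N, (e / 2), c; split=> // [|z /andP[z0 zc]]; first by rewrite divr_gt0.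
rewrite expr1 qE normrM mulrC ler_pM2l//.
rewrite -[q z](subKr (q w)); apply: (le_dist (s := e / 2)); first by rewrite -splitr.
rewrite distrC; apply: le_trans (Lip z w _ _) _; rewrite ?z0 ?w0 ?(le_trans _ cd)//.
apply: (@le_trans _ _ (L * (c + c))).
  by rewrite ler_pM2l//; apply: le_trans (ler_normB _ _) _; exact: lerD.
have -> : e / 2 = L * (e / (4 * L) + e / (4 * L)) by field; rewrite lt0r_neq0.
by rewrite ler_pM2l// lerD.
Qed.

(** If [z] could be divided out indefinitely, the Cauchy estimate for
    [u z / z ^+ k] around a fixed point [t], on an annulus where
    [|z| >= 2 |t|], would give [|u t| <= 4 M / 2 ^+ k] for all [k], so that [u]
    would vanish at [t]. *)
Lemma zero_order u : punctured_hol u ->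
  (forall z, 0 < `|z| <= a -> u z != 0) ->
  exists k m d, [/\ 0 < m, 0 < d &
     forall z, 0 < `|z| <= d -> m * `|z| ^+ k <= `|u z|].
Proof.
move=> uP unz; apply: contrapT => N.
have quo k : exists2 q, punctured_hol q & forall z, u z = z ^+ k * q z.
  elim: k => [|k [q qP qE]]; first by exists u => // z; rewrite expr0 mul1r.
  have [[j [m [d [m0 d0 H]]]]|[q' q'P q'E]] := divide_zero qP; last first.
    by exists q' => // z; rewrite qE q'E exprSr mulrA.
  case: N; exists (k + j)%N, m, d; split=> // z zd.
  rewrite qE exprD normrM normrX mulrCA ler_wpM2l ?exprn_ge0//; exact: H.
have uc0 : cts u 0 by apply: uP.1; rewrite normr0 ltW.
have [d d0 Hd] := cts_bound uc0.
have [b [b0 bd ba]] := lower_bound d0 a0.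
pose M := `|u 0| + 1; pose t := b / 16.
have t0 : 0 < t by rewrite divr_gt0.
have tb : 16 * t = b by rewrite mulrC mulfVK ?pnatr_eq0.
have ta : 0 < `|t| <= a.
  rewrite normr_gt0 lt0r_neq0// ger0_norm ?(ltW t0)//= (le_trans _ ba)// -tb.
  by rewrite ler_peMl ?(ltW t0)// ler1n.
clearbody t.
have bnd k : `|u t| * 2 ^+ k <= 4 * M.
  have [q [qc qd] qE] := quo k.
  have wb w : `|w - t| <= 4 * (3 * t) -> `|w| <= b.
    move=> wt; rewrite -[w](subrK t); apply: le_trans (ler_normD _ _) _.
    rewrite (ger0_norm (ltW t0)); apply: le_trans (_ : 4 * (3 * t) + t <= _).
      by rewrite lerD2r.
    rewrite -tb; have -> : 16 * t = 4 * (3 * t) + t + 3 * t by ring.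
    by rewrite lerDl mulr_ge0 ?(ltW t0).
  have qt : `|q t| <= 4 * (M / (2 * t) ^+ k).
    apply: (cauchy (S := [:: 0]) (r := 3 * t)); first by rewrite mulr_gt0.
    - by move=> w /wb wb'; apply: qc; exact: le_trans ba.
    - by move=> w /wb wb'; rewrite inE => w0; apply: qd => //; exact: le_trans ba.
    move=> w /andP[wt /wb wb'].
    have w2 : 2 * t <= `|w|.
      rewrite -[w](subrK t) -[t in _ + t]opprK; apply: (le_dist (s := t)).
        by apply: le_trans wt; rewrite le_eqVlt; apply/orP; left; apply/eqP; ring.
      by rewrite normrN ger0_norm ?(ltW t0).
    have wk : (2 * t) ^+ k <= `|w| ^+ k.
      by rewrite lerXn2r// nnegrE ?mulr_ge0// ltW.
    have tk0 : 0 < (2 * t) ^+ k by rewrite exprn_gt0// mulr_gt0.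
    rewrite ler_pdivlMr//; apply: (@le_trans _ _ `|u w|); last first.
      by apply: Hd; rewrite subr0; exact: le_trans bd.
    by rewrite qE normrM normrX mulrC ler_wpM2r.
  have -> : `|u t| * 2 ^+ k = `|q t| * (2 * t) ^+ k.
    rewrite qE normrM normrX (ger0_norm (ltW t0)) exprMn; ring.
  have tk0 : 0 < (2 * t) ^+ k by rewrite exprn_gt0// mulr_gt0.
  by move: qt; rewrite mulrA ler_pdivlMr.
have ut0 : 0 < `|u t| by rewrite normr_gt0 unz.
have [n Hn] := arch (4 * M / `|u t|).
have M0 : 0 <= M by rewrite addr_ge0.
rewrite ger0_norm ?divr_ge0 ?mulr_ge0// in Hn.
have := bnd n; rewrite mulrC -ler_pdivlMr// => /le_trans/(_ Hn).
by rewrite -natrX ler_nat leqNgt ltn_expl.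
Qed.

End ZeroOrder.
End FunctionTheory.

(** * Local square roots *)

Section Branches.
Variable C : numClosedFieldType.
Implicit Types (u h b q : C -> C).

(** Differentiability in the form of Caratheodory. *)
Lemma factor_hol u q z : cts q z -> (forall w, u w = u z + (w - z) * q w) ->
  hol u z.
Proof.
move=> qc uE; apply/cvg_ex; exists (q z).
apply/(@cvgrPdist_lt _ _ _ (dnbhs (0 : C))) => e e0.
have [d d0 Hd] := continuous_epsP qc e0.
apply/nbhs_ballP; exists d => // w; rewrite -ball_normE /= sub0r normrN => wd w0.
rewrite [_%:A]mulr1 uE addrAC subrr add0r addrK.
rewrite /GRing.scale /= mulKf// distrC; apply: Hd.
by rewrite addrK.
Qed.

Lemma root_cts h b z : cts h z -> h z = 0 -> (forall w, b w ^+ 2 = h w) -> cts b z.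
Proof.
move=> hc hz bE; have bz : b z = 0.
  by apply/eqP; rewrite -(sqrf_eq0 (b z)) bE hz.
apply: eps_continuous => e e0.
have [d d0 Hd] := continuous_epsP hc (exprn_gt0 2 e0); exists d => // w /Hd.
rewrite hz bz !subr0 -bE normrX ltr_pXn2r// nnegrE// ltW//.
Qed.

(** Near [z] the branch takes the root closer to [y0]. Then [b w + y0] stays away
    from 0, and [b w - y0 = (h w - h z) / (b w + y0)] shows that [b] is
    differentiable at [z]. As differentiability of a trace is a statement at one
    point, the branch may depend on that point. *)
Lemma local_branch h z y0 : hol h z -> h z != 0 -> y0 ^+ 2 = h z ->
  exists b, [/\ hol b z, b z = y0 & forall w, b w ^+ 2 = h w].
Proof.
move=> hd h0 yz; have y00 : y0 != 0 by rewrite -(sqrf_eq0 y0) yz.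
pose b w := if `|sqrtC (h w) - y0| <= `|sqrtC (h w) + y0| then sqrtC (h w)
            else - sqrtC (h w).
have bE w : b w ^+ 2 = h w by rewrite /b; case: ifP; rewrite ?sqrrN sqrtCK.
have bc w : `|b w - y0| <= `|b w + y0|.
  rewrite /b; case: ifPn => // N.
  rewrite -opprD normrN [- _ + _]addrC distrC.
  have := real_leVge (normr_real (sqrtC (h w) - y0)) (normr_real (sqrtC (h w) + y0)).
  by rewrite (negbTE N).
have bl w : `|y0| <= `|b w + y0|.
  rewrite -(ler_pM2l (ltr0Sn C 1)) -{1}(normr_nat C 2) -normrM.
  have -> : 2 * y0 = (b w + y0) - (b w - y0) by ring.
  apply: le_trans (ler_normB _ _) _; rewrite mulr2n mulrDl mul1r lerD2l; exact: bc.
have bn w : b w + y0 != 0.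
  by rewrite -normr_gt0; apply: lt_le_trans (bl w); rewrite normr_gt0.
have bz : b z = y0.
  have /eqP := bE z; rewrite -yz eqf_sqr => /orP[/eqP//|/eqP E].
  by have := bn z; rewrite E addNr eqxx.
have slopeh w : (w - z) * slope h z w = b w ^+ 2 - y0 ^+ 2.
  by rewrite bE yz (slopeE w hd) addrAC subrr add0r.
have bF w : b w = b z + (w - z) * (slope h z w / (b w + y0)).
  by rewrite mulrA slopeh bz subr_sqr mulfK// addrC subrK.
have bcz : cts b z.
  apply: eps_continuous => e e0.
  have hc : cts h z by apply: differentiable_continuous; apply/derivable1_diffP.
  have e1 : 0 < e * `|y0| by rewrite mulr_gt0// normr_gt0.
  have [d d0 Hd] := continuous_epsP hc e1; exists d => // w /Hd hw.
  rewrite bz -(ltr_pM2r (x := `|y0|)) ?normr_gt0//; apply: le_lt_trans hw.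
  by rewrite -bE -yz subr_sqr normrM ler_wpM2l.
exists b; split; [|exact: bz|exact: bE]; apply: factor_hol bF.
have sc := slope_continuous_at hd.
apply: (cvgM sc); apply: cvgV; first exact: bn.
by apply: cvgD; [exact: bcz|exact: cvg_cst].
Qed.

End Branches.

(** * Functions on the projective plane along a curve *)

Section PlaneFunctions.
Variable C : numClosedFieldType.
Local Notation C3 := 'rV[C]_3.
Local Notation P2 := {vspace C3}.
Implicit Types (a b c : C -> C) (F G : P2 -> C).

Definition row3 (x y z : C) : C3 := \row_(i < 3) [:: x; y; z]`_i.

Lemma row3E x y z :
  row3 x y z = x *: row3 1 0 0 + (y *: row3 0 1 0 + z *: row3 0 0 1).
Proof.
by apply/rowP => -[[|[|[|//]]] i]; rewrite !mxE /= ?mulr1 ?mulr0 ?addr0 ?add0r.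
Qed.

Lemma row3_eta (v : C3) : v = row3 (v 0 0) (v 0 1) (v 0 2).
Proof.
by apply/rowP => -[[|[|[|//]]] i]; rewrite !mxE /=; congr (v _ _); apply: val_inj.
Qed.

Lemma row3_neq0 x y z : (row3 x y z != 0) = ~~ [&& x == 0, y == 0 & z == 0].
Proof.
congr (~~ _); apply/eqP/and3P => [/rowP H|[/eqP-> /eqP-> /eqP->]].
  by have := (H 0, H 1, H 2); rewrite !mxE /= => -[[-> ->] ->].
by rewrite row3E !scale0r !addr0.
Qed.

Lemma row3_cts a b c (z : C) : cts a z -> cts b z -> cts c z ->
  row3 (a t) (b t) (c t) @[t --> z] --> row3 (a z) (b z) (c z).
Proof.
move=> ca cb cc; rewrite row3E; under eq_fun do rewrite row3E.
have Z (f : C -> C) (v : C3) : cts f z -> f t *: v @[t --> z] --> f z *: v.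
  move=> fz; have fz' : f t @[t --> z] --> f z := fz.
  by apply: (cvgZr_tmp fz').
exact: (cvgD (Z _ _ ca) (cvgD (Z _ _ cb) (Z _ _ cc))).
Qed.

Lemma row3_differentiable a b c (z : C) : hol a z -> hol b z -> hol c z ->
  differentiable (fun t => row3 (a t) (b t) (c t)) z.
Proof.
move=> /derivable1_diffP da /derivable1_diffP db /derivable1_diffP dc.
under eq_fun do rewrite row3E.
apply: differentiableD; first exact: differentiableZl.
by apply: differentiableD; exact: differentiableZl.
Qed.

Lemma plane_hol F a b c (z : C) : hol a z -> hol b z -> hol c z ->
  differentiable (fun u : C3 => F <[u]>%VS) (row3 (a z) (b z) (c z)) ->
  hol (fun t => F (hpoint (a t) (b t) (c t))) z.
Proof.
move=> da db dc dF; apply/derivable1_diffP.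
exact: (differentiable_comp (row3_differentiable da db dc) dF).
Qed.

Lemma plane_cts F a b c (z : C) : cts a z -> cts b z -> cts c z ->
  differentiable (fun u : C3 => F <[u]>%VS) (row3 (a z) (b z) (c z)) ->
  cts (fun t => F (hpoint (a t) (b t) (c t))) z.
Proof.
move=> ca cb cc /differentiable_continuous dF.
exact: (continuous_cvg _ dF (row3_cts ca cb cc)).
Qed.

End PlaneFunctions.

(** * Affine coordinates on the punctured curve *)

Section EllipticCurve.
Variable C : numClosedFieldType.
Variables e1 e2 : C.
Local Notation C3 := 'rV[C]_3.
Local Notation P2 := {vspace C3}.
Local Notation e3 := (- (e1 + e2)).
Local Notation pts := (curve_pt e1 e2).

Definition weierstrass_cubic (x : C) : C := 4 * (x - e1) * (x - e2) * (x - e3).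

Lemma vline_scale (k : C) (v : C3) : k != 0 -> <[k *: v]>%VS = <[v]>%VS.
Proof.
move=> k0; apply/vspaceP => w; apply/vlineP/vlineP => -[c ->].
  by exists (c * k); rewrite scalerA.
by exists (c / k); rewrite scalerA mulfVK.
Qed.

Lemma hpoint_inj x y x' y' : hpoint x y 1 = hpoint x' y' 1 :> P2 ->
  x = x' /\ y = y'.
Proof.
move=> E; have : row3 x y 1 \in hpoint x' y' 1 by rewrite -E memv_line.
move=> /vlineP[k] /rowP H; have := (H 0, H 1, H 2); rewrite !mxE /=.
by rewrite mulr1 => -[[-> ->] <-]; rewrite !mul1r.
Qed.

(** The only point at infinity of the curve, and the only point above [e1], are
    the two that are removed. *)
Lemma curve_ptP (q : pts) :
  exists x y, [/\ val q = hpoint x y 1, y ^+ 2 = weierstrass_cubic x & x != e1].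
Proof.
case: q => p /= /[dup]; rewrite {1}inE => -[[p1 pE]] pN pP.
have p0 : p != 0%VS by rewrite -dimv_eq0 p1.
pose v := vpick p; have vp : v \in p := memv_pick p.
have v0 : v != 0 by rewrite vpick0.
have pv : p = <[v]>%VS.
  apply/eqP; rewrite eq_sym eqEdim dim_vline v0 p1 andbT.
  by apply/subvP => w /vlineP[k ->]; exact: memvZ.
have vE := row3_eta v; have /= := pE v vp.
set X := v 0 0 in vE *; set Y := v 0 1 in vE *; set Z := v 0 2 in vE *.
have [Z0|Z0] := eqVneq Z 0.
  rewrite Z0 !mulr0 !subr0 => /esym/eqP; rewrite !mulf_eq0 pnatr_eq0 /= !orbb.
  move=> /eqP X0; case: pN; left; rewrite /= pv vE X0 Z0.
  have Y0 : Y != 0.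
    by apply: contraNneq v0 => Y0; rewrite vE X0 Y0 Z0 row3E !scale0r !addr0.
  rewrite -[RHS](vline_scale (row3 0 1 0) Y0); congr (<[_]>)%VS.
  by apply/rowP => -[[|[|[|//]]] i]; rewrite !mxE /= ?mulr0 ?mulr1.
move=> E; exists (X / Z), (Y / Z).
have yE : (Y / Z) ^+ 2 = weierstrass_cubic (X / Z).
  apply: (mulIf (expf_neq0 3 Z0)); rewrite /weierstrass_cubic.
  have -> : (Y / Z) ^+ 2 * Z ^+ 3 = Y ^+ 2 * Z by field.
  by rewrite E; field.
have pq : p = hpoint (X / Z) (Y / Z) 1.
  rewrite pv vE -[LHS](vline_scale (row3 X Y Z) (_ : Z^-1 != 0)) ?invr_eq0//.
  by congr (<[_]>)%VS; apply/rowP => -[[|[|[|//]]] i]; rewrite !mxE /= mulrC // divff.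
split=> //; apply/eqP => xe; case: pN; right.
have y0 : Y / Z = 0.
  by apply/eqP; rewrite -(sqrf_eq0 (Y / Z)) yE xe /weierstrass_cubic subrr mulr0 !mul0r.
by rewrite pq xe y0.
Qed.

Lemma on_curve x y : y ^+ 2 = weierstrass_cubic x -> x != e1 ->
  hpoint x y 1 \in punctured_curve e1 e2.
Proof.
move=> yE xe; rewrite inE; split; first split.
- by rewrite dim_vline row3_neq0 oner_eq0 !andbF.
- move=> v /vlineP[k ->] /=; rewrite !mxE /= mulr1 exprMn yE /weierstrass_cubic; ring.
- case.
    move=> E; have : row3 x y 1 \in hpoint x y 1 := memv_line _; rewrite E.
    move=> /vlineP[k] /rowP/(_ 2); rewrite !mxE /= mulr0 => /eqP.
    by rewrite oner_eq0.
  by move=> /hpoint_inj[E _]; rewrite E eqxx in xe.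
Qed.

Definition at_xy (f : pts -> C) (x y : C) : C :=
  if insub (hpoint x y 1) is Some q then f q else 0.

Lemma at_xyE f (q : pts) x y : val q = hpoint x y 1 -> at_xy f x y = f q.
Proof. by move=> qE; rewrite /at_xy -qE valK. Qed.

Lemma curve_pt_ex x y : y ^+ 2 = weierstrass_cubic x -> x != e1 ->
  exists q : pts, val q = hpoint x y 1.
Proof. by move=> yE xe; exists (@exist _ (fun p => p \in punctured_curve e1 e2) (hpoint x y 1) (on_curve yE xe) : pts). Qed.

End EllipticCurve.

(** * Growth of meromorphic functions at the missing points *)

Section NearLemmas.
Variable C : numClosedFieldType.
Implicit Types (u g : C -> C).

Lemma hol_cts u z : hol u z -> cts u z.
Proof. by move=> du; apply: differentiable_continuous; apply/derivable1_diffP. Qed.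

Lemma hol_cst (c z : C) : hol (fun=> c) z.
Proof. exact: derivable_cst. Qed.

Lemma hol_id (z : C) : hol id z.
Proof. exact: derivable_id. Qed.

Lemma cts_near_eq u g z : (\forall w \near z, u w = g w) -> cts u z -> cts g z.
Proof.
move=> ug uz; have uz' : u w @[w --> z] --> u z := uz.
rewrite (nbhs_singleton ug) in uz'.
exact: cvg_trans (near_eq_cvg ug) uz'.
Qed.

Lemma hol_near_eq u g z : (\forall w \near z, u w = g w) -> hol u z -> hol g z.
Proof. exact: near_eq_derivable. Qed.

Lemma near_neq (z p : C) : z != p -> \forall w \near z, w != p.
Proof.
move=> zp; apply/nbhs_ballP; exists `|z - p|; first by rewrite /= normr_gt0 subr_eq0.
by move=> w; rewrite -ball_normE /=; apply: contraTneq => ->; rewrite ltxx.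
Qed.

(** Closed discs of radius at most [a], the form in which the estimates above
    take their domains. *)
Lemma near_disc (z a : C) (P : C -> Prop) : 0 < a -> (\forall w \near z, P w) ->
  exists d, [/\ 0 < d, d <= a & forall w, `|w - z| <= d -> P w].
Proof.
move=> a0 /nbhs_ballP[d d0 Hd].
have d2 : 0 < d / 2 by rewrite divr_gt0.
have d2d : d / 2 < d by rewrite gtr_pMr// invf_lt1// ltr1n.
have [c [c0 cd ca]] := lower_bound d2 a0.
exists c; split=> // w wc; apply: Hd; rewrite -ball_normE /= distrC.
exact: le_lt_trans wc (le_lt_trans cd d2d).
Qed.

End NearLemmas.

Section MeromorphicGrowth.
Variable C : numClosedFieldType.
Hypothesis cauchy : cauchy_estimate C.
Hypothesis arch : forall x : C, exists n : nat, `|x| <= n%:R.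
Variables (e1 e2 : C).
Local Notation C3 := 'rV[C]_3.
Local Notation P2 := {vspace C3}.
Local Notation pts := (curve_pt e1 e2).

Variables (V : C -> C -> C3) (h : C -> C) (p : P2) (a : C).
Hypothesis a0 : 0 < a.
Hypothesis V_hol : forall (b : C -> C) t, hol b t ->
  differentiable (fun t => V t (b t)) t.
Hypothesis V_cts : forall (b : C -> C) t, cts b t ->
  V s (b s) @[s --> t] --> V t (b t).
Hypothesis V0 : V 0 0 != 0.
Hypothesis Vp : p = <[V 0 0]>%VS.
Hypothesis h_hol : forall t, `|t| <= a -> hol h t.
Hypothesis h0 : h 0 = 0.
Hypothesis h_neq0 : forall t, 0 < `|t| <= a -> h t != 0.
Hypothesis V_curve : forall t n, 0 < `|t| <= a -> n ^+ 2 = h t ->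
  exists2 q : pts, val q = <[V t n]>%VS & val q != p.

Let s t := sqrtC (h t).

Let s2 t : s t ^+ 2 = h t. Proof. exact: sqrtCK. Qed.

Let s0 : s 0 = 0. Proof. by rewrite /s h0 sqrtC0. Qed.

Let rootP t n : n ^+ 2 = h t -> n = s t \/ n = - s t.
Proof. by move/eqP; rewrite -s2 eqf_sqr => /orP[/eqP|/eqP]; [left|right]. Qed.

Let V_near (P : C3 -> Prop) : (\forall w \near V 0 0, P w) ->
  \forall t \near 0, P (V t (s t)) /\ P (V t (- s t)).
Proof.
have hc : cts h 0 by apply/hol_cts/h_hol; rewrite normr0 ltW.
have sc : cts s 0 by exact: root_cts hc h0 s2.
have sNc : cts (fun t => - s t) 0.
  by apply: root_cts hc h0 _ => w; rewrite sqrrN.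
have c1 := V_cts sc; have c2 := V_cts sNc; rewrite s0 ?oppr0 in c1 c2.
by move=> nP; apply: filterI; [exact: c1 nP|exact: c2 nP].
Qed.

Let bounded (H : P2 -> C) : {for V 0 0, continuous (fun u : C3 => H <[u]>%VS)} ->
  exists2 M, 0 < M & \forall t \near 0, `|H <[V t (s t)]>%VS| <= M /\
    `|H <[V t (- s t)]>%VS| <= M.
Proof.
move=> Hc; exists (`|H <[V 0 0]>%VS| + 1); first by rewrite ltr_wpDl.
apply: (V_near (P := fun w => `|H <[w]>%VS| <= `|H <[V 0 0]>%VS| + 1)).
have Hc' : H <[u]>%VS @[u --> V 0 0] --> H <[V 0 0]>%VS := Hc.
have /(_ _ 1 ltr01) := (@cvgrPdist_le _ _ _ _ _ _ _).1 Hc'; apply: filterS => w Hw.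
rewrite -[H <[w]>%VS](subrK (H <[V 0 0]>%VS)) addrC.
by apply: le_trans (ler_normD _ _) _; rewrite lerD2l distrC.
Qed.

(** An end of the curve is described by a double cover [n ^+ 2 = h t] of the
    punctured [t]-disc, through the map [V] to the plane. Writing [f = F / G], the
    product of the values of [G] at the two points above [t] does not depend on
    the choice of a root, hence is holomorphic in [t] outside 0 and bounded below
    by a power of [t]; [F] and [G] are bounded near the end. *)
Lemma meromorphic_growth (f : pts -> C) : meromorphic_at f p ->
  exists k K d, [/\ 0 < K, 0 < d & forall t n (q : pts), 0 < `|t| <= d ->
    n ^+ 2 = h t -> val q = <[V t n]>%VS -> `|f q| * `|t| ^+ k <= K].
Proof.
move=> [F [G [HF HG HFG]]].
have vp : V 0 0 \in p by rewrite Vp memv_line.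
have nF := HF _ vp V0; have nG := HG _ vp V0; have nFG := HFG _ vp V0.
have [MF MF0 bF] := bounded (differentiable_continuous (nbhs_singleton nF)).
have [MG MG0 bG] := bounded (differentiable_continuous (nbhs_singleton nG)).
have [d [d0 da Hd]] := near_disc a0 (filterI (V_near nG) (filterI (V_near nFG) (filterI bF bG))).
pose N t := G <[V t (s t)]>%VS * G <[V t (- s t)]>%VS.
have Gd t : `|t| <= d -> differentiable (fun u : C3 => G <[u]>%VS) (V t (s t)) /\
    differentiable (fun u : C3 => G <[u]>%VS) (V t (- s t)).
  by move=> td; have [] := Hd t; rewrite ?subr0.
have Nhol t : `|t| <= d -> t != 0 -> hol N t.
  move=> td t0; have [D1 D2] := Gd t td.
  have ta := le_trans td da; have ht0 : h t != 0 by apply: h_neq0; rewrite normr_gt0 t0.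
  have [b [bh bt b2]] := local_branch (h_hol ta) ht0 (s2 t).
  have NE : N = fun w => G <[V w (b w)]>%VS * G <[V w (- b w)]>%VS.
    by apply/funext => w; case: (rootP (b2 w)) => ->; rewrite // opprK mulrC.
  rewrite NE; apply: derivableM; apply/derivable1_diffP.
    by rewrite -bt in D1; exact: differentiable_comp (V_hol bh) D1.
  rewrite -bt in D2; apply: differentiable_comp D2.
  by apply: (V_hol (b := fun w => - b w)); exact: derivableN.
have Ncts t : `|t| <= d -> cts N t.
  move=> td; have [->|t0] := eqVneq t 0; last exact/hol_cts/Nhol.
  have [|D1 D2] := Gd 0; first by rewrite normr0 ltW.
  have hc : cts h 0 by apply/hol_cts/h_hol; rewrite normr0 ltW.
  have sc : cts s 0 by exact: root_cts hc h0 s2.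
  have sNc : cts (fun t => - s t) 0.
    by apply: root_cts hc h0 _ => w; rewrite sqrrN.
  have c1 : cts (fun t => G <[V t (s t)]>%VS) 0.
    exact: continuous_cvg _ (differentiable_continuous D1) (V_cts sc).
  have c2 : cts (fun t => G <[V t (- s t)]>%VS) 0.
    exact: continuous_cvg _ (differentiable_continuous D2) (V_cts sNc).
  exact: (cvgM c1 c2).
have GN0 t n (q : pts) : 0 < `|t| <= d -> n ^+ 2 = h t -> val q = <[V t n]>%VS ->
    G (val q) != 0 /\ f q = F (val q) / G (val q).
  move=> /andP[t0 td] n2 qE; have t0a : 0 < `|t| <= a by rewrite t0 (le_trans td).
  have [q' q'E q'p] := V_curve t0a n2.
  have [|_ [[Q1 Q2] _]] := Hd t; first by rewrite subr0.
  have qp : val q != p by rewrite qE -q'E.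
  case: (rootP n2) => nE; rewrite nE in qE.
    by have := Q1 q qE; rewrite -qE => /(_ qp).
  by have := Q2 q qE; rewrite -qE => /(_ qp).
have N0 t : 0 < `|t| <= d -> N t != 0.
  move=> td; have /andP[t0 td'] := td.
  have t0a : 0 < `|t| <= a by rewrite t0 (le_trans td').
  have [q qE _] := V_curve t0a (s2 t); have [g1 _] := GN0 _ _ _ td (s2 t) qE.
  have sN2 : (- s t) ^+ 2 = h t by rewrite sqrrN.
  have [q' q'E _] := V_curve t0a sN2; have [g2 _] := GN0 _ _ _ td sN2 q'E.
  by rewrite mulf_neq0// -?qE -?q'E.
have [k [m [c [m0 c0 Hc]]]] := zero_order cauchy arch d0 (conj Ncts Nhol) N0.
have [r [r0 rd rc]] := lower_bound d0 c0.
exists k, (MF * MG / m), r; split=> //; first by rewrite divr_gt0 ?mulr_gt0.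
move=> t n q /andP[t0 tr] n2 qE; have td := le_trans tr rd.
have [|g0 fE] := GN0 t n q _ n2 qE; first by rewrite t0.
rewrite ler_pdivlMr// -mulrA [_ * m]mulrC.
have lN : m * `|t| ^+ k <= `|N t| by apply: Hc; rewrite t0 (le_trans tr).
apply: le_trans (ler_wpM2l (normr_ge0 _) lN) _.
have [|_ [_ [[F1 F2] [G1 G2]]]] := Hd t; first by rewrite subr0.
rewrite fE normf_div mulrAC.
have gq0 : 0 < `|G (val q)| by rewrite normr_gt0.
rewrite ler_pdivrMr//.
have [G'] : exists2 G' , `|N t| = `|G (val q)| * G' & 0 <= G' <= MG.
  rewrite /N normrM qE; case: (rootP n2) => ->.
    by exists `|G <[V t (- s t)]>%VS|; rewrite ?normr_ge0.
  by exists `|G <[V t (s t)]>%VS|; rewrite ?normr_ge0// mulrC.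
move=> -> /andP[GN2 GN3]; rewrite [`|G (val q)| * G']mulrC mulrA.
rewrite ler_wpM2r ?(ltW gq0)//; apply: ler_pM => //.
by rewrite qE; case: (rootP n2) => ->.
Qed.

End MeromorphicGrowth.

(** * The coordinate functions of the curve *)

Section CoordinateFunctions.
Variable C : numClosedFieldType.
Variables e1 e2 : C.
Local Notation C3 := 'rV[C]_3.
Local Notation P2 := {vspace C3}.
Local Notation pts := (curve_pt e1 e2).

(** Coefficients in the order of the three coordinates of the plane. *)
Definition form (k : C * C * C) (v : C3) : C :=
  k.1.1 * v 0 0 + k.1.2 * v 0 1 + k.2 * v 0 2.

(** A degree 0 rational function on the plane, the quotient of two linear
    forms; it can be computed on any vector of the line ([ratioE]). *)
Definition ratio k m (l : P2) : C := form k (vpick l) / form m (vpick l).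

Lemma formZ k (a : C) v : form k (a *: v) = a * form k v.
Proof. by rewrite /form !mxE; ring. Qed.

Lemma ratioE k m (w : C3) : ratio k m <[w]>%VS = form k w / form m w.
Proof.
have [->|w0] := eqVneq w 0.
  have f0 n : form n 0 = 0 by rewrite /form !mxE !mulr0 !addr0.
  rewrite /ratio; have /vlineP[a ->] := memv_pick (<[0%R]>%VS : P2).
  by rewrite scaler0 f0 !mul0r.
rewrite /ratio; have /vlineP[a aE] := memv_pick <[w]>%VS.
have a0 : a != 0.
  have : vpick <[w]>%VS != 0 by rewrite vpick0 -dimv_eq0 dim_vline w0.
  by rewrite aE scaler_eq0 negb_or => /andP[].
by rewrite aE !formZ invfM mulrACA divff// mul1r.
Qed.

Lemma form_differentiable k (v : C3) : differentiable (form k) v.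
Proof.
have coord i : differentiable (fun w : C3 => w 0 i) v by exact: differentiable_coord.
have Z (c : C) i : differentiable (fun w : C3 => c * w 0 i) v.
  exact: differentiableZ.
exact: differentiableD (differentiableD (Z _ _) (Z _ _)) (Z _ _).
Qed.

Lemma near_form k (v : C3) : form k v != 0 -> \forall w \near v, form k w != 0.
Proof.
move=> fv; have /differentiable_continuous fc := form_differentiable k v.
have fc' : form k w @[w --> v] --> form k v := fc.
exact: (cvgr_neq0 _ fc' fv).
Qed.

Lemma ratio_holomorphic k m (p : P2) :
  (forall v : C3, v \in p -> v != 0 -> form m v != 0) ->
  plane_holomorphic (ratio k m) p.
Proof.
move=> mp v vp v0; apply: filterS (near_form (mp v vp v0)) => w mw.
rewrite (_ : (fun u => _) = (fun u => form k u * (form m u)^-1)).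
  apply: differentiableM; first exact: form_differentiable.
  by apply: differentiableV mw; exact: form_differentiable.
by apply/funext => u; exact: ratioE.
Qed.

Definition ratio_fun k m (q : pts) : C := ratio k m (val q).

Lemma ratio_funE k m (q : pts) x y : val q = hpoint x y 1 ->
  ratio_fun k m q = form k (row3 x y 1) / form m (row3 x y 1).
Proof. by move=> qE; rewrite /ratio_fun qE; exact: ratioE. Qed.

(** Numerator and denominator are divided by a form [n] that does not vanish at
    [p]. *)
Lemma ratio_fun_meromorphic k m n (p : P2) :
  (forall v : C3, v \in p -> v != 0 -> form n v != 0) ->
  (forall (q : pts) w, val q = <[w]>%VS -> form m w != 0) ->
  meromorphic_at (ratio_fun k m) p.
Proof.
move=> np mq; exists (ratio k n), (ratio m n); split.
- exact: ratio_holomorphic.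
- exact: ratio_holomorphic.
- move=> v vp v0; apply: filterS (near_form (np v vp v0)) => w nw q qE _.
  have mw := mq q w qE.
  rewrite /ratio_fun qE !ratioE mulf_neq0 ?invr_eq0//; split=> //.
  by rewrite invfM invrK mulrACA mulVf// mulr1.
Qed.

Lemma ratio_fun_elliptic k m :
  (forall (q : pts) w, val q = <[w]>%VS -> form m w != 0) ->
  ratio_fun k m \in @elliptic_pred C e1 e2.
Proof.
move=> mq; apply/asboolP; split.
- move=> q; exists (ratio k m); split.
    apply: ratio_holomorphic => v vq v0.
    apply: (mq q); apply/eqP; rewrite eqEdim dim_vline v0 /=.
    have [x [y [qE _ _]]] := curve_ptP q.
    rewrite qE dim_vline row3_neq0 oner_eq0 !andbF /= andbT.
    apply/subvP => w; rewrite -qE.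
    have := vq; rewrite qE => /vlineP[a aE].
    have a0 : a != 0 by apply: contraNneq v0 => a0; rewrite aE a0 scale0r.
    move=> /vlineP[b ->]; apply/vlineP; exists (b / a).
    by rewrite aE scalerA mulfVK.
  by move=> v _ _; apply: (@filterE _ (nbhs v)) => w q' q'E; rewrite /ratio_fun q'E.
- apply: (@ratio_fun_meromorphic _ _ (0, 1, 0)) => // v /vlineP[a ->] a0.
  rewrite formZ /form !mxE /= mulf_neq0//.
  by apply: contraNneq a0 => ->; rewrite scale0r.
- apply: (@ratio_fun_meromorphic _ _ (0, 0, 1)) => // v /vlineP[a ->] a0.
  rewrite formZ /form !mxE /= mulf_neq0//.
  by apply: contraNneq a0 => ->; rewrite scale0r.
  by rewrite !mul0r mulr1 !add0r oner_eq0.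
Qed.

Lemma pt_coord (q : pts) (w : C3) : val q = <[w]>%VS ->
  exists x y a, [/\ w = a *: row3 x y 1, a != 0, y ^+ 2 = weierstrass_cubic e1 e2 x & x != e1].
Proof.
have [x [y [-> yE xe]]] := curve_ptP q => wE.
have : w \in hpoint x y 1 by rewrite wE memv_line.
move=> /vlineP[a aE]; exists x, y, a; split=> //.
have : row3 x y 1 \in hpoint x y 1 := memv_line _.
rewrite wE => /vlineP[b bE]; apply/eqP => a0.
have := row3_neq0 x y (1 : C); rewrite bE aE a0 scale0r scaler0 eqxx.
by rewrite oner_eq0 !andbF.
Qed.

Definition fun_x : elliptic_alg e1 e2.
Proof.
exists (ratio_fun (1, 0, 0) (0, 0, 1)); apply: ratio_fun_elliptic => q w.
move=> /pt_coord[x [y [a [-> a0 _ _]]]]; rewrite formZ mulf_neq0//.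
by rewrite /form !mxE /= !mul0r mulr1 !add0r oner_eq0.
Defined.

Definition fun_y : elliptic_alg e1 e2.
Proof.
exists (ratio_fun (0, 1, 0) (0, 0, 1)); apply: ratio_fun_elliptic => q w.
move=> /pt_coord[x [y [a [-> a0 _ _]]]]; rewrite formZ mulf_neq0//.
by rewrite /form !mxE /= !mul0r mulr1 !add0r oner_eq0.
Defined.

(** The function [1 / (x - e1)], whose only pole is the removed point [(e1, 0)]. *)
Definition fun_tV : elliptic_alg e1 e2.
Proof.
exists (ratio_fun (0, 0, 1) (1, 0, - e1)); apply: ratio_fun_elliptic => q w.
move=> /pt_coord[x [y [a [-> a0 _ xe]]]]; rewrite formZ mulf_neq0//.
by rewrite /form !mxE /= mul1r mul0r mulr1 addr0 subr_eq0.
Defined.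

Lemma fun_xE (q : pts) x y : val q = hpoint x y 1 -> val fun_x q = x.
Proof.
by move=> qE; rewrite [LHS](ratio_funE _ _ qE) /form !mxE /= !mul0r !mul1r !addr0 !add0r divr1.
Qed.

Lemma fun_yE (q : pts) x y : val q = hpoint x y 1 -> val fun_y q = y.
Proof.
by move=> qE; rewrite [LHS](ratio_funE _ _ qE) /form !mxE /= !mul0r !mul1r !addr0 !add0r divr1.
Qed.

Lemma fun_tVE (q : pts) x y : val q = hpoint x y 1 -> val fun_tV q = (x - e1)^-1.
Proof.
move=> qE; rewrite [LHS](ratio_funE _ _ qE) /form !mxE /= !mul0r !mul1r !addr0 !add0r.
by rewrite mulr1 mul1r.
Qed.

End CoordinateFunctions.

(** * Growth at the two ends of the curve *)

Section Trace.
Variable C : numClosedFieldType.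
Hypothesis cauchy : cauchy_estimate C.
Hypothesis arch : forall x : C, exists n : nat, `|x| <= n%:R.
Variables (e1 e2 : C).
Local Notation C3 := 'rV[C]_3.
Local Notation P2 := {vspace C3}.
Local Notation pts := (curve_pt e1 e2).
Local Notation e3 := (- (e1 + e2)).
Local Notation cubic := (weierstrass_cubic e1 e2).
Hypotheses (e12 : e1 != e2) (e13 : e1 != e3).

Implicit Types (f : pts -> C) (b : C -> C).

Lemma hol_horner (p : {poly C}) z : hol (horner p) z.
Proof.
elim/poly_ind: p => [|p c IH].
  rewrite (_ : horner 0 = cst 0); first exact: derivable_cst.
  by apply/funext => w; rewrite horner0.
rewrite (_ : horner _ = (horner p * id) + cst c).
  exact: (derivableD (derivableM IH (@hol_id C z)) (@hol_cst C c z)).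
by apply/funext => w; rewrite !hornerE.
Qed.

Lemma hol_poly (u : C -> C) (p : {poly C}) z : (forall w, u w = p.[w]) -> hol u z.
Proof. by move=> uE; have -> : u = horner p; [exact/funext|exact: hol_horner]. Qed.

Lemma cubic_hol z : hol cubic z.
Proof.
apply: (hol_poly (p := 4%:P * ('X - e1%:P) * ('X - e2%:P) * ('X - e3%:P))) => w.
by rewrite !hornerE.
Qed.

Lemma cubic_shift t : cubic (e1 + t) = 4 * t * (e1 + t - e2) * (e1 + t - e3).
Proof. by rewrite /weierstrass_cubic [e1 + t - e1]addrAC subrr add0r. Qed.

Lemma curve_coord (q : pts) x y : val q = hpoint x y 1 ->
  y ^+ 2 = cubic x /\ x != e1.
Proof.
by have [x' [y' [-> yE xe]]] := curve_ptP q => /hpoint_inj[<- <-].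
Qed.

(** The end at [(e1, 0)], with [t = x - e1] and [n = y]. *)
Lemma growth_e1 f : meromorphic_at f (pt_e1 e1) ->
  exists k K d, [/\ 0 < K, 0 < d & forall x y (q : pts), `|x - e1| <= d ->
    val q = hpoint x y 1 -> `|f q| * `|x - e1| ^+ k <= K].
Proof.
move=> fm; pose V t n : C3 := row3 (e1 + t) n 1.
have idh t : hol (fun t : C => e1 + t) t.
  by apply: (hol_poly (p := e1%:P + 'X)) => w; rewrite !hornerE.
have n0 : \forall t \near (0 : C), (t != e2 - e1) /\ (t != e3 - e1).
  by apply: filterI; apply: near_neq; rewrite eq_sym subr_eq0 eq_sym.
have [a [a0 _ Ha]] := near_disc (ltr01 : 0 < 1 :> C) n0.
pose h t := cubic (e1 + t).
have h_hol t : hol h t.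
  apply: (hol_poly (p := 4%:P * 'X * ('X + (e1 - e2)%:P) * ('X + (e1 - e3)%:P))) => w.
  by rewrite /h cubic_shift !hornerE /= [w + e1]addrC.
have hn t : 0 < `|t| <= a -> h t != 0.
  rewrite normr_gt0 /h cubic_shift => /andP[t0 ta].
  have [|t2 t3] := Ha t; first by rewrite subr0.
  rewrite !mulf_neq0 ?pnatr_eq0//.
    by rewrite addrAC addrC -[e1 - e2]opprB subr_eq0.
  by rewrite addrAC addrC -[e1 - e3]opprB subr_eq0.
have fg := @meromorphic_growth C cauchy arch e1 e2 V h (pt_e1 e1) a a0.
have [||||||t n ta n2|k [K [d [K0 d0 H]]]] := fg _ _ _ _ _ _ hn _ f fm.
- by move=> b t bh; exact: (row3_differentiable (idh t) bh (@hol_cst C 1 t)).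
- move=> b t bc; exact: (row3_cts (hol_cts (idh t)) bc (hol_cts (@hol_cst C 1 t))).
- by rewrite row3_neq0 oner_eq0 !andbF.
- by rewrite /V addr0.
- by move=> t _; exact: h_hol.
- by rewrite /h cubic_shift mulr0 !mul0r.
- have xe : e1 + t != e1.
    by move/andP: ta => [t0 _]; rewrite -subr_eq0 addrAC subrr add0r -normr_gt0.
  have [q qE] := curve_pt_ex n2 xe; exists q => //.
  rewrite qE; apply/eqP => /hpoint_inj[E _]; by rewrite E eqxx in xe.
exists k, K, d; split=> // x y q xd qE; have [yE xe] := curve_coord qE.
by apply: (H _ y); rewrite ?normr_gt0 ?subr_eq0 ?xe//= /h /V addrC subrK.
Qed.

(** The end at infinity, with [t = 1 / x] and [n = x / y], so that
    [(x : y : 1) = (n : 1 : t n)] and [n ^+ 2 = t / Q t] with [Q 0 = 4]. *)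
Lemma growth_infty f : meromorphic_at f (pt_infty C) ->
  exists k K r, [/\ 0 < K, 0 < r & forall x y (q : pts), r <= `|x| ->
    val q = hpoint x y 1 -> `|f q| <= K * `|x| ^+ k].
Proof.
move=> fm; pose V t n : C3 := row3 n 1 (t * n).
pose Q t := 4 * (1 - e1 * t) * (1 - e2 * t) * (1 - e3 * t).
have Qh t : hol Q t.
  apply: (hol_poly (p := 4%:P * (1 - e1%:P * 'X) * (1 - e2%:P * 'X)
                         * (1 - e3%:P * 'X))) => w.
  by rewrite !hornerE.
have Q0 : Q 0 != 0 by rewrite /Q !mulr0 !subr0 !mulr1 pnatr_eq0.
have n0 : \forall t \near (0 : C), Q t != 0.
  have /differentiable_continuous Qc : differentiable Q 0 by apply/derivable1_diffP.
  have Qc' : Q t @[t --> 0] --> Q 0 := Qc.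
  exact: (cvgr_neq0 _ Qc' Q0).
have [a [a0 _ Ha]] := near_disc (ltr01 : 0 < 1 :> C) n0.
pose h t := t / Q t.
have Qa t : `|t| <= a -> Q t != 0 by move=> ta; apply: Ha; rewrite subr0.
have h_hol t : `|t| <= a -> hol h t.
  move=> /Qa Qt; have := Qh t; have := @hol_id C t => idt Qt'.
  exact: (derivableM idt (derivableV Qt Qt')).
have hn t : 0 < `|t| <= a -> h t != 0.
  by rewrite normr_gt0 /h => /andP[t0 /Qa Qt]; rewrite mulf_neq0// invr_eq0.
have cE t : t != 0 -> cubic t^-1 = Q t / t ^+ 3.
  by move=> t0; rewrite /weierstrass_cubic /Q; field.
have VE t n : t != 0 -> n != 0 -> <[V t n]>%VS = hpoint t^-1 (t * n)^-1 1.
  move=> t0 nn0; rewrite -[RHS](vline_scale _ (mulf_neq0 t0 nn0)); congr (<[_]>)%VS.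
  apply/rowP => -[[|[|[|//]]] i]; rewrite !mxE /= ?mulr1 ?divff ?mulf_neq0//.
  by rewrite mulrAC divff// mul1r.
have fg := @meromorphic_growth C cauchy arch e1 e2 V h (pt_infty C) a a0.
have [|||||t n ta n2|k [K [d [K0 d0 H]]]] := fg _ _ _ _ h_hol _ hn _ f fm.
- move=> b t bh; exact: (row3_differentiable bh (@hol_cst C 1 t) (derivableM (@hol_id C t) bh)).
- move=> b t bc; have tb : cts (fun t => t * b t) t.
    exact: (cvgM (hol_cts (@hol_id C t)) bc).
  have c1 : cts (fun=> 1 : C) t by exact/hol_cts/hol_cst.
  exact: (row3_cts bc c1 tb).
- by rewrite row3_neq0 oner_eq0 !andbF.
- by rewrite /V mulr0.
- by rewrite /h mul0r.
- have hne := hn t ta; move/andP: ta => [t0 ta]; rewrite normr_gt0 in t0.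
  have nn0 : n != 0 by rewrite -(sqrf_eq0 n) n2.
  have Qt := Qa t ta.
  have te : 1 - e1 * t != 0.
    by apply: contraNneq Qt => E; rewrite /Q E mulr0 !mul0r.
  have yE : (t * n)^-1 ^+ 2 = cubic t^-1.
    by rewrite cE// exprVn exprMn n2 /h; field; rewrite t0.
  have xe : t^-1 != e1.
    by apply: contraNneq te => <-; rewrite mulVf// subrr.
  have [q qE] := curve_pt_ex yE xe; exists q; first by rewrite VE.
  rewrite qE; apply/eqP => E.
  have : row3 t^-1 (t * n)^-1 1 \in hpoint t^-1 (t * n)^-1 1 := memv_line _.
  rewrite E => /vlineP[c] /rowP/(_ 2); rewrite !mxE /= mulr0 => /eqP.
  by rewrite oner_eq0.
have r0 : 0 < d^-1 + a^-1 by rewrite addr_gt0 ?invr_gt0.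
exists k, K, (d^-1 + a^-1); split=> // x y q xr qE.
have x0' : 0 < `|x| by exact: lt_le_trans xr.
have x0 : x != 0 by rewrite -normr_gt0.
have [yE xe] := curve_coord qE.
have xd : `|x^-1| <= d.
  rewrite normfV -[d]invrK lef_pV2 ?posrE ?invr_gt0//; apply: le_trans xr.
  by rewrite lerDl invr_ge0 ltW.
have xa : `|x^-1| <= a.
  rewrite normfV -[a]invrK lef_pV2 ?posrE ?invr_gt0//; apply: le_trans xr.
  by rewrite lerDr invr_ge0 ltW.
have Qx := Qa _ xa.
have xV0 : x^-1 != 0 by rewrite invr_eq0.
have yQ : y ^+ 2 = Q x^-1 * x ^+ 3.
  by rewrite yE -{1}[x]invrK cE// exprVn invrK.
have y0 : y != 0 by rewrite -(sqrf_eq0 y) yQ mulf_neq0// expf_neq0.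
have := H x^-1 (x / y) q; rewrite normr_gt0 xV0 xd => /(_ isT).
rewrite VE// ?mulf_neq0 ?invr_eq0// invrK mulKf// invrK qE => /(_ _ erefl).
rewrite normfV exprVn -ler_pdivlMr ?invr_gt0 ?exprn_gt0// invrK; apply.
rewrite exprMn exprVn yQ /h; field.
by rewrite x0 Qx.
Qed.

End Trace.

(** * The structure of the functions on the punctured curve *)

Section Structure.
Variable C : numClosedFieldType.
Hypothesis cauchy : cauchy_estimate C.
Hypothesis arch : forall x : C, exists n : nat, `|x| <= n%:R.
Variables (e1 e2 : C).
Local Notation C3 := 'rV[C]_3.
Local Notation P2 := {vspace C3}.
Local Notation pts := (curve_pt e1 e2).
Local Notation e3 := (- (e1 + e2)).
Local Notation cubic := (weierstrass_cubic e1 e2).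
Hypotheses (e12 : e1 != e2) (e13 : e1 != e3) (e23 : e2 != e3).
Implicit Types (f : pts -> C) (b : C -> C).

(** The condition on [b] says that [(w, b w)] moves on the curve. *)
Lemma at_xy_near f x0 b : (forall q : pts, holomorphic_at f (val q)) ->
  x0 != e1 -> cts b x0 -> (forall w, b w ^+ 2 = cubic w) ->
  exists F : P2 -> C,
    differentiable (fun u : C3 => F <[u]>%VS) (row3 x0 (b x0) 1) /\
    \forall w \near x0, F (hpoint w (b w) 1) = at_xy f w (b w).
Proof.
move=> fh xe bc b2; have [q0 q0E] := curve_pt_ex (b2 x0) xe.
have [F [HF fF]] := fh q0; exists F.
have vq : row3 x0 (b x0) 1 \in (val q0 : P2) by rewrite q0E; exact: memv_line.
have v0 : row3 x0 (b x0) 1 != 0 by rewrite row3_neq0 oner_eq0 !andbF.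
split; first exact: nbhs_singleton (HF _ vq v0).
have c1 : cts (fun=> 1 : C) x0 by exact/hol_cts/hol_cst.
have R := row3_cts (hol_cts (@hol_id C x0)) bc c1.
apply: filterS (filterI (near_neq xe) (R _ (fF _ vq v0))) => w [we Hw].
have [q qE] := curve_pt_ex (b2 w) we.
by rewrite (at_xyE f qE) -(Hw q qE).
Qed.

Lemma at_xy_cts f x0 b : (forall q : pts, holomorphic_at f (val q)) ->
  x0 != e1 -> cts b x0 -> (forall w, b w ^+ 2 = cubic w) ->
  cts (fun w => at_xy f w (b w)) x0.
Proof.
move=> fh xe bc b2; have [F [dF FE]] := at_xy_near fh xe bc b2.
apply: cts_near_eq FE _.
have c1 : cts (fun=> 1 : C) x0 by exact/hol_cts/hol_cst.
exact: (plane_cts (hol_cts (@hol_id C x0)) bc c1 dF).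
Qed.

Lemma at_xy_hol f x0 b : (forall q : pts, holomorphic_at f (val q)) ->
  x0 != e1 -> hol b x0 -> (forall w, b w ^+ 2 = cubic w) ->
  hol (fun w => at_xy f w (b w)) x0.
Proof.
move=> fh xe bh b2; have [F [dF FE]] := at_xy_near fh xe (hol_cts bh) b2.
apply: hol_near_eq FE _.
exact: (plane_hol (@hol_id C x0) bh (@hol_cst C 1 x0) dF).
Qed.

Definition trace f x : C :=
  at_xy f x (sqrtC (cubic x)) + at_xy f x (- sqrtC (cubic x)).

Lemma traceE f x y : y ^+ 2 = cubic x -> trace f x = at_xy f x y + at_xy f x (- y).
Proof.
move/eqP; rewrite -(sqrtCK (cubic x)) eqf_sqr /trace => /orP[/eqP ->|/eqP ->] //.
by rewrite opprK addrC.
Qed.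

(** At a branch point both roots tend to 0, whatever the choice of the root. *)
Lemma trace_cts f x0 : (forall q : pts, holomorphic_at f (val q)) ->
  x0 != e1 -> cubic x0 = 0 -> cts (trace f) x0.
Proof.
move=> fh xe c0; pose s w := sqrtC (cubic w).
have s2 w : s w ^+ 2 = cubic w by exact: sqrtCK.
have sN2 w : (- s w) ^+ 2 = cubic w by rewrite sqrrN.
have cc : cts cubic x0 by exact/hol_cts/cubic_hol.
have c1 := at_xy_cts fh xe (root_cts cc c0 s2) s2.
have c2 := at_xy_cts fh xe (root_cts cc c0 sN2) sN2.
exact: (cvgD c1 c2).
Qed.

Lemma trace_hol f x0 : (forall q : pts, holomorphic_at f (val q)) ->
  cubic x0 != 0 -> hol (trace f) x0.
Proof.
move=> fh c0.
have xe : x0 != e1 by apply: contraNneq c0 => ->; rewrite /weierstrass_cubic subrr mulr0 !mul0r.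
have [b [bh _ b2]] := local_branch (@cubic_hol C e1 e2 x0) c0 (sqrtCK (cubic x0)).
have bN2 w : (- b w) ^+ 2 = cubic w by rewrite sqrrN.
have -> : trace f = fun w => at_xy f w (b w) + at_xy f w (- b w).
  by apply/funext => w; exact: traceE.
apply: derivableD; first exact: at_xy_hol.
exact: (at_xy_hol fh xe (derivableN bh) bN2).
Qed.

(** After multiplication by a power of [x - e1] the trace extends continuously
    to [e1], and Liouville's theorem applies with the three branch points as
    exceptional points. *)
Lemma trace_poly f : f \in @elliptic_pred C e1 e2 ->
  exists n (p : {poly C}), forall x, (x - e1) ^+ n * trace f x = p.[x].
Proof.
move=> /asboolP[fh fi fe].
have [k [K [d [K0 d0 Hk]]]] := growth_e1 cauchy arch e12 e13 fe.
have [j [L [r [L0 r0 Hj]]]] := growth_infty cauchy arch fi.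
pose u x := (x - e1) ^+ k.+1 * trace f x.
have ph n x : hol (fun x => (x - e1) ^+ n) x.
  by apply: (hol_poly (p := ('X - e1%:P) ^+ n)) => w; rewrite !hornerE.
have tb (B x : C) : x != e1 -> 0 <= B ->
    (forall y (q : pts), val q = hpoint x y 1 -> `|f q| <= B) ->
    `|trace f x| <= 2 * B.
  move=> xe B0 H; pose y := sqrtC (cubic x).
  have y2 : y ^+ 2 = cubic x by exact: sqrtCK.
  have yN2 : (- y) ^+ 2 = cubic x by rewrite sqrrN.
  have [q qE] := curve_pt_ex y2 xe; have [q' q'E] := curve_pt_ex yN2 xe.
  rewrite (traceE f y2) (at_xyE f qE) (at_xyE f q'E) mulr2n mulrDl mul1r.
  by apply: le_trans (ler_normD _ _) _; apply: lerD; [exact: H qE|exact: H q'E].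
have uc x : cts u x.
  have [->|xe] := eqVneq x e1; last first.
    have tc : cts (trace f) x.
      have [c0|c0] := eqVneq (cubic x) 0; first exact: trace_cts.
      by apply/hol_cts/trace_hol.
    exact: (cvgM (hol_cts (ph k.+1 x)) tc).
  apply: eps_continuous => e e0.
  have eK : 0 < e / (4 * K) by rewrite divr_gt0// mulr_gt0.
  have [c [c0 cd ce]] := lower_bound d0 eK.
  exists c => // w wc; rewrite /u subrr expr0n /= mul0r subr0.
  have [->|we] := eqVneq w e1; first by rewrite subrr expr0n /= mul0r normr0.
  have w0 : 0 < `|w - e1| by rewrite normr_gt0 subr_eq0.
  have wk : 0 < `|w - e1| ^+ k by rewrite exprn_gt0.
  have := tb (K / `|w - e1| ^+ k) w we; rewrite divr_ge0 ?(ltW K0) ?(ltW wk)// => /(_ isT) Ht.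
  rewrite normrM normrX exprS -mulrA.
  apply: (@le_lt_trans _ _ (`|w - e1| * (2 * K))).
    rewrite ler_wpM2l// mulrC -ler_pdivlMr// -mulrA; apply: Ht => y q qE.
    by rewrite ler_pdivlMr//; apply: Hk qE; rewrite (le_trans _ cd)// ltW.
  rewrite -ltr_pdivlMr ?mulr_gt0//; apply: lt_le_trans wc _; apply: le_trans ce _.
  by rewrite ler_pM2l// lef_pV2 ?posrE ?mulr_gt0// ler_wpM2r ?(ltW K0)// ler_nat.
have uh x : x \notin [:: e1; e2; e3] -> hol u x.
  rewrite !inE !negb_or => /and3P[x1 x2 x3].
  have c0 : cubic x != 0 by rewrite /weierstrass_cubic !mulf_neq0 ?subr_eq0 ?pnatr_eq0.
  by apply: derivableM; [exact: ph|exact: trace_hol].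
have ug x : r + `|e1| + 1 <= `|x| ->
    `|x| * `|u x| <= (2 ^+ k.+1 * (2 * L)) * `|x| ^+ (k.+1 + j).+1.
  move=> xr.
  have xr' : r <= `|x| by apply: le_trans xr; rewrite -addrA lerDl addr_ge0.
  have xe' : `|e1| <= `|x|.
    by apply: le_trans xr; rewrite addrAC lerDr addr_ge0 ?(ltW r0).
  have xe : x != e1.
    apply/eqP => E; have : `|x| < `|x|; last by rewrite ltxx.
    apply: lt_le_trans xr; rewrite E addrAC ltrDr addr_gt0//.
  have x0 : 0 <= `|x| by [].
  rewrite [`|x| ^+ _.+1]exprS [leRHS]mulrCA ler_wpM2l// /u normrM normrX exprD.
  have -> : 2 ^+ k.+1 * (2 * L) * (`|x| ^+ k.+1 * `|x| ^+ j) =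
      (2 * `|x|) ^+ k.+1 * (2 * (L * `|x| ^+ j)) by rewrite exprMn; ring.
  apply: ler_pM => //.
    rewrite lerXn2r ?nnegrE ?mulr_ge0//; apply: le_trans (ler_normB _ _) _.
    by rewrite mulr2n mulrDl mul1r lerD2l.
  by apply: tb => // [|y q]; [rewrite mulr_ge0 ?(ltW L0) ?exprn_ge0|exact: Hj].
have [||p pE] := liouville cauchy _ _ uc uh ug.
- by rewrite !addr_ge0// ltW.
- by rewrite !mulr_ge0 ?exprn_ge0 ?(ltW L0).
by exists k.+1, p.
Qed.

(** The function [f] is half its trace plus half the trace of [y f] divided by
    [y]. The trace of [y f] vanishes at [e2] and [e3], where [y] does, so its
    polynomial is divisible by [(x - e2) (x - e3) = y^2 / (4 (x - e1))], and the
    division by [y] leaves a factor [y] over a power of [x - e1]. *)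
Lemma elliptic_structure (f : elliptic_alg e1 e2) :
  exists n (p r : {poly C}), forall (q : pts) x y, val q = hpoint x y 1 ->
    (x - e1) ^+ n * val f q = p.[x] + y * r.[x].
Proof.
pose g : elliptic_alg e1 e2 := fun_y e1 e2 * f.
have [n1 [p1 E1]] := trace_poly (valP f).
have [n2 [p2 E2]] := trace_poly (valP g).
have gE (q : pts) x y : val q = hpoint x y 1 -> val g q = y * val f q.
  by move=> qE; rewrite -(fun_yE qE).
have root2 x : x != e1 -> cubic x = 0 -> root p2 x.
  move=> xe c0; apply/rootP; rewrite -E2.
  have y2 : 0 ^+ 2 = cubic x by rewrite expr0n c0.
  have [q qE] := curve_pt_ex y2 xe.
  by rewrite (traceE (val g) y2) oppr0 (at_xyE _ qE) (gE _ _ _ qE) mul0r addr0 mulr0.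
have c2 : cubic e2 = 0 by rewrite /weierstrass_cubic subrr mulr0 mul0r.
have c3 : cubic e3 = 0 by rewrite /weierstrass_cubic subrr mulr0.
have /factor_theorem[p4 p4E] : root p2 e2 by apply: root2; rewrite // eq_sym.
have /factor_theorem[p3 p3E] : root p4 e3.
  have : root p2 e3 by apply: root2; rewrite // eq_sym.
  by rewrite p4E rootM root_XsubC [e3 == _]eq_sym (negbTE e23) orbF.
exists (n1 + n2.+1)%N, (2^-1%:P * ('X - e1%:P) ^+ n2.+1 * p1),
  (8^-1%:P * ('X - e1%:P) ^+ n1 * p3) => q x y qE.
have [yE xe] := curve_coord qE.
have yN : (- y) ^+ 2 = cubic x by rewrite sqrrN.
have [q' q'E] := curve_pt_ex yN xe.
have T1 : (x - e1) ^+ n1 * (val f q + val f q') = p1.[x].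
  by rewrite -E1 (traceE _ yE) (at_xyE _ qE) (at_xyE _ q'E).
have T2 : (x - e1) ^+ n2 * (y * val f q - y * val f q') =
    p3.[x] * (x - e3) * (x - e2).
  have -> : p3.[x] * (x - e3) * (x - e2) = p2.[x] by rewrite p4E p3E !hornerE.
  by rewrite -E2 (traceE _ yE) (at_xyE _ qE) (at_xyE _ q'E) (gE _ _ _ qE)
    (gE _ _ _ q'E) mulNr.
have -> : (2^-1%:P * ('X - e1%:P) ^+ n2.+1 * p1).[x] =
    2^-1 * (x - e1) ^+ n2.+1 * p1.[x] by rewrite !hornerE.
have -> : (8^-1%:P * ('X - e1%:P) ^+ n1 * p3).[x] =
    8^-1 * (x - e1) ^+ n1 * p3.[x] by rewrite !hornerE.
rewrite -T1; have [y0|y0] := eqVneq y 0.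
  have qq' : val f q' = val f q.
    by congr (val f _); apply: val_inj; rewrite q'E qE y0 oppr0.
  by rewrite qq' y0 mul0r addr0 exprD; field.
have yy : y * (y * ((x - e1) ^+ n1 * p3.[x])) =
    4 * (x - e1) ^+ n1.+1 * ((x - e1) ^+ n2 * (y * val f q - y * val f q')).
  by rewrite T2 mulrA -expr2 yE /weierstrass_cubic exprS; ring.
have {}yy : y * (8^-1 * (x - e1) ^+ n1 * p3.[x]) =
    2^-1 * (x - e1) ^+ n1.+1 * ((x - e1) ^+ n2 * (val f q - val f q')).
  apply: (mulfI y0); apply: (mulfI (_ : 8 != 0 :> C)); first by rewrite pnatr_eq0.
  transitivity (y * (y * ((x - e1) ^+ n1 * p3.[x]))); first by field.
  by rewrite yy; field.
by rewrite yy exprD !exprS; field.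
Qed.

End Structure.

(** * Linear maps on a space with a basis *)

Section Bases.
Variables (K : comNzRingType) (V : lmodType K) (I : eqType) (A : I -> V).

Lemma linear_pack (U W : lmodType K) (f : U -> W) : linear f ->
  exists g : {linear U -> W}, g =1 f.
Proof.
move=> fl; pose fM := GRing.isLinear.Build _ _ _ _ f fl.
by pose g : {linear U -> W} := HB.pack f fM; exists g.
Qed.

(** Linear combinations are handled as lists of pairs, possibly with repeated
    indices, because these can be concatenated. *)
Definition coef_of (L : seq (K * I)) (i : I) : K := \sum_(p <- L | p.2 == i) p.1.

Lemma sum_pairs (W : lmodType K) (F : I -> W) (L : seq (K * I)) :
  \sum_(p <- L) p.1 *: F p.2 =
  \sum_(i <- undup (map snd L)) coef_of L i *: F i.
Proof.
under [RHS]eq_bigr do rewrite scaler_suml big_mkcond.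
rewrite exchange_big; apply: eq_big_seq => p pL /=.
rewrite (bigD1_seq p.2) ?undup_uniq ?mem_undup ?map_f//= eqxx.
by rewrite big1 ?addr0// => i; rewrite eq_sym => /negbTE ->.
Qed.

Hypothesis HA : is_basis A.

(** Uniqueness of coordinates, in the form that makes linear maps defined by
    their values on a basis well defined. *)
Lemma basis_pairs_eq (W : lmodType K) (F : I -> W) (L M : seq (K * I)) :
  \sum_(p <- L) p.1 *: A p.2 = \sum_(p <- M) p.1 *: A p.2 ->
  \sum_(p <- L) p.1 *: F p.2 = \sum_(p <- M) p.1 *: F p.2.
Proof.
pose N := L ++ [seq (- p.1, p.2) | p <- M].
have NE (X : lmodType K) (G : I -> X) : \sum_(p <- N) p.1 *: G p.2 =
    \sum_(p <- L) p.1 *: G p.2 - \sum_(p <- M) p.1 *: G p.2.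
  rewrite big_cat big_map /= -sumrN; congr (_ + _).
  by apply: eq_bigr => p _; rewrite scaleNr.
move=> E; apply/eqP; rewrite -subr_eq0 -NE sum_pairs big_seq big1// => i iN.
have [+ _] := HA => /(_ _ (coef_of N) (undup_uniq (map snd N))) ->//.
  by rewrite scale0r.
by rewrite -sum_pairs NE E subrr.
Qed.

Lemma span_pairs v : exists L : seq (K * I), v = \sum_(p <- L) p.1 *: A p.2.
Proof.
have [_ /(_ v)[s [c ->]]] := HA; exists [seq (c i, i) | i <- s].
by rewrite big_map.
Qed.

Lemma basis_lift (W : lmodType K) (F : I -> W) :
  exists f : {linear V -> W}, forall i, f (A i) = F i.
Proof.
have /choice[c cE] := span_pairs.
pose f v : W := \sum_(p <- c v) p.1 *: F p.2.
have fl : linear f.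
  move=> a v w; pose L := [seq (a * p.1, p.2) | p <- c v] ++ c w.
  have LE (X : lmodType K) (G : I -> X) : \sum_(p <- L) p.1 *: G p.2 =
      a *: (\sum_(p <- c v) p.1 *: G p.2) + \sum_(p <- c w) p.1 *: G p.2.
    rewrite big_cat big_map /= scaler_sumr; congr (_ + _).
    by apply: eq_bigr => p _; rewrite scalerA.
  by rewrite /f -LE; apply: basis_pairs_eq; rewrite LE -!cE.
have [g gE] := linear_pack fl; exists g => i; rewrite gE /f.
have := @basis_pairs_eq _ F (c (A i)) [:: (1, i)].
by rewrite -cE !big_seq1 !scale1r; exact.
Qed.

Lemma basis_ext (W : lmodType K) (f g : {linear V -> W}) :
  (forall i, f (A i) = g (A i)) -> f =1 g.
Proof.
move=> fg v; have [L ->] := span_pairs v; rewrite !linear_sum.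
by apply: eq_bigr => p _; rewrite !linearZ fg.
Qed.

End Bases.

Lemma is_basis_pairs (K : comNzRingType) (V : lmodType K) (I : eqType) (A : I -> V) :
  (forall (s : seq I) (c : I -> K), uniq s ->
     \sum_(i <- s) c i *: A i = 0 -> {in s, forall i, c i = 0}) ->
  (forall v, exists L : seq (K * I), v = \sum_(p <- L) p.1 *: A p.2) ->
  is_basis A.
Proof.
move=> ind span; split=> // v; have [L ->] := span v.
by exists (undup (map snd L)), (coef_of L); exact: sum_pairs.
Qed.

Lemma basis_bij (K : comNzRingType) (V W : lmodType K) (I : eqType) (A : I -> V)
    (B : I -> W) (f : {linear V -> W}) :
  is_basis A -> is_basis B -> (forall i, f (A i) = B i) ->
  exists g : {linear W -> V}, cancel f g /\ cancel g f.
Proof.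
move=> HA HB fE; have [g gE] := basis_lift HB A; exists g; split.
  by apply: (basis_ext HA (f := g \o f) (g := idfun)) => i /=; rewrite fE gE.
by apply: (basis_ext HB (f := f \o g) (g := idfun)) => i /=; rewrite gE fE.
Qed.

(** * Multilinear maps on tensor products *)

Section Bilinear.
Variable K : comNzRingType.

Section Basic.
Variables (U V W : lmodType K) (b : U -> V -> W).
Hypothesis b_bilin : bilinear_map b.

Lemma bil0l v : b 0 v = 0.
Proof. by have := b_bilin.1 v 1 0 0; rewrite scaler0 addr0 scale1r -[LHS]addr0 => /addrI. Qed.

Lemma bil0r u : b u 0 = 0.
Proof. by have := b_bilin.2 u 1 0 0; rewrite scaler0 addr0 scale1r -[LHS]addr0 => /addrI. Qed.

Lemma bilDl u u' v : b (u + u') v = b u v + b u' v.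
Proof. by have := b_bilin.1 v 1 u u'; rewrite !scale1r. Qed.

Lemma bilDr u v v' : b u (v + v') = b u v + b u v'.
Proof. by have := b_bilin.2 u 1 v v'; rewrite !scale1r. Qed.

Lemma bilZl a u v : b (a *: u) v = a *: b u v.
Proof. by have := b_bilin.1 v a u 0; rewrite /= !addr0 bil0l addr0. Qed.

Lemma bilZr a u v : b u (a *: v) = a *: b u v.
Proof. by have := b_bilin.2 u a v 0; rewrite !addr0 bil0r addr0. Qed.

End Basic.

(** Stated as an induction principle, which is how it is used. *)
Definition spans (M : lmodType K) (G : M -> Prop) : Prop :=
  forall P : M -> Prop, P 0 -> (forall a u t, G u -> P t -> P (a *: u + t)) ->
  forall t, P t.

Lemma bil_ext (U V W : lmodType K) (G : U -> Prop) (H : V -> Prop)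
    (b c : U -> V -> W) : bilinear_map b -> bilinear_map c -> spans G -> spans H ->
  (forall u v, G u -> H v -> b u v = c u v) -> b =2 c.
Proof.
move=> hb hc sG sH bc s t; elim/sG: s => [|a u s Gu IH].
  by rewrite (bil0l hb) (bil0l hc).
rewrite hb.1 hc.1 IH; congr (a *: _ + _).
elim/sH: t {IH} => [|a' v t Hv IH]; first by rewrite (bil0r hb) (bil0r hc).
by rewrite hb.2 hc.2 IH bc.
Qed.

Lemma bilinear_comb (U V W : lmodType K) (b c : U -> V -> W) (k : K) :
  bilinear_map b -> bilinear_map c -> bilinear_map (fun u v => b u v + k *: c u v).
Proof.
move=> hb hc; split=> [v a u u'|u a v v'].
  by rewrite hb.1 hc.1 !scalerDr !scalerA (mulrC a) addrACA.
by rewrite hb.2 hc.2 !scalerDr !scalerA (mulrC a) addrACA.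
Qed.

Lemma bilinear_comp (U V W U' V' X : lmodType K) (b : U -> V -> W)
    (f : {linear U' -> U}) (h : {linear V' -> V}) (l : {linear W -> X}) :
  bilinear_map b -> bilinear_map (fun u v => l (b (f u) (h v))).
Proof.
move=> hb; split=> [v a u u'|u a v v'].
  by rewrite linearP hb.1 linearP.
by rewrite linearP hb.2 linearP.
Qed.

Lemma tensor_spans (U V : lmodType K) (H : V -> Prop) : spans H ->
  spans (fun t : tensor U V => exists u v, H v /\ t = tens u v).
Proof.
have [tl tr] := tens_bilinear U V.
move=> sH P P0 PS t; elim/tensor_ind: t => [//|a u v t Pt].
elim/sH: v t Pt => [|c w v Hw IH] t Pt.
  by rewrite (bil0r (tens_bilinear U V)) scaler0 add0r.
rewrite tr scalerDr scalerA -addrA; apply: PS; first by exists u, w.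
exact: IH.
Qed.

Lemma tens_mapP (U V V' : lmodType K) (f : {linear V -> V'}) :
  bilinear_map (fun (u : U) v => tens u (f v)).
Proof.
have [tl tr] := tens_bilinear U V'.
by split=> [v a u u'|u a v v']; rewrite ?tl// linearP tr.
Qed.

Lemma tens_map_linear (U V V' : lmodType K) (f : {linear V -> V'}) :
  linear (@tens_map K U V V' f).
Proof. exact: (tlift_linear (@tens_mapP U V V' f)). Qed.

Lemma tens_map_tens (U V V' : lmodType K) (f : {linear V -> V'}) (u : U) v :
  tens_map f (tens u v) = tens u (f v).
Proof. exact: (tlift_tens (@tens_mapP U V V' f)). Qed.

Lemma tens_map_bij (U V V' : lmodType K) (f : {linear V -> V'}) (h : {linear V' -> V}) :
  cancel f h -> cancel h f -> bijective (@tens_map K U V V' f).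
Proof.
move=> fK hK; exists (@tens_map K U V' V h).
  elim/tensor_ind => [|a u v t IH].
    by rewrite /tens_map !(tlift0 (tens_mapP _ _)).
  by rewrite !tens_map_linear IH !tens_map_tens fK.
elim/tensor_ind => [|a u v t IH].
  by rewrite /tens_map !(tlift0 (tens_mapP _ _)).
by rewrite !tens_map_linear IH !tens_map_tens hK.
Qed.

Section TensorBilinear.
Variables (U V U' V' W : lmodType K) (b : U -> V -> U' -> V' -> W).
Hypothesis b_in : forall u v, bilinear_map (b u v).
Hypothesis b_out : forall u' v', bilinear_map (fun u v => b u v u' v').

Let inner (t : tensor U' V') : bilinear_map (fun u v => tlift (b u v) t).
Proof.
split=> [v a u u'|u a v v']; elim/tensor_ind: t => [|c x y t IH].
- by rewrite !(tlift0 (b_in _ _)) scaler0 addr0.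
- rewrite !(tlift_linear (b_in _ _)) !(tlift_tens (b_in _ _)) IH (b_out x y).1.
  by rewrite !scalerDr !scalerA (mulrC c) addrACA.
- by rewrite !(tlift0 (b_in _ _)) scaler0 addr0.
- rewrite !(tlift_linear (b_in _ _)) !(tlift_tens (b_in _ _)) IH (b_out x y).2.
  by rewrite !scalerDr !scalerA (mulrC c) addrACA.
Qed.

(** The universal property is used once for each factor. *)
Lemma tensor_bilinear : exists B : tensor U V -> tensor U' V' -> W,
  bilinear_map B /\ forall u v u' v', B (tens u v) (tens u' v') = b u v u' v'.
Proof.
exists (fun s t => tlift (fun u v => tlift (b u v) t) s); split; last first.
  by move=> u v u' v'; rewrite (tlift_tens (inner _)) (tlift_tens (b_in _ _)).
split=> [t|s a t t']; first exact: (tlift_linear (inner t)).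
elim/tensor_ind: s => [|c u v s IH].
  by rewrite !(tlift0 (inner _)) scaler0 addr0.
rewrite !(tlift_linear (inner _)) IH !(tlift_tens (inner _)).
rewrite (tlift_linear (b_in u v)) !scalerDr !scalerA (mulrC c).
by rewrite addrACA.
Qed.

End TensorBilinear.
End Bilinear.

Section GenericLie.
Variables (K : comNzRingType) (M : lmodType K) (D : M -> M -> M) (G : M -> Prop).
Hypothesis D_bilin : bilinear_map D.
Hypothesis G_spans : spans G.
Hypothesis M2 : forall u : M, u + u = 0 -> u = 0.

(** Antisymmetry and the Jacobi identity are multilinear, and the Jacobi sum is
    invariant under cyclic permutations, so that it suffices to treat one
    argument at a time. Antisymmetry gives [D u u + D u u = 0]. *)
Lemma lie_on_generators :
  (forall u v, G u -> G v -> D u v = - D v u) ->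
  (forall u v w, G u -> G v -> G w ->
     D u (D v w) + D v (D w u) + D w (D u v) = 0) -> lie_bracket D.
Proof.
move=> anti jac.
have anti' u v : D u v = - D v u.
  elim/G_spans: u => [|a u s Gu IH].
    by rewrite (bil0l D_bilin) (bil0r D_bilin) oppr0.
  rewrite D_bilin.1 D_bilin.2 IH opprD; congr (_ + _); rewrite -scalerN; congr (_ *: _).
  elim/G_spans: v {IH} => [|a' v t Gv IH].
    by rewrite (bil0l D_bilin) (bil0r D_bilin) oppr0.
  by rewrite D_bilin.1 D_bilin.2 IH opprD anti// scalerN.
split=> //; first by move=> u; apply: M2; rewrite {1}anti' addNr.
have step (J : M -> M -> M -> M) :
    (forall v w, linear (fun u => J u v w)) ->
    forall v w, (forall u, G u -> J u v w = 0) -> forall u, J u v w = 0.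
  move=> Jl v w H; elim/G_spans => [|a u t Gu IH].
    by have := Jl v w 1 0 0; rewrite scaler0 addr0 scale1r -[LHS]addr0 => /addrI.
  by rewrite (Jl v w a u t) H// IH scaler0 addr0.
pose J u v w := D u (D v w) + D v (D w u) + D w (D u v).
have J1 v w : linear (fun u => J u v w).
  move=> a u u'; rewrite /J !D_bilin.1 !D_bilin.2 !scalerDr.
  by rewrite (addrACA (a *: D u (D v w))) (addrACA (a *: D u (D v w) + _)).
have Jrot u v w : J u v w = J v w u.
  by rewrite /J -addrA addrC.
move=> u v w; rewrite -[LHS]/(J u v w); apply: (step _ J1) => {}u Gu.
rewrite Jrot; apply: (step _ J1) => {}v Gv; rewrite Jrot; apply: (step _ J1) => {}w Gw.
exact: jac.
Qed.

End GenericLie.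

(** * The family of brackets *)

Section FamilyLie.
Variables (K : comNzRingType) (g : lmodType K) (br : g -> g -> g).
Hypothesis br_lie : lie_bracket br.

(** The base ring [B] is the complex numbers for the algebra over a point, and the
    polynomials in the parameters for the deformation. *)
Lemma family_lie (B : comNzRingType) (M : lmodType B) (T : g -> int -> M)
    (p q : B) (D : M -> M -> M) :
  (forall x y n, T (x + y) n = T x n + T y n) -> bilinear_map D ->
  spans (fun u => exists x n, u = T x n) -> (forall u : M, u + u = 0 -> u = 0) ->
  (forall x y n m, D (T x n) (T y m) =
     if (2 %| n)%Z || (2 %| m)%Z then T (br x y) (n + m)
     else T (br x y) (n + m) + p *: T (br x y) (n + m - 2)
          + q *: T (br x y) (n + m - 4)) ->
  lie_bracket D.
Proof.
have [br_bil br_alt br_jac] := br_lie.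
move=> TD D_bil T_span M2 DT.
have T0 n : T 0 n = 0.
  by have := TD 0 0 n; rewrite addr0 -[LHS]addr0 => /addrI.
have TN x n : T (- x) n = - T x n.
  by apply/eqP; rewrite -addr_eq0 -TD addNr T0.
have anti x y : br x y = - br y x.
  have := br_alt (x + y); rewrite (bilDl br_bil) !(bilDr br_bil) !br_alt.
  by rewrite addr0 add0r => /eqP; rewrite addr_eq0 => /eqP.
pose e (c : bool) x s : M :=
  if c then T x s + p *: T x (s - 2) + q *: T x (s - 4) else T x s.
have De x y n m : D (T x n) (T y m) =
    e (~~ ((2 %| n)%Z || (2 %| m)%Z)) (br x y) (n + m).
  by rewrite DT /e; case: ifP.
have eD c x y s : e c (x + y) s = e c x s + e c y s.
  rewrite /e; case: c; rewrite !TD ?scalerDr //.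
  by rewrite (addrACA (T x s)) (addrACA (T x s + _)).
have e0 c s : e c 0 s = 0 by rewrite /e; case: c; rewrite !T0 ?scaler0 ?addr0.
apply: (lie_on_generators D_bil T_span M2).
  move=> _ _ [x [n ->]] [y [m ->]]; rewrite !De anti addrC orbC.
  by rewrite /e; case: ifP => _; rewrite !TN ?scalerN ?opprD.
move=> _ _ _ [x [n ->]] [y [m ->]] [z [k ->]].
(* The triple bracket has the extra terms exactly when at least two of the
   three indices are odd. *)
have triple u v w (i j l : int) : D (T u i) (D (T v j) (T w l)) =
    e [|| ~~ ((2 %| i)%Z || (2 %| j)%Z), ~~ ((2 %| i)%Z || (2 %| l)%Z)
       | ~~ ((2 %| j)%Z || (2 %| l)%Z)] (br u (br v w)) (i + j + l).
  rewrite De {1}/e; case: ifPn => [jl|jl]; last first.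
    rewrite De addrA; congr (e _ _ _); lia.
  rewrite !(bilDr D_bil) !(bilZr D_bil) !De /e.
  have -> : (2 %| (j + l)%R)%Z by lia.
  have -> : (2 %| (j + l - 2)%R)%Z by lia.
  have -> : (2 %| (j + l - 4)%R)%Z by lia.
  by rewrite !orbT /= !addrA.
rewrite !triple.
have -> : m + k + n = n + m + k by lia.
have -> : k + n + m = n + m + k by lia.
set c1 := [|| _, _ | _]; set c2 := [|| _, _ | _]; set c3 := [|| _, _ | _].
have -> : c2 = c1 by rewrite /c1 /c2; lia.
have -> : c3 = c1 by rewrite /c1 /c3; lia.
by rewrite -!eD br_jac e0.
Qed.

End FamilyLie.

Section FamilyBracket.
Variables (K : comNzRingType) (g V : lmodType K) (br : g -> g -> g) (A : int -> V).
Hypothesis br_bil : bilinear_map br.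
Hypothesis HA : is_basis A.

Lemma product_on_basis (W : lmodType K) (F : int -> int -> W) :
  exists mu : V -> V -> W, bilinear_map mu /\ forall n m, mu (A n) (A m) = F n m.
Proof.
have /choice[f fE] n := basis_lift HA (F n).
have /choice[h hE] w := basis_lift HA (fun n => f n w).
exists (fun v w => h w v); split; last by move=> n m; rewrite hE fE.
split=> [w a v v'|v a w w']; first exact: linearP.
have [L ->] := span_pairs HA v; rewrite /= !linear_sum -big_split /=.
apply: eq_bigr => p _; rewrite !linearZ /= !hE linearP /= scalerDr !scalerA.
by rewrite mulrC.
Qed.

Lemma basis_spans : spans (fun v => exists n, v = A n).
Proof.
move=> P P0 PS v; have [L ->] := span_pairs HA v.
elim: L => [|p L IH]; first by rewrite big_nil.
by rewrite big_cons; apply: PS => //; exists p.2.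
Qed.

Definition on_tensors (t : tensor g V) : Prop := exists x n, t = tens x (A n).

Lemma on_tensors_spans : spans on_tensors.
Proof.
move=> P P0 PS; apply: (tensor_spans basis_spans) => // a u t [x [v [[n ->] ->]]].
by apply: PS; exists x, n.
Qed.

Lemma tensor_product_on_basis (F : int -> int -> V) :
  exists c : tensor g V -> tensor g V -> tensor g V, bilinear_map c /\
    forall x y n m, c (tens x (A n)) (tens y (A m)) = tens (br x y) (F n m).
Proof.
have [mu [mu_bil muE]] := product_on_basis F.
have [tl tr] := tens_bilinear g V.
have [||c [c_bil cE]] := @tensor_bilinear _ _ _ _ _ _
    (fun x v y w => tens (br x y) (mu v w)).
- move=> x v; split=> [w a y y'|y a w w']; first by rewrite br_bil.2 tl.
  by rewrite mu_bil.2 tr.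
- move=> y w; split=> [v a x x'|x a v v']; first by rewrite br_bil.1 tl.
  by rewrite mu_bil.1 tr.
by exists c; split=> // x y n m; rewrite cE muE.
Qed.

(** The family is [c0 + 3 e1 c1 + (e1 - e2)(2 e1 + e2) c2] with components [c0],
    [c1], [c2] that do not depend on the parameters; [j] shifts the index by
    [2 j]. *)
Definition component (j : nat) (c : tensor g V -> tensor g V -> tensor g V) :=
  bilinear_map c /\ forall x y n m, c (tens x (A n)) (tens y (A m)) =
    if (j != 0%N) && ((2 %| n)%Z || (2 %| m)%Z) then 0
    else tens (br x y) (A (n + m - (2 * j)%:Z)).

Lemma component_ex j : exists c, component j c.
Proof.
have [c [c_bil cE]] := tensor_product_on_basis (fun n m =>
  if (j != 0%N) && ((2 %| n)%Z || (2 %| m)%Z) then 0 else A (n + m - (2 * j)%:Z)).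
exists c; split=> // x y n m; rewrite cE; case: ifP => // _.
exact: bil0r (tens_bilinear g V) _.
Qed.

Lemma family_of_components c0 c1 c2 e1 e2 :
  component 0 c0 -> component 1 c1 -> component 2 c2 ->
  family_bracket br A e1 e2 (fun s t => c0 s t + (3 * e1) *: c1 s t
    + ((e1 - e2) * (2 * e1 + e2)) *: c2 s t).
Proof.
move=> [b0 E0] [b1 E1] [b2 E2]; split.
  exact: bilinear_comb (bilinear_comb _ b0 b1) b2.
move=> x y n m; rewrite E0 E1 E2 /= muln0 subr0.
by case: ifP => _; rewrite ?scaler0 ?addr0.
Qed.

Lemma family_bracket_ex e1 e2 : exists b, family_bracket br A e1 e2 b.
Proof.
have [c0 C0] := component_ex 0; have [c1 C1] := component_ex 1.
have [c2 C2] := component_ex 2.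
by eexists; exact: family_of_components C0 C1 C2.
Qed.

Lemma family_bracket_unique e1 e2 b b' : family_bracket br A e1 e2 b ->
  family_bracket br A e1 e2 b' -> b' =2 b.
Proof.
move=> [b_bil bE] [b'_bil b'E].
apply: (bil_ext b'_bil b_bil on_tensors_spans on_tensors_spans).
by move=> _ _ [x [n ->]] [y [m ->]]; rewrite bE b'E.
Qed.

Lemma family_bracket_lie e1 e2 b : (forall u : tensor g V, u + u = 0 -> u = 0) ->
  lie_bracket br -> family_bracket br A e1 e2 b -> lie_bracket b.
Proof.
move=> M2 br_lie [b_bil bE].
apply: (family_lie br_lie (T := fun x n => tens x (A n)) (p := 3 * e1)
  (q := (e1 - e2) * (2 * e1 + e2))) => // [x y n|].
  exact: (bilDl (tens_bilinear g V)).
exact: on_tensors_spans.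
Qed.

End FamilyBracket.

(** * Extension of scalars and fibres *)

Section BaseChange.
Variables (K : comNzRingType) (B : comAlgType K) (L : lmodType K).
Local Notation LB := (base_ext B L).
Local Notation tL := (tensor (B : lmodType K) L).

Definition btens (b : B) (l : L) : LB := (tens b l : tL).

Lemma btensZ a b l : a *: btens b l = btens (a * b) l.
Proof. exact: base_scale_tens. Qed.

Lemma btensDr b l l' : btens b (l + l') = btens b l + btens b l'.
Proof. exact: (bilDr (tens_bilinear (B : lmodType K) L)). Qed.

Lemma btens0r b : btens b 0 = 0.
Proof. exact: (bil0r (tens_bilinear (B : lmodType K) L)). Qed.

Lemma btensZr b (k : K) l : btens b (k *: l) = btens (k *: b) l.
Proof.
have T := tens_bilinear (B : lmodType K) L.
rewrite /btens (bilZr T); exact: esym (bilZl T k b l).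
Qed.

(** Scalars of [K] are absorbed into the first factor. *)
Lemma base_ind (P : LB -> Prop) : P 0 ->
  (forall b l t, P t -> P (btens b l + t)) -> forall t, P t.
Proof.
move=> P0 PS; apply: tensor_ind => // k b l t Pt.
have := PS (k *: b) l t Pt; rewrite /btens.
by rewrite (bilZl (tens_bilinear (B : lmodType K) L)).
Qed.

Lemma base_spans (H : L -> Prop) : spans H ->
  spans (fun t : LB => exists l, H l /\ t = btens 1 l).
Proof.
move=> sH P P0 PS t; elim/base_ind: t => // b l t.
elim/sH: l t => [|k l l' Hl IH] t Pt; first by rewrite btens0r add0r.
rewrite btensDr -addrA btensZr -[k *: b]mulr1 -btensZ.
by apply: PS; [exists l|exact: IH].
Qed.

Lemma base_bilinear (c : L -> L -> L) : bilinear_map c ->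
  exists D : LB -> LB -> LB, bilinear_map D /\
    forall a b l l', D (btens a l) (btens b l') = btens (a * b) (c l l').
Proof.
move=> c_bil; have [tl tr] := tens_bilinear (B : lmodType K) L.
have [||D [D_bil DE]] := @tensor_bilinear K (B : lmodType K) L (B : lmodType K) L tL
    (fun a l b l' => tens (a * b) (c l l')).
- move=> a l; split=> [l' k b b'|b k l' l2]; last by rewrite c_bil.2 tr.
  by rewrite mulrDr -scalerAr tl.
- move=> b l'; split=> [l k a a'|a k l l2]; last by rewrite c_bil.1 tr.
  by rewrite mulrDl -scalerAl tl.
have D0l t : D 0 t = 0 := bil0l D_bil t.
have D0r t : D t 0 = 0 := bil0r D_bil t.
have DDl s s' t : D (s + s') t = D s t + D s' t := bilDl D_bil s s' t.
have DDr s t t' : D s (t + t') = D s t + D s t' := bilDr D_bil s t t'.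
exists (D : LB -> LB -> LB); split; last by move=> a b l l'; exact: DE.
have DZl (a : B) (s t : LB) : D (a *: s) t = a *: (D s t : LB).
  elim/base_ind: s => [|b l s IH]; first by rewrite scaler0 D0l scaler0.
  rewrite scalerDr [LHS]DDl IH [in RHS]DDl scalerDr; congr (_ + _).
  elim/base_ind: t {IH} => [|b' l' t IH]; first by rewrite !D0r scaler0.
  rewrite [LHS]DDr IH [in RHS]DDr scalerDr; congr (_ + _).
  by rewrite btensZ [LHS]DE [D _ _ in RHS]DE -/(btens _ _) btensZ mulrA.
have DZr (a : B) (s t : LB) : D s (a *: t) = a *: (D s t : LB).
  elim/base_ind: s => [|b l s IH]; first by rewrite !D0l scaler0.
  rewrite [LHS]DDl IH [in RHS]DDl scalerDr; congr (_ + _).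
  elim/base_ind: t {IH} => [|b' l' t IH]; first by rewrite scaler0 !D0r scaler0.
  rewrite scalerDr [LHS]DDr IH [in RHS]DDr scalerDr; congr (_ + _).
  by rewrite btensZ [LHS]DE [D _ _ in RHS]DE -/(btens _ _) btensZ mulrCA.
split=> [t a s s'|s a t t']; first by rewrite -DZl; exact: DDl.
by rewrite -DZr; exact: DDr.
Qed.

Section Fibre.
Variable ev : {lrmorphism B -> K | *%R}.

Local Notation sp := (@specialize K B L ev).

Let sp_bil : bilinear_map (fun (a : B) (l : L) => ev a *: l).
Proof.
split=> [l k a a'|a k l l'].
  by rewrite linearP scalerDl scalerA.
by rewrite scalerDr !scalerA mulrC.
Qed.

Lemma specializeD s t : sp (s + t) = sp s + sp t.
Proof.
by have := tlift_linear sp_bil 1 s t; rewrite !scale1r.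
Qed.

Lemma specialize0 : sp (0 : LB) = 0.
Proof. exact: (tlift0 sp_bil). Qed.

Lemma specialize_tens a l : sp (btens a l) = ev a *: l.
Proof. exact: (tlift_tens sp_bil). Qed.

Lemma specializeZ a (t : LB) : sp (a *: t) = ev a *: sp t.
Proof.
elim/base_ind: t => [|b l t IH]; first by rewrite scaler0 specialize0 scaler0.
by rewrite scalerDr !specializeD IH btensZ !specialize_tens rmorphM scalerDr scalerA.
Qed.

Lemma fibre_of_base_change (c : L -> L -> L) (D : LB -> LB -> LB) :
  bilinear_map c -> bilinear_map D ->
  (forall a b l l', D (btens a l) (btens b l') = btens (a * b) (c l l')) ->
  fibre_bracket ev D c.
Proof.
move=> c_bil D_bil DE s t; elim/base_ind: s => [|a l s IH].
  by rewrite (bil0l D_bil) specialize0 (bil0l c_bil).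
rewrite (bilDl D_bil) !specializeD IH (bilDl c_bil); congr (_ + _).
elim/base_ind: t {IH} => [|b l' t IH].
  by rewrite (bil0r D_bil) specialize0 (bil0r c_bil).
rewrite (bilDr D_bil) !specializeD IH (bilDr c_bil) DE !specialize_tens.
by rewrite !(bilZl c_bil) !(bilZr c_bil) scalerA rmorphM.
Qed.

Lemma fibre_bracket_comb (a : B) (D D' : LB -> LB -> LB) (c c' : L -> L -> L) :
  fibre_bracket ev D c -> fibre_bracket ev D' c' ->
  fibre_bracket ev (fun s t => D s t + a *: D' s t) (fun x y => c x y + ev a *: c' x y).
Proof. by move=> Dc Dc' s t; rewrite specializeD specializeZ Dc Dc'. Qed.

End Fibre.
End BaseChange.

(** * The basis of the Laurent polynomials *)

Section LaurentBasis.

(** Linear independence of powers is used for the Laurent polynomials and for the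
    functions on the curve, after multiplication by a common power. *)
Lemma monomials_free (K : nzRingType) (I : eqType) (s : seq I) (c : I -> K)
    (m : I -> nat) : uniq s -> {in s &, injective m} ->
  \sum_(i <- s) c i *: 'X^(m i) = 0 -> {in s, forall i, c i = 0}.
Proof.
move=> us mI S0 i si; have := congr1 (fun p : {poly K} => p`_(m i)) S0.
rewrite coef0 coef_sum (bigD1_seq i)//= coefZ coefXn eqxx mulr1.
rewrite big_seq_cond big1 ?addr0// => j /andP[sj ji]; rewrite coefZ coefXn.
by case: eqP => [/(mI _ _ si sj) E|]; [rewrite E eqxx in ji|rewrite mulr0].
Qed.

Variable K : fieldType.
Local Notation L := (laurent K).
Local Notation "p %:F" := (tofrac p).

Let X0 : ('X : {poly K})%:F != 0.
Proof. by rewrite tofrac_eq0 polyX_eq0. Qed.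

Lemma val_laurent_sum (I : Type) (s : seq I) (F : I -> L) :
  val (\sum_(i <- s) F i) = \sum_(i <- s) val (F i).
Proof. exact: (raddf_sum (val : L -> {fraction {poly K}})). Qed.

Lemma laurent_zM n m : laurent_z K n * laurent_z K m = laurent_z K (n + m).
Proof. by apply: val_inj; rewrite /= -expfzDr. Qed.

Lemma laurent_basis : is_basis (laurent_z K).
Proof.
apply: is_basis_pairs => [s c us S0|f].
  pose N := (\sum_(n <- s) `|n|)%N.
  have sN n : n \in s -> 0 <= n + N%:Z.
    move=> sn; have : (`|n| <= N)%N by rewrite /N (big_rem n)//= leq_addr.
    lia.
  apply: (monomials_free (m := fun n => `|(n + N%:Z)%R|%N)) => //.
    by move=> n m sn sm; have := sN n sn; have := sN m sm; lia.
  apply/eqP; rewrite -tofrac_eq0; apply/eqP.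
  have := congr1 (fun f : L => val f * 'X%:F ^ N%:Z) S0.
  rewrite /= mul0r val_laurent_sum mulr_suml => S0'; rewrite -[RHS]S0' rmorph_sum /=.
  apply: eq_big_seq => n sn; rewrite -mulrA -expfzDr// -mul_polyC rmorphM rmorphXn /=.
  by congr (_ * _); rewrite exprnP gez0_abs// sN.
have /asboolP[n [p fp]] := valP f.
exists [seq (p`_i, (nat_of_ord i)%:Z - n%:Z) | i : 'I_(size p)].
apply: val_inj; rewrite big_map val_laurent_sum /=.
have Xn0 : ('X^n)%:F != 0 :> {fraction {poly K}} by rewrite rmorphXn expf_neq0.
apply: (mulIf Xn0); rewrite fp -{1}[p]coefK poly_def rmorph_sum mulr_suml big_enum /=.
apply: eq_bigr => i _; rewrite -mul_polyC rmorphM !rmorphXn /= -mulrA; congr (_ * _).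
by rewrite (exprnP _ n) -(expfzDr _ _ X0) subrK.
Qed.

End LaurentBasis.

(** * The basis of the functions on the punctured curve *)

(** The points of [S] are made zeros by multiplying with [\prod ('X - s%:P)]. *)
Lemma poly_eq0_off (C : numFieldType) (S : seq C) (p : {poly C}) :
  (forall t, t \notin S -> p.[t] = 0) -> p = 0.
Proof.
move=> pS; pose m := \prod_(s <- S) ('X - s%:P).
have q0 t : (p * m).[t] = 0.
  rewrite hornerM; have [tS|tS] := boolP (t \in S); last by rewrite pS// mul0r.
  by rewrite [m.[t]](rootP _) ?mulr0// root_prod_XsubC.
have : p * m = 0.
  apply/eqP; apply: contraT => q_neq0.
  pose s : seq C := [seq k%:R | k <- iota 0 (size (p * m))].
  have roots : all (root (p * m)) s by apply/allP => t _; apply/rootP.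
  have us : uniq s.
    by rewrite map_inj_uniq ?iota_uniq// => i j /eqP; rewrite eqr_nat => /eqP.
  by have := max_poly_roots q_neq0 roots us; rewrite size_map size_iota ltnn.
by move/eqP; rewrite mulf_eq0 (negbTE (monic_neq0 (monic_prod_XsubC _ _ _))) orbF => /eqP.
Qed.

Section EllipticBasis.
Variable C : numClosedFieldType.
Variables (e1 e2 : C).
Local Notation pts := (curve_pt e1 e2).
Local Notation EA := (elliptic_alg e1 e2).
Local Notation e3 := (- (e1 + e2)).

Lemma elliptic_eq (f h : EA) : (forall q : pts, val f q = val h q) -> f = h.
Proof. by move=> fh; apply: val_inj; exact/funext. Qed.

Lemma val_ellipticX (f : EA) n (q : pts) : val (f ^+ n) q = val f q ^+ n.
Proof.
by elim: n => [|n IH]; rewrite ?expr0// !exprS -IH.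
Qed.

Lemma val_elliptic_sum (I : Type) (s : seq I) (F : I -> EA) (q : pts) :
  val (\sum_(i <- s) F i) q = \sum_(i <- s) val (F i) q.
Proof.
elim: s => [|i s IH]; first by rewrite !big_nil.
by rewrite !big_cons -IH.
Qed.

Lemma val_ellipticZ (c : C) (f : EA) (q : pts) : val (c *: f) q = c * val f q.
Proof. by []. Qed.

Lemma val_ellipticD (f h : EA) (q : pts) : val (f + h) q = val f q + val h q.
Proof. by []. Qed.

(** Negative powers use [fun_tV], as the algebra is not a field. *)
Definition tpow (k : int) : EA :=
  match k with
  | Posz n => (fun_x e1 e2 - elliptic_cst e1 e2 e1) ^+ n
  | Negz n => fun_tV e1 e2 ^+ n.+1
  end.

Lemma tpowE k (q : pts) x y : val q = hpoint x y 1 -> val (tpow k) q = (x - e1) ^ k.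
Proof.
move=> qE; case: k => n; rewrite /tpow val_ellipticX.
  have -> : val (fun_x e1 e2 - elliptic_cst e1 e2 e1) q = val (fun_x e1 e2) q - e1 by [].
  by rewrite (fun_xE qE).
by rewrite (fun_tVE qE) NegzE -exprnN exprVn.
Qed.

(** The basis that corresponds to the [A n]. *)
Definition efun (n : int) : EA :=
  if (2 %| n)%Z then tpow (n %/ 2)%Z
  else 2^-1 *: (fun_y e1 e2 * tpow ((n %/ 2)%Z - 1)).

Lemma efunE n (q : pts) x y : val q = hpoint x y 1 -> val (efun n) q =
  if (2 %| n)%Z then (x - e1) ^ (n %/ 2)%Z
  else 2^-1 * (y * (x - e1) ^ ((n %/ 2)%Z - 1)).
Proof.
move=> qE; rewrite /efun; case: ifP => _; first exact: tpowE qE.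
by rewrite val_ellipticZ -(tpowE _ qE) -(fun_yE qE).
Qed.

Lemma efunM n m : efun n * efun m =
  if (2 %| n)%Z || (2 %| m)%Z then efun (n + m)
  else efun (n + m) + (3 * e1) *: efun (n + m - 2)
       + ((e1 - e2) * (2 * e1 + e2)) *: efun (n + m - 4).
Proof.
apply: elliptic_eq => q; have [x [y [qE yE xe]]] := curve_ptP q.
have t0 : x - e1 != 0 by rewrite subr_eq0.
have -> : val (efun n * efun m) q = val (efun n) q * val (efun m) q by [].
have tD (i j k : int) : k = i + j -> (x - e1) ^ k = (x - e1) ^ i * (x - e1) ^ j.
  by move=> ->; rewrite expfzDr.
have [n2|n2] := boolP (2 %| n)%Z.
  rewrite !(efunE _ qE) n2 /=.
  have -> : (2 %| (n + m)%R)%Z = (2 %| m)%Z by lia.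
  have [m2|m2] := boolP (2 %| m)%Z; first by apply/esym/tD; lia.
  rewrite (tD (n %/ 2)%Z ((m %/ 2)%Z - 1) (((n + m)%R %/ 2)%Z - 1)); [ring|lia].
have [m2|m2] := boolP (2 %| m)%Z.
  rewrite /= !(efunE _ qE) (negbTE n2) m2.
  have -> : (2 %| (n + m)%R)%Z = false by lia.
  rewrite (tD ((n %/ 2)%Z - 1) (m %/ 2)%Z (((n + m)%R %/ 2)%Z - 1)); [ring|lia].
rewrite orbF !val_ellipticD !val_ellipticZ !(efunE _ qE) (negbTE n2) (negbTE m2).
have -> : (2 %| (n + m)%R)%Z by lia.
have -> : (2 %| (n + m - 2)%R)%Z by lia.
have -> : (2 %| (n + m - 4)%R)%Z by lia.
set i := ((n %/ 2)%Z - 1); set j := ((m %/ 2)%Z - 1).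
have -> : ((n + m)%R %/ 2)%Z = 1 + (1 + (1 + (i + j))) by rewrite /i /j; lia.
have -> : ((n + m - 2)%R %/ 2)%Z = 1 + (1 + (i + j)) by rewrite /i /j; lia.
have -> : ((n + m - 4)%R %/ 2)%Z = 1 + (i + j) by rewrite /i /j; lia.
clearbody i j; rewrite !(expfzDr _ _ t0) expr1z.
have -> : 2^-1 * (y * (x - e1) ^ i) * (2^-1 * (y * (x - e1) ^ j)) =
    4^-1 * y ^+ 2 * ((x - e1) ^ i * (x - e1) ^ j) by field.
by rewrite yE /weierstrass_cubic; field.
Qed.

(** Adding and subtracting the values at [(x, y)] and [(x, -y)] separates even
    and odd indices; what remains are two Laurent polynomials in [x - e1] that
    vanish at all but finitely many points. *)
Lemma efun_free (s : seq int) (c : int -> C) : uniq s ->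
  \sum_(n <- s) c n *: efun n = 0 -> {in s, forall n, c n = 0}.
Proof.
move=> us S0.
pose N := (\sum_(n <- s) `|n|)%N.+1.
have sN n : n \in s -> 0 <= (n %/ 2)%Z - 1 + N%:Z.
  move=> sn; have : (`|n| < N)%N by rewrite /N ltnS (big_rem n)//= leq_addr.
  lia.
pose ev := [seq n <- s | (2 %| n)%Z]; pose od := [seq n <- s | ~~ (2 %| n)%Z].
pose m n := `|((n %/ 2)%Z - 1 + N%:Z)%R|%N.
pose P (l : seq int) := \sum_(n <- l) c n *: 'X^(m n) : {poly C}.
have PE l (t : C) : t != 0 -> {subset l <= s} ->
    (P l).[t] = (\sum_(n <- l) c n * t ^ ((n %/ 2)%Z - 1)) * t ^+ N.
  move=> t0 ls; rewrite horner_sum mulr_suml; apply: eq_big_seq => n nl.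
  rewrite hornerZ hornerXn -mulrA; congr (_ * _).
  by rewrite (exprnP _ N) -(expfzDr _ _ t0) exprnP gez0_abs// sN// ls.
have evs : {subset ev <= s} by move=> n; rewrite mem_filter => /andP[].
have ods : {subset od <= s} by move=> n; rewrite mem_filter => /andP[].
have P0 t : t \notin [:: 0; e2 - e1; e3 - e1] -> (P ev).[t] = 0 /\ (P od).[t] = 0.
  rewrite !inE !negb_or => /and3P[t0 t2 t3].
  pose x := t + e1; have xt : x - e1 = t by rewrite /x addrK.
  pose y := sqrtC (weierstrass_cubic e1 e2 x).
  have y2 : y ^+ 2 = weierstrass_cubic e1 e2 x by exact: sqrtCK.
  have yN2 : (- y) ^+ 2 = weierstrass_cubic e1 e2 x by rewrite sqrrN.
  have xe : x != e1 by rewrite -subr_eq0 xt.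
  have y0 : y != 0.
    rewrite -(sqrf_eq0 y) y2 /weierstrass_cubic xt !mulf_neq0 ?pnatr_eq0//.
      by rewrite /x -addrA addr_eq0 opprB.
    by rewrite /x -addrA addr_eq0 opprB.
  have [q qE] := curve_pt_ex y2 xe; have [q' q'E] := curve_pt_ex yN2 xe.
  pose sE := \sum_(n <- ev) c n * t ^ ((n %/ 2)%Z - 1).
  pose sO := \sum_(n <- od) c n * t ^ ((n %/ 2)%Z - 1).
  have vE (q0 : pts) z : val q0 = hpoint x z 1 ->
      t * sE + 2^-1 * z * sO = 0.
    move=> zE; have := congr1 (fun f : EA => val f q0) S0.
    rewrite val_elliptic_sum (eq_bigr (fun n => c n * (if (2 %| n)%Z
      then t ^ (n %/ 2)%Z else 2^-1 * (z * t ^ ((n %/ 2)%Z - 1))))); last first.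
      by move=> n _; rewrite val_ellipticZ (efunE _ zE) xt.
    move=> S0q; rewrite -[RHS]S0q (bigID (fun n => (2 %| n)%Z)) /= /sE /sO !big_filter.
    rewrite !mulr_sumr; congr (_ + _); apply: eq_bigr => n n2.
      by rewrite n2 mulrCA -{1}[t]expr1z -(expfzDr _ _ t0) addrC subrK.
    by rewrite (negbTE n2); ring.
  have h1 := vE q y qE; have h2 := vE q' (- y) q'E.
  have sE0 : sE = 0.
    apply: (mulfI t0); apply: (mulfI (_ : 2 != 0 :> C)); first by rewrite pnatr_eq0.
    rewrite !mulr0 -[RHS](addr0 0) -{1}h1 -h2; ring.
  have sO0 : sO = 0.
    move: h1; rewrite sE0 mulr0 add0r => /eqP.
    by rewrite !mulf_eq0 (negbTE y0) invr_eq0 pnatr_eq0 => /eqP.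
  by rewrite !PE// -/sE -/sO sE0 sO0 !mul0r.
have Pev : P ev = 0 by apply: poly_eq0_off => t /P0[].
have Pod : P od = 0 by apply: poly_eq0_off => t /P0[].
have mI (l : seq int) : {subset l <= s} -> {in l &, forall i j, (2 %| i)%Z = (2 %| j)%Z} ->
    {in l &, injective m}.
  move=> ls l2 i j il jl; have := sN i (ls i il); have := sN j (ls j jl).
  by have := l2 i j il jl; rewrite /m; lia.
move=> n ns; have [n2|n2] := boolP (2 %| n)%Z.
  apply: (monomials_free (s := ev) (m := m)) => //.
  - exact: filter_uniq.
  - by apply: mI => // i j; rewrite !mem_filter => /andP[-> _] /andP[-> _].
  - by rewrite mem_filter n2.
apply: (monomials_free (s := od) (m := m)) => //.
- exact: filter_uniq.
- apply: mI => // i j; rewrite !mem_filter => /andP[/negbTE-> _].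
  by move=> /andP[/negbTE-> _].
- by rewrite mem_filter n2.
Qed.

Hypothesis cauchy : cauchy_estimate C.
Hypothesis arch : forall x : C, exists n : nat, `|x| <= n%:R.
Hypotheses (e12 : e1 != e2) (e13 : e1 != e3) (e23 : e2 != e3).

Lemma efun_basis : is_basis efun.
Proof.
apply: is_basis_pairs; first exact: efun_free.
move=> f; have [n [p [r fE]]] := elliptic_structure cauchy arch e12 e13 e23 f.
pose p' := p \Po ('X + e1%:P); pose r' := r \Po ('X + e1%:P).
exists ([seq (p'`_i, 2 * ((nat_of_ord i)%:Z - n%:Z)) | i : 'I_(size p')]
     ++ [seq (2 * r'`_i, 2 * ((nat_of_ord i)%:Z - n%:Z + 1) + 1) | i : 'I_(size r')]).
apply: elliptic_eq => q; have [x [y [qE yE xe]]] := curve_ptP q.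
have t0 : x - e1 != 0 by rewrite subr_eq0.
have tn0 : (x - e1) ^+ n != 0 by rewrite expf_neq0.
apply: (mulfI tn0); rewrite (fE _ _ _ qE) val_elliptic_sum.
rewrite (eq_bigr (fun c => c.1 * (if (2 %| c.2)%Z then (x - e1) ^ (c.2 %/ 2)%Z
    else 2^-1 * (y * (x - e1) ^ ((c.2 %/ 2)%Z - 1))))); last first.
  by move=> c _; rewrite val_ellipticZ (efunE _ qE).
rewrite big_cat !big_map mulrDr -!enumT !big_enum !mulr_sumr.
have -> : p.[x] = p'.[x - e1] by rewrite horner_comp hornerD hornerX hornerC subrK.
have -> : r.[x] = r'.[x - e1] by rewrite horner_comp hornerD hornerX hornerC subrK.
have tE (i : nat) : (x - e1) ^+ n * (x - e1) ^ (i%:Z - n%:Z) = (x - e1) ^+ i.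
  by rewrite (exprnP _ n) -(expfzDr _ _ t0) [n%:Z + _]addrC subrK.
rewrite !horner_coef; congr (_ + _).
  apply: eq_bigr => i _ /=.
  have -> : (2 %| (2 * ((nat_of_ord i)%:Z - n%:Z))%R)%Z by lia.
  have -> : ((2 * ((nat_of_ord i)%:Z - n%:Z))%R %/ 2)%Z = (nat_of_ord i)%:Z - n%:Z by lia.
  by rewrite mulrCA tE.
rewrite mulr_sumr; apply: eq_bigr => i _ /=.
set k : int := _ - _.
have -> : (2 %| (2 * (k + 1) + 1)%R)%Z = false by lia.
have -> : ((2 * (k + 1) + 1)%R %/ 2)%Z - 1 = k by lia.
by rewrite -(tE i) -/k; field.
Qed.

End EllipticBasis.

(** * Transport of brackets *)

Section Assembly.
Variable (R : realType).
Local Notation C := R[i].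

Lemma complex_arch (x : C) : exists n : nat, `|x| <= n%:R.
Proof.
have xr : `|x| = (complex.Re `|x|)%:C by rewrite RRe_real.
exists (Num.Def.archi_bound (complex.Re `|x|)).
rewrite xr -(rmorph_nat (real_complex R)) lecR ltW// archi_boundP// -lecR -xr.
exact: normr_ge0.
Qed.

End Assembly.

Lemma lmod_double_eq0 (K : numFieldType) (M : lmodType K) (u : M) :
  u + u = 0 -> u = 0.
Proof.
by rewrite -mulr2n -scaler_nat => /eqP; rewrite scaler_eq0 pnatr_eq0 /= => /eqP.
Qed.

Lemma tens_map_comb (K : comNzRingType) (g V V' : lmodType K)
    (f : {linear V -> V'}) (a b : K) (r s t : tensor g V) :
  tens_map f (r + a *: s + b *: t) =
    tens_map f r + a *: tens_map f s + b *: tens_map f t.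
Proof.
have [F FE] := linear_pack (@tens_map_linear _ g _ _ f).
by rewrite -!FE !linearD !linearZ.
Qed.

Section TransportLie.
Variables (K : comNzRingType) (g V V' : lmodType K) (A : int -> V).
Hypothesis HA : is_basis A.

Lemma tens_map_lie_iso (b : tensor g V -> tensor g V -> tensor g V)
    (b' : tensor g V' -> tensor g V' -> tensor g V')
    (f : {linear V -> V'}) (h : {linear V' -> V}) :
  bilinear_map b -> bilinear_map b' -> cancel f h -> cancel h f ->
  (forall x y n m, tens_map f (b (tens x (A n)) (tens y (A m))) =
     b' (tens x (f (A n))) (tens y (f (A m)))) ->
  lie_iso b b' (tens_map f).
Proof.
move=> bb bb' fK hK E; split; last exact: tens_map_bij fK hK.
split; first exact: tens_map_linear.
have [F FE] := linear_pack (@tens_map_linear _ g _ _ f).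
move=> s t; rewrite -!FE.
apply: (bil_ext (bilinear_comp idfun idfun F bb) (bilinear_comp F F idfun bb')
  (on_tensors_spans HA) (on_tensors_spans HA)) => _ _ [x [n ->]] [y [m ->]] /=.
by rewrite !FE !tens_map_tens E.
Qed.

End TransportLie.

(** * The theorem *)

Theorem theorem4p2 (R : realType) (g : vectType R[i]) (br : g -> g -> g)
    (Hbr : lie_bracket br) (V : lmodType R[i]) (A : int -> V)
    (HA : is_basis A) :
  (forall e1 e2 : R[i], exists b : tensor g V -> tensor g V -> tensor g V,
     [/\ family_bracket br A e1 e2 b,
         (forall b', family_bracket br A e1 e2 b' -> b' =2 b) &
         lie_bracket b]) /\
  (exists theta : {linear V -> laurent R[i]},
     [/\ bijective theta, (forall n, theta (A n) = laurent_z R[i] n) &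
      exists D : base_ext {mpoly R[i][2]} (tensor g (laurent R[i])) ->
                 base_ext {mpoly R[i][2]} (tensor g (laurent R[i])) ->
                 base_ext {mpoly R[i][2]} (tensor g (laurent R[i])),
        deformation (eval2 0 0) (current_bracket br (B := laurent R[i])) D /\
        forall (e1 e2 : R[i]) (b : tensor g V -> tensor g V -> tensor g V),
          family_bracket br A e1 e2 b ->
          exists b' : tensor g (laurent R[i]) -> tensor g (laurent R[i]) ->
                      tensor g (laurent R[i]),
          [/\ fibre_bracket (eval2 e1 e2) D b',
              lie_bracket b',
              lie_iso b b' (tens_map theta),
              (e1 = 0 -> e2 = 0 ->
                 b' =2 current_bracket br (B := laurent R[i])) &
              let e3 := - (e1 + e2) in
              [/\ e1 != e2, e1 != e3 & e2 != e3] ->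
              exists phi : {linear laurent R[i] -> elliptic_alg e1 e2},
                bijective phi /\
                lie_iso b' (current_bracket br (B := elliptic_alg e1 e2))
                  (tens_map phi)]]).
Proof.
have [br_bil _ _] := Hbr.
pose L : lmodType R[i] := laurent R[i]; pose z : int -> L := laurent_z R[i].
have Hz : is_basis z := laurent_basis R[i].
split=> [e1 e2|].
  have [b bF] := family_bracket_ex br_bil HA e1 e2; exists b; split=> //.
    by move=> b' b'F; apply: (family_bracket_unique HA bF b'F).
  by apply: (family_bracket_lie HA _ Hbr bF); exact: lmod_double_eq0.
have [theta thetaE] := basis_lift HA z.
have [theta' [thetaK theta'K]] := basis_bij HA Hz thetaE.
exists theta; split; [by exists theta'|exact: thetaE|].
have [c0 C0] := component_ex br_bil Hz 0; have [c1 C1] := component_ex br_bil Hz 1.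
have [c2 C2] := component_ex br_bil Hz 2.
pose B : comAlgType R[i] := {mpoly R[i][2]}.
have [D0 [D0_bil D0E]] := base_bilinear B C0.1.
have [D1 [D1_bil D1E]] := base_bilinear B C1.1.
have [D2 [D2_bil D2E]] := base_bilinear B C2.1.
pose X0 : B := 'X_(0 : 'I_2); pose X1 : B := 'X_(1 : 'I_2).
pose p : B := 3 * X0; pose q : B := (X0 - X1) * (2 * X0 + X1).
pose D s t := D0 s t + p *: D1 s t + q *: D2 s t.
have D_bil : bilinear_map D := bilinear_comb q (bilinear_comb p D0_bil D1_bil) D2_bil.
pose b' e1 e2 s t := c0 s t + (3 * e1) *: c1 s t
   + ((e1 - e2) * (2 * e1 + e2)) *: c2 s t.
have b'F e1 e2 : family_bracket br z e1 e2 (b' e1 e2).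
  exact: family_of_components.
have D_fibre e1 e2 : fibre_bracket (eval2 e1 e2) D (b' e1 e2).
  have F0 := @fibre_of_base_change _ _ _ (eval2 e1 e2) _ _ C0.1 D0_bil D0E.
  have F1 := @fibre_of_base_change _ _ _ (eval2 e1 e2) _ _ C1.1 D1_bil D1E.
  have F2 := @fibre_of_base_change _ _ _ (eval2 e1 e2) _ _ C2.1 D2_bil D2E.
  have := fibre_bracket_comb q (fibre_bracket_comb p F0 F1) F2.
  have E0 : eval2 e1 e2 X0 = e1 by rewrite /eval2 /= mevalXU.
  have E1 : eval2 e1 e2 X1 = e2 by rewrite /eval2 /= mevalXU.
  have evM (r s : B) : eval2 e1 e2 (r * s) = eval2 e1 e2 r * eval2 e1 e2 s.
    exact: rmorphM.
  have evD (r s : B) : eval2 e1 e2 (r + s) = eval2 e1 e2 r + eval2 e1 e2 s.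
    exact: rmorphD.
  have evB (r s : B) : eval2 e1 e2 (r - s) = eval2 e1 e2 r - eval2 e1 e2 s.
    exact: rmorphB.
  have evn n : eval2 e1 e2 (n%:R : B) = n%:R by exact: rmorph_nat.
  have -> : eval2 e1 e2 p = 3 * e1 by rewrite evM evn E0.
  have -> : eval2 e1 e2 q = (e1 - e2) * (2 * e1 + e2).
    by rewrite evM evB evD evM evn E0 E1.
  exact.
have b'0 : b' 0 0 =2 current_bracket br (B := laurent R[i]).
  apply: (bil_ext (b'F 0 0).1 (current_bracket_bilinear _ br_bil)
    (on_tensors_spans Hz) (on_tensors_spans Hz)) => _ _ [x [n ->]] [y [m ->]].
  rewrite (b'F 0 0).2 current_bracketE// laurent_zM.
  by rewrite !mulr0 addr0 mulr0 !scale0r !addr0 if_same.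
exists D; split.
  split; last by move=> s t; rewrite (D_fibre 0 0) b'0.
  apply: (@family_lie _ g br Hbr B _ (fun x n => btens (1 : B) (tens x (z n))) p q D) => //.
  - by move=> x y n; rewrite (bilDl (tens_bilinear g L)) btensDr.
  - move=> P P0 PS; apply: (base_spans (on_tensors_spans Hz)) => // a u t [l [[x [n ->]] ->]].
    by apply: PS; exists x, n.
  - by move=> u; exact: (@lmod_double_eq0 R[i] (tensor (B : lmodType R[i]) _) u).
  - move=> x y n m; rewrite /D D0E D1E D2E mulr1 C0.2 C1.2 C2.2 /= muln0 subr0.
    by case: ifP => _; rewrite ?btens0r ?scaler0 ?addr0.
move=> e1 e2 b bF; exists (b' e1 e2).
have b'_lie : lie_bracket (b' e1 e2).
  by apply: (family_bracket_lie Hz _ Hbr (b'F e1 e2)); exact: lmod_double_eq0.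
split=> //.
- apply: (tens_map_lie_iso HA bF.1 (b'F e1 e2).1 thetaK theta'K) => x y n m.
  rewrite bF.2 !thetaE (b'F e1 e2).2.
  by case: ifP => _; rewrite ?tens_map_comb !tens_map_tens !thetaE.
- by move=> -> ->; exact: b'0.
move=> e3 [e12 e13 e23].
have arch := @complex_arch R.
have Hf := efun_basis (@complex_cauchy_estimate R) arch e12 e13 e23.
have [phi phiE] := basis_lift Hz (@efun R[i] e1 e2).
have [phi' [phiK phi'K]] := basis_bij Hz Hf phiE.
exists phi; split; first by exists phi'.
apply: (tens_map_lie_iso Hz (b'F e1 e2).1 _ phiK phi'K) => [|x y n m].
  exact: current_bracket_bilinear.
rewrite (b'F e1 e2).2 !phiE current_bracketE// efunM.
case: ifP => _; first by rewrite tens_map_tens phiE.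
have T := tens_bilinear g (elliptic_alg e1 e2).
by rewrite tens_map_comb !tens_map_tens !phiE !(bilDr T) !(bilZr T).
Qed.
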